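(* Let $\mu$ be a probability measure on $\mathbb{R}^d$ with density $\phi$. Assume that $\phi$ is even and that its Fourier transform is positive and integrable. Consider the function $$G(q):=S_{\mu^n}(\sqrt q),\qquad q\in\Delta^{n-1},$$ where $\sqrt q:=(\sqrt{q_1},\ldots,\sqrt{q_n})$. Then: 1) If for each $t\in\mathbb{R}^d$ the function $r\mapsto\hat\phi(\sqrt r\,t)$ is log-convex on $[0,+\infty)$, then $G$ is log-convex. 2) If for each $t\in\mathbb{R}^d$ the function $r\mapsto\hat\phi(\sqrt r\,t)$ is log-concave on $[0,+\infty)$, then $G$ is Schur concave.
   Context: Fourier transform convention: $\hat f(x)=\int_{\mathbb{R}^d}f(y)e^{-2\pi i\langle x,y\rangle}dy$; ''positive'' means $\ge0$. Since $\hat\phi$ is integrable, $\phi$ denotes its continuous representative. $\Delta^{n-1}=\{a\in[0,1]^n: a_1+\cdots+a_n=1\}$. For $y\in\mathbb{R}^n\setminus\{0\}$ let $H_y=\{x=(x_1,\ldots,x_n)\in(\mathbb{R}^d)^n=\mathbb{R}^{nd}: y_1x_1+\cdots+y_nx_n=0\}$, and define the (block) section function $S_{\mu^n}(y)=\int_{H_y}\prod_{k=1}^n\phi(x_k)\,\mathcal{H}^{nd-d}(dx)$, with $\mathcal{H}^{nd-d}$ the $(nd-d)$-dimensional Hausdorff measure. A function $f:C\to[0,\infty)$ on a convex set $C$ is log-convex (resp. log-concave) if $f(\lambda x+(1-\lambda)y)\le f(x)^\lambda f(y)^{1-\lambda}$ (resp. $\ge$) for all $x,y\in C$, $\lambda\in(0,1)$.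 For $x,y\in\mathbb{R}^n$, write $x\prec y$ if, after rearranging the coordinates of each in decreasing order, $x_1+\cdots+x_i\le y_1+\cdots+y_i$ for $i=1,\ldots,n-1$ and $x_1+\cdots+x_n=y_1+\cdots+y_n$. $f$ is Schur concave if $x\prec y$ implies $f(x)\ge f(y)$ for all $x,y$ in its domain. *)

(* Defs.v *)
From HB Require Import structures.
From mathcomp Require Import all_boot all_order all_algebra.
From mathcomp Require Import all_classical all_reals all_analysis.
From mathcomp.real_closed Require Import complex.

Set Implicit Arguments.
Unset Strict Implicit.
Unset Printing Implicit Defensive.

Import Order.TTheory GRing.Theory Num.Theory.
Import numFieldNormedType.Exports.

Local Open Scope classical_set_scope.
Local Open Scope ring_scope.

(* R^d is 'rV[R]_d and (R^d)^n = R^(nd) is 'M[R]_(n, d), the point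
   (x_1, ..., x_n) being the matrix with rows x_k.  Both carry the sigma-algebra
   generated by the coordinates, i.e. the Borel sigma-algebra. *)

Section measurable_matrix.
Context {R : realType} (m n : nat).

Definition mx_sigma_algebra : set (set 'M[R]_(m, n)) :=
  <<s [set A | exists i j, exists2 B : set R, measurable B &
               A = [set M : 'M[R]_(m, n) | B (M i j)]] >>.

Let mx_set0 : mx_sigma_algebra set0.
Proof. exact: sigma_algebra0. Qed.

Let mx_setC A : mx_sigma_algebra A -> mx_sigma_algebra (~` A).
Proof. exact: sigma_algebraC. Qed.

Let mx_bigcup (F : _^nat) : (forall i, mx_sigma_algebra (F i)) ->
  mx_sigma_algebra (\bigcup_i (F i)).
Proof. exact: sigma_algebra_bigcup. Qed.

HB.instance Definition _ := @isMeasurable.Build default_measure_display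
  'M[R]_(m, n) mx_sigma_algebra mx_set0 mx_setC mx_bigcup.

End measurable_matrix.

Lemma product_sigma_finite d1 d2 (T1 : measurableType d1)
    (T2 : measurableType d2) (R : realType)
    (m1 : {sigma_finite_measure set T1 -> \bar R})
    (m2 : {sigma_finite_measure set T2 -> \bar R}) :
  sigma_finite setT (m1 \x m2)%E.
Proof.
have /sigma_finiteP[F [TF ndF Foo]] := sigma_finiteT m1.
have /sigma_finiteP[G [TG ndG Goo]] := sigma_finiteT m2.
exists (fun n => F n `*` G n).
  rewrite -setXTT TF TG predeqE => -[x y]; split.
    move=> [/= [n _ Fnx] [k _ Gky]]; exists (maxn n k) => //; split.
    - by move: x Fnx; exact/subsetPset/ndF/leq_maxl.
    - by move: y Gky; exact/subsetPset/ndG/leq_maxr.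
  by move=> [n _ []/= ? ?]; split; exists n.
move=> k; have [? ?] := Foo k; have [? ?] := Goo k.
split; first exact: measurableX.
by rewrite product_measure1E// lte_mul_pinfty// ge0_fin_numE.
Qed.

Section lebesgue_rV.
Context {R : realType}.

Definition row_cons n (p : measurableTypeR R * 'rV[R]_n) : 'rV[R]_n.+1 :=
  \row_(i < n.+1) oapp (p.2 ord0) (p.1 : R) (unlift ord0 i).

Lemma measurable_row_cons n : measurable_fun setT (@row_cons n).
Proof.
move=> _ A mA; rewrite setTI.
pose M := [set A : set 'rV[R]_n.+1 | measurable ((@row_cons n) @^-1` A)].
suff : measurable `<=` M by exact.
apply: smallest_sub.
  split=> [|B MB|F MF]; rewrite /M /=.
  - by rewrite preimage_set0.
  - by rewrite setTD preimage_setC; exact: measurableC.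
  - by rewrite preimage_bigcup; exact: bigcupT_measurable.
move=> _ [i [j [B mB ->]]]; rewrite /M /=.
have -> : @row_cons n @^-1` [set M | B (M i j)] =
    if unlift ord0 j is Some k then
      snd @^-1` [set v : 'rV[R]_n | B (v ord0 k)]
    else fst @^-1` (B : set (measurableTypeR R)).
  apply/seteqP; split => -[x v] /=; rewrite /row_cons /= mxE;
  by case: (unlift ord0 j).
case: (unlift ord0 j) => [k|].
  rewrite -[X in measurable X]setTI; apply: measurable_snd => //.
  by apply: (@sub_sigma_algebra _ setT); exists ord0, k; exists B.
by rewrite -[X in measurable X]setTI; apply: measurable_fst.
Qed.

Section succ.
Context n (mu : {sigma_finite_measure set 'rV[R]_n -> \bar R}).

Definition lebesgue_rV_succ : set 'rV[R]_n.+1 -> \bar R :=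
  pushforward (lebesgue_measure \x mu)%E (@row_cons n).

Let lebesgue_rV_succ0 : lebesgue_rV_succ set0 = 0%E.
Proof. by rewrite /lebesgue_rV_succ /pushforward preimage_set0 measure0. Qed.

Let lebesgue_rV_succ_ge0 A : (0 <= lebesgue_rV_succ A)%E.
Proof. exact: (measure_ge0 (lebesgue_measure \x mu)%E). Qed.

Let lebesgue_rV_succ_sigma_additive : semi_sigma_additive lebesgue_rV_succ.
Proof.
move=> F mF tF mUF; rewrite /lebesgue_rV_succ /pushforward preimage_bigcup.
have mp A : measurable A -> measurable (@row_cons n @^-1` A).
  by move=> mA; rewrite -[X in measurable X]setTI; exact: measurable_row_cons.
apply: measure_semi_sigma_additive.
- by move=> k; exact: mp.
- apply/trivIsetP => i j _ _ ij; rewrite -preimage_setI.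
  by move/trivIsetP : tF => /(_ _ _ Logic.I Logic.I ij) ->; rewrite preimage_set0.
- by rewrite -preimage_bigcup; exact: mp.
Qed.

HB.instance Definition _ := isMeasure.Build _ _ _ lebesgue_rV_succ
  lebesgue_rV_succ0 lebesgue_rV_succ_ge0 lebesgue_rV_succ_sigma_additive.

Let lebesgue_rV_succ_sigma_finite : sigma_finite setT lebesgue_rV_succ.
Proof.
pose uncons (w : 'rV[R]_n.+1) : measurableTypeR R * 'rV[R]_n :=
  (w ord0 ord0, \row_j w ord0 (lift ord0 j)).
have unconsK : cancel uncons (@row_cons n).
  move=> w; apply/rowP => i; rewrite mxE /uncons /=.
  by case: unliftP => [j ->|->] //=; rewrite mxE.
have row_consK : cancel (@row_cons n) uncons.
  move=> [x v]; congr (_, _); first by rewrite mxE unlift_none.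
  by apply/rowP => j; rewrite !mxE liftK.
have muncons : measurable_fun setT uncons.
  apply/measurable_fun_pairP; split.
    move=> _ B mB; rewrite setTI; apply: (@sub_sigma_algebra _ setT).
    by exists ord0, ord0; exists B.
  move=> _ A mA; rewrite setTI.
  pose M := [set A : set 'rV[R]_n | measurable ((snd \o uncons) @^-1` A)].
  suff : measurable `<=` M by exact.
  apply: smallest_sub.
    split=> [|B MB|F MF]; rewrite /M /=.
    - by rewrite preimage_set0.
    - by rewrite setTD preimage_setC; exact: measurableC.
    - by rewrite preimage_bigcup; exact: bigcupT_measurable.
  move=> _ [i [j [B mB ->]]]; rewrite /M /=; apply: (@sub_sigma_algebra _ setT).
  exists ord0, (lift ord0 j); exists B => //.
  by apply/seteqP; split => w /=; rewrite mxE.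
have [F FT Foo] := product_sigma_finite (@lebesgue_measure R) mu.
exists (fun k => uncons @^-1` F k).
  by rewrite -preimage_bigcup -FT preimage_setT.
move=> k; have [mF muF] := Foo k; split.
  by rewrite -[X in measurable X]setTI; exact: muncons.
rewrite /lebesgue_rV_succ /pushforward -comp_preimage.
by rewrite (_ : uncons \o _ = id) ?preimage_id//; apply/funext.
Qed.

HB.instance Definition _ := @Measure_isSigmaFinite.Build _ _ _ lebesgue_rV_succ
  lebesgue_rV_succ_sigma_finite.

End succ.

(* Lebesgue measure on R^n as the n-fold product of Lebesgue measure on R;
   on R^0 it is the unit point mass *)
Fixpoint lebesgue_rV n : {sigma_finite_measure set 'rV[R]_n -> \bar R} :=
  match n with
  | 0%N => @dirac _ 'rV[R]_0 0 R
  | n'.+1 => lebesgue_rV_succ (lebesgue_rV n')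
  end.

End lebesgue_rV.
Arguments lebesgue_rV {R} n.

Section euclidean.
Context {R : realType}.

Definition inner_prod d (x y : 'rV[R]_d) : R := \sum_i x ord0 i * y ord0 i.

(* the norm of the library on matrices is the sup norm *)
Definition euclidean_norm p q (x : 'M[R]_(p, q)) : R :=
  Num.sqrt (\sum_i \sum_j x i j ^+ 2).

Definition diam p q (A : set 'M[R]_(p, q)) : \bar R :=
  ereal_sup [set (euclidean_norm (xy.1 - xy.2))%:E | xy in A `*` A].

End euclidean.

Section hausdorff.
Context {R : realType} (p q m : nat).
Local Open Scope ereal_scope.

(* volume of the m-dimensional ball of diameter 1, which normalizes the
   Hausdorff measure to agree with Lebesgue measure on R^m *)
Definition hausdorff_const : \bar R :=
  lebesgue_rV m [set x : 'rV[R]_m | (euclidean_norm x <= 1)%R] *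
  (2^-1 ^+ m)%:E.

(* the case distinction matters for m = 0, where x ^+ 0 = 1 *)
Definition hausdorff_gauge (A : set 'M[R]_(p, q)) : \bar R :=
  if A == set0 then 0 else hausdorff_const * diam A ^+ m.

Definition hausdorff_premeasure (delta : R) (A : set 'M[R]_(p, q)) : \bar R :=
  ereal_inf [set \sum_(k <oo) hausdorff_gauge (F k) |
    F in [set F : (set 'M[R]_(p, q))^nat |
          A `<=` \bigcup_k F k /\ forall k, diam (F k) <= delta%:E]].

Definition hausdorff_outer (A : set 'M[R]_(p, q)) : \bar R :=
  ereal_sup [set hausdorff_premeasure delta A |
    delta in [set delta : R | (0 < delta)%R]].

Lemma hausdorff_gauge_ge0 A : 0 <= hausdorff_gauge A.
Proof.
rewrite /hausdorff_gauge; case: ifPn => // /set0P[x Ax].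
rewrite mule_ge0//.
  by rewrite mule_ge0// lee_fin exprn_ge0// invr_ge0.
rewrite expe_ge0// (@le_trans _ _ (euclidean_norm (x - x))%:E)//.
  by rewrite lee_fin sqrtr_ge0.
by apply: ereal_sup_ubound; exists (x, x).
Qed.

Lemma hausdorff_premeasure_sigma_subadditive delta :
  sigma_subadditive (hausdorff_premeasure delta).
Proof.
pose T := g_sigma_algebraType [set: set 'M[R]_(p, q)].
pose g (A : set T) : \bar R :=
  if diam (A : set 'M[R]_(p, q)) <= delta%:E then hausdorff_gauge A else +oo.
have g_ge0 A : 0 <= g A.
  by rewrite /g; case: ifP => // _; exact: hausdorff_gauge_ge0.
have -> : hausdorff_premeasure delta = mu_ext g; last first.
  exact: (@mu_ext_sigma_subadditive _ T R g g_ge0).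
apply/funext => A; apply/eqP; rewrite eq_le; apply/andP; split.
  apply: le_ereal_inf_tmp => _ [F [_ AF] <-].
  have [dF|] := pselect (forall k, diam (F k : set 'M[R]_(p, q)) <= delta%:E).
    apply: ereal_inf_lbound; exists F => //.
    by apply: eq_eseriesr => k _; rewrite /g dF.
  move=> /existsNP[k /negP/negbTE dF].
  by rewrite (@eseries_pinfty _ _ _ k) ?leey// /g ?dF// => n _; rewrite -ltNye (lt_le_trans _ (g_ge0 _)).
apply: le_ereal_inf_tmp => _ [F [AF dF] <-].
apply: ereal_inf_lbound; exists F.
  by split => // k; exact: sub_sigma_algebra.
by apply: eq_eseriesr => k _; rewrite /g dF.
Qed.

Lemma hausdorff_premeasure_ge0 delta A : 0 <= hausdorff_premeasure delta A.
Proof.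
apply: le_ereal_inf_tmp => _ [F _ <-]; apply: nneseries_ge0 => k _ _.
exact: hausdorff_gauge_ge0.
Qed.

Lemma hausdorff_premeasure_le_outer delta A : (0 < delta)%R ->
  hausdorff_premeasure delta A <= hausdorff_outer A.
Proof. by move=> d0; apply: ereal_sup_ubound; exists delta. Qed.

Let hausdorff_outer_ge0 A : 0 <= hausdorff_outer A.
Proof.
exact: le_trans (hausdorff_premeasure_ge0 1 A)
                (hausdorff_premeasure_le_outer A ltr01).
Qed.

Let hausdorff_outer0 : hausdorff_outer set0 = 0.
Proof.
apply/eqP; rewrite eq_le hausdorff_outer_ge0 andbT.
apply: ge_ereal_sup => _ [delta /= d0 <-]; apply: ereal_inf_lbound.
exists (fun=> set0).
  by split=> // k; rewrite /diam set0X image_set0 ereal_sup0 leNye.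
by rewrite eseries0// => k _ _; rewrite /hausdorff_gauge eqxx.
Qed.

Let le_hausdorff_outer : {homo hausdorff_outer : A B / A `<=` B >-> A <= B}.
Proof.
move=> A B AB; apply: ge_ereal_sup => _ [delta d0 <-].
apply: le_trans (hausdorff_premeasure_le_outer B d0).
apply: ereal_inf_le_tmp => _ [F [BF dF] <-]; exists F => //; split => //.
exact: subset_trans BF.
Qed.

Let hausdorff_outer_sigma_subadditive : sigma_subadditive hausdorff_outer.
Proof.
move=> F; apply: ge_ereal_sup => _ [delta d0 <-].
apply: le_trans (hausdorff_premeasure_sigma_subadditive delta F) _.
apply: lee_nneseries => k _; first by move=> _; exact: hausdorff_premeasure_ge0.
exact: hausdorff_premeasure_le_outer.
Qed.

HB.instance Definition _ := isOuterMeasure.Build R 'M[R]_(p, q)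
  hausdorff_outer hausdorff_outer0 hausdorff_outer_ge0 le_hausdorff_outer
  hausdorff_outer_sigma_subadditive.

Definition hausdorff_outer_measure : {outer_measure set 'M[R]_(p, q) -> \bar R} :=
  hausdorff_outer.

(* The m-dimensional Hausdorff measure on R^(p q), on the sigma-algebra of
   Caratheodory measurable sets, which contains the Borel sets. *)
Definition hausdorff_measure :
  {measure set (caratheodory_type hausdorff_outer_measure) -> \bar R} :=
  (hausdorff_outer_measure :
     set (caratheodory_type hausdorff_outer_measure) -> \bar R).

End hausdorff.
Arguments hausdorff_measure {R p q} m.

Section fourier.
Context {R : realType} (d : nat).
Local Open Scope complex_scope.

Definition Cintegral (f : 'rV[R]_d -> R[i]) : R[i] :=
  (\int[lebesgue_rV d]_y complex.Re (f y)) +i* (\int[lebesgue_rV d]_y complex.Im (f y)).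

Definition Cintegrable (f : 'rV[R]_d -> R[i]) : Prop :=
  (lebesgue_rV d).-integrable setT (EFin \o (@complex.Re R \o f)) /\
  (lebesgue_rV d).-integrable setT (EFin \o (@complex.Im R \o f)).

Definition expi (t : R) : R[i] := cos t +i* sin t.

Definition fourier (phi : 'rV[R]_d -> R) (x : 'rV[R]_d) : R[i] :=
  Cintegral (fun y => (phi y)%:C * expi (- (2 * pi * inner_prod x y))).

End fourier.

Section sections.
Context {R : realType} (d n : nat).

Definition block_hyperplane (y : 'rV[R]_n) : set 'M[R]_(n, d) :=
  [set x | \sum_k y ord0 k *: row k x = 0].

Definition block_section (phi : 'rV[R]_d -> R) (y : 'rV[R]_n) : \bar R :=
  (\int[hausdorff_measure (n * d - d)]_(x in block_hyperplane y)
     (\prod_k phi (row k x))%:E)%E.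

End sections.

Definition sqrt_rV (R : realType) n (q : 'rV[R]_n) : 'rV[R]_n :=
  map_mx (@Num.sqrt R) q.

Definition std_simplex (R : realType) n : set 'rV[R]_n :=
  [set a | (forall i, 0 <= a ord0 i <= 1) /\ \sum_i a ord0 i = 1].

Section log_convexity.
Context {R : realType} (V : lmodType R).

Definition log_convex_on (C : set V) (f : V -> R) : Prop :=
  (forall x, C x -> 0 <= f x) /\
  (forall x y l, C x -> C y -> 0 < l < 1 ->
     f (l *: x + (1 - l) *: y) <= f x `^ l * f y `^ (1 - l)).

Definition log_concave_on (C : set V) (f : V -> R) : Prop :=
  (forall x, C x -> 0 <= f x) /\
  (forall x y l, C x -> C y -> 0 < l < 1 ->
     f x `^ l * f y `^ (1 - l) <= f (l *: x + (1 - l) *: y)).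

End log_convexity.

Section majorization.
Context {R : realType} (n : nat).

Definition decreasing_rearrangement (x : 'rV[R]_n) : seq R :=
  sort >=%O [seq x ord0 i | i <- enum 'I_n].

Definition majorized (x y : 'rV[R]_n) : Prop :=
  (forall i, (0 < i < n)%N ->
     \sum_(a <- take i (decreasing_rearrangement x)) a <=
     \sum_(a <- take i (decreasing_rearrangement y)) a) /\
  \sum_i x ord0 i = \sum_i y ord0 i.

Definition schur_concave_on (C : set 'rV[R]_n) (f : 'rV[R]_n -> R) : Prop :=
  forall x y, C x -> C y -> majorized x y -> f y <= f x.

End majorization.

(* Main.v *)
From HB Require Import structures.
Require Import Defs.
From mathcomp Require Import all_boot all_order all_algebra.
From mathcomp Require Import all_classical all_reals all_analysis.
From mathcomp.real_closed Require Import complex.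
From mathcomp Require Import measurable_realfun ring lra.

Set Implicit Arguments.
Unset Strict Implicit.
Unset Printing Implicit Defensive.

Import Order.TTheory GRing.Theory Num.Theory.
Import numFieldNormedType.Exports.

Local Open Scope classical_set_scope.
Local Open Scope ring_scope.

(* For a unit vector [y], [S y = W * \int \prod_k hat(y_k t) dt] where [W] does not
   depend on [y], and the theorem is read off this formula with [y = sqrt q]:
   if [r |-> hat(sqrt r t)] is log-convex, Hoelder's inequality makes the integral
   log-convex in [q]; if it is log-concave, Karamata's inequality makes
   [\prod_k hat(sqrt q_k t)] Schur concave in [q] for each [t].
   To obtain the formula, parametrize [H_y] by all blocks but one. The Hausdorff
   measure pulls back to a translation-invariant measure, hence to a multiple of
   the Lebesgue measure; a Householder reflection maps [H_y] isometrically to a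
   fixed hyperplane and preserves the Gaussian, and integrating the latter over
   both identifies the multiple. In these coordinates the remaining block is
   replaced by means of the inversion formula, and Fubini gives the product. *)

(** * Measurability of matrix-valued functions *)

(** What makes the Hausdorff measure tractable is that Borel sets are Caratheodory measurable, that
    Euclidean isometries preserve it, and that Lipschitz images of cubes have finite measure in the
    dimension of the cube. The constant [W] therefore stays implicit: it is the ratio of the
    Hausdorff measure on the hyperplane where the first block vanishes to Lebesgue measure. Both
    conclusions survive multiplication by any [W >= 0]. Two powers of the solved coordinate [y_k]
    meet: the parametrization of a unit hyperplane contributes [W |y_k|^-d], and the substitution
    [s = y_k t] on the Fourier side contributes [|y_k|^d]. Their cancellation makes the formula
    independent of the choice of [k]. The transform is real, so complex integrals are replaced by a
    cosine integral and a vanishing sine integral; by the addition formulas such pairs multiply over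
    product measures. The inversion formula is obtained at every point: [hat] is damped by
    [exp (- e |t|_1)], whose transform is a product of Cauchy kernels. Fatou's lemma first yields
    the bound of [phi] by the integral of [hat], which then permits dominated convergence. *)

Section measurable_matrix.
Context {R : realType}.

Lemma measurable_mx_entry m n (i : 'I_m) (j : 'I_n) :
  measurable_fun [set: 'M[R]_(m, n)] (fun M : 'M[R]_(m, n) => M i j).
Proof.
move=> _ B mB; rewrite setTI; apply: (@sub_sigma_algebra _ setT).
by exists i, j; exists B.
Qed.

Lemma measurable_fun_mx d (T : measurableType d) m n (f : T -> 'M[R]_(m, n)) :
  (forall i j, measurable_fun setT (fun x => f x i j)) -> measurable_fun setT f.
Proof.
move=> mf; apply: (@measurability _ _ _ _ _ _ [set A | exists i j, exists2 B : set R,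
    measurable B & A = [set M : 'M[R]_(m, n) | B (M i j)]]) => //.
move=> _ [_ [i [j [B mB ->]]] <-]; exact: mf.
Qed.

Lemma measurable_fun_preimage d d' (T : measurableType d) (T' : measurableType d')
  (f : T -> T') (A : set T') : measurable_fun setT f -> measurable A ->
  measurable (f @^-1` A).
Proof. by move=> mf mA; rewrite -[X in measurable X]setTI; exact: mf. Qed.

(** The sigma-algebra is generated by the entries, not by the open sets. An open set belongs to it
    because it is the union of the countably many boxes with rational centre and radius that it
    contains. *)
Lemma continuous_measurable_mx m n (f : 'M[R]_(m, n) -> R) :
  continuous f -> measurable_fun setT f.
Proof.
move=> cf; apply: (measurability _ (measurable_realfun.RGenOpens.measurableE R)).
move=> _ [_ [a [b ->]] <-]; rewrite setTI.
set U := `]a, b[%classic; have oU : open U by exact: interval_open.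
have oV : open (f @^-1` U) by apply: open_comp => // x _; exact: cf.
pose box (c : 'M[rat]_(m, n) * rat) : set 'M[R]_(m, n) :=
  [set M | forall i j, `|ratr (c.1 i j) - M i j| < ratr c.2].
pose F c : set 'M[R]_(m, n) := if `[< box c `<=` f @^-1` U >] then box c else set0.
have -> : f @^-1` U = \bigcup_c F c.
  apply/seteqP; split => [x Vx|x [c _]]; last first.
    by rewrite /F; case: asboolP => // h; exact: h.
  have := open_nbhs_nbhs (conj oV Vx) => /nbhs_ballP [e /= e0 xe].
  (* A box of radius [r < e / 2] whose centre is within [r] of [x] contains [x] and stays within [e]
     of it. *)
  have [r] := @rat_in_itvoo R 0 (e / 2) ltac:(lra).
  rewrite in_itv/= => /andP[r0 re].
  have hc i j : {c : rat | `|ratr c - x i j| < ratr r}.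
    apply: cid.
    have [c] := @rat_in_itvoo R (x i j - ratr r) (x i j + ratr r) ltac:(lra).
    by rewrite in_itv/= => /andP[h1 h2]; exists c; rewrite ltr_norml; lra.
  pose c := \matrix_(i, j) projT1 (hc i j).
  exists (c, r) => //; rewrite /F; case: asboolP => [_ i j|].
    by rewrite /= mxE; exact: projT2 (hc i j).
  move=> []; move=> y ybox; apply: xe; split => // i j.
  rewrite /ball/= /ball_; have := ybox i j; rewrite /= mxE => h1.
  have h2 := projT2 (hc i j).
  set p := ratr _ in h1 h2.
  have -> : x i j - y i j = (p - y i j) - (p - x i j) by ring.
  have := ler_normB (p - y i j) (p - x i j); lra.
apply: countable_bigcupT_measurable; first exact: countableP.
move=> c; rewrite /F; case: ifP => // _.
have -> : box c = \bigcap_(ij : 'I_m * 'I_n) [set M | `|ratr (c.1 ij.1 ij.2) - M ij.1 ij.2| < ratr c.2].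
  by apply/seteqP; split => [M h [i j] _|M h i j]; [exact: h | exact: (h (i, j))].
apply: fin_bigcap_measurable => [|[i j] _]; first exact: finite_finset.
rewrite [X in measurable X](_ : _ = (fun M : 'M[R]_(m, n) => M i j) @^-1`
    `]ratr (c.1 i j) - ratr c.2, ratr (c.1 i j) + ratr c.2[%classic).
  by apply: measurable_fun_preimage => //; exact: measurable_mx_entry.
apply/seteqP; split => M /=; rewrite in_itv/= ltr_norml; lra.
Qed.

End measurable_matrix.

(** * Translation-invariant measures *)

Section invariance.
Local Open Scope ereal_scope.
Context {R : realType}.

Lemma ge0_integral_invariant d (T : measurableType d)
    (mu : {measure set T -> \bar R}) (s : T -> T) (f : T -> \bar R) :
  measurable_fun setT s -> (forall A, measurable A -> mu (s @^-1` A) = mu A) ->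
  measurable_fun setT f -> (forall x, 0 <= f x) ->
  \int[mu]_x f (s x) = \int[mu]_x f x.
Proof.
move=> ms mus mf f0.
have /= <- := @ge0_integral_pushforward _ _ _ _ R _ ms mu setT f measurableT mf (fun x _ => f0 x).
by apply: eq_measure_integral => A mA _; exact: mus.
Qed.

Lemma lebesgue_measure_shift (a : R) (A : set R) : measurable A ->
  lebesgue_measure ((fun x => x + a)%R @^-1` A) = lebesgue_measure A.
Proof.
have ms : measurable_fun setT ((fun x => x + a)%R : measurableTypeR R -> measurableTypeR R).
  exact: measurable_funD.
move=> mA; apply/esym.
apply: (@lebesgue_measure_unique _ (pushforward (@lebesgue_measure R) ((fun x => x + a)%R : measurableTypeR R -> measurableTypeR R))) => //= _ [[b c]] _ <-.
rewrite /pushforward.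
rewrite (_ : _ @^-1` _ = `](b - a)%R, (c - a)%R]%classic).
  rewrite !lebesgue_measure_itv/= !lte_fin ltrD2r -!EFinB.
  by rewrite (_ : (c - a - (b - a) = c - b)%R); last by ring.
by apply/seteqP; split => x /=; rewrite !in_itv/= lerBrDr ltrBlDr.
Qed.

Definition translation_invariant m n (mu : set 'M[R]_(m, n) -> \bar R) :=
  forall (a : 'M[R]_(m, n)) (A : set 'M[R]_(m, n)), measurable A ->
    mu ((fun x => x + a)%R @^-1` A) = mu A.

Lemma measurable_addmx m n :
  measurable_fun setT (fun p : 'M[R]_(m, n) * 'M[R]_(m, n) => p.1 + p.2)%R.
Proof.
apply: measurable_fun_mx => i j.
rewrite (_ : (fun _ => _) = (fun p : 'M[R]_(m, n) * 'M[R]_(m, n) => p.1 i j + p.2 i j)%R); last first.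
  by apply/funext => p; rewrite mxE.
by apply: measurable_funD;
  apply: (measurableT_comp (measurable_mx_entry i j)).
Qed.

Lemma measurable_addrmx m n (a : 'M[R]_(m, n)) :
  measurable_fun setT (fun x : 'M[R]_(m, n) => x + a)%R.
Proof.
apply: measurable_fun_mx => i j.
rewrite (_ : (fun _ => _) = (fun p : 'M[R]_(m, n) => p i j + a i j)%R); last first.
  by apply/funext => p; rewrite mxE.
by apply: measurable_funD => //; exact: measurable_mx_entry.
Qed.

Lemma measurable_scalemx m n (a : R) :
  measurable_fun setT (fun x : 'M[R]_(m, n) => a *: x)%R.
Proof.
apply: measurable_fun_mx => i j.
rewrite (_ : (fun _ => _) = (fun p : 'M[R]_(m, n) => a * p i j)%R); last first.
  by apply/funext => p; rewrite mxE.
by apply: measurable_funM => //; exact: measurable_mx_entry.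
Qed.

Lemma measurable_oppmx m n : measurable_fun setT (@GRing.opp 'M[R]_(m, n)).
Proof.
rewrite (_ : -%R = (fun x => -1 *: x)%R); first exact: measurable_scalemx.
by apply/funext => x; rewrite scaleN1r.
Qed.

Lemma ge0_integral_shift m n (mu : {measure set 'M[R]_(m, n) -> \bar R})
    (f : 'M[R]_(m, n) -> \bar R) a : translation_invariant mu ->
  measurable_fun setT f -> (forall x, 0 <= f x) ->
  \int[mu]_x f (x + a)%R = \int[mu]_x f x.
Proof.
move=> mus; apply: ge0_integral_invariant; first exact: measurable_addrmx.
exact: mus.
Qed.

Lemma measurable_fun_indic_comp d d' (T : measurableType d) (T' : measurableType d')
    (A : set T') (f : T -> T') : measurable A -> measurable_fun setT f ->
  measurable_fun setT (fun x => \1_A (f x) : R).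
Proof.
move=> mA mf.
have m1 : measurable_fun setT (\1_A : T' -> R) by exact: measurable_indic.
exact: (measurableT_comp m1 mf).
Qed.

(** These cubes exhaust the space, and their symmetry about the origin absorbs the reflection that
    occurs in [translation_invariant_unique]. *)
Definition mx_cube m n (K : nat) : set 'M[R]_(m, n) :=
  [set x | forall i j, (`|x i j| <= K%:R)%R].

Lemma mx_boxE m n (B : set R) :
  [set x : 'M[R]_(m, n) | forall i j, B (x i j)] =
  \bigcap_(ij : 'I_m * 'I_n) (fun x : 'M[R]_(m, n) => x ij.1 ij.2) @^-1` B.
Proof.
by apply/seteqP; split => [M h [i j] _|M h i j]; [exact: h | exact: (h (i, j))].
Qed.

Lemma measurable_box m n (B : set R) : measurable B ->
  measurable [set x : 'M[R]_(m, n) | forall i j, B (x i j)].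
Proof.
move=> mB; rewrite mx_boxE.
apply: fin_bigcap_measurable => [|[i j] _]; first exact: finite_finset.
by apply: measurable_fun_preimage => //; exact: measurable_mx_entry.
Qed.

Lemma measurable_mx_cube m n K : measurable (@mx_cube m n K).
Proof.
apply: (measurable_box (B := [set x : R | (`|x| <= K%:R)%R])).
rewrite (_ : mkset _ = `[(- K%:R)%R, K%:R%R]%classic) //.
by apply/seteqP; split => x /=; rewrite in_itv/= ler_norml.
Qed.

Lemma mx_cube_cover m n : \bigcup_K @mx_cube m n K = setT.
Proof.
apply/seteqP; split => // x _.
pose s := (\sum_i \sum_j Num.bound `|x i j|%R)%N.
exists s => // i j; apply: (@le_trans _ _ (Num.bound `|x i j|%R)%:R).
  exact/ltW/archi_boundP.
rewrite ler_nat /s (bigD1 i)//= (bigD1 j)//= -addnA; exact: leq_addr.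
Qed.

Lemma sigma_finite_cube m n (mu : {measure set 'M[R]_(m, n) -> \bar R}) :
  (forall K, mu (mx_cube K) < +oo) -> sigma_finite setT mu.
Proof.
move=> muK; exists (@mx_cube m n); first by rewrite mx_cube_cover.
by move=> K; split; [exact: measurable_mx_cube|exact: muK].
Qed.

Lemma ge0_integralZl_indic d (T : measurableType d) (mu : {measure set T -> \bar R})
    (c : \bar R) (A : set T) : 0 <= c -> measurable A ->
  \int[mu]_x (c * (\1_A x)%:E) = c * mu A.
Proof.
move=> c0 mA; rewrite ge0_integralZl //=; last first.
  have : measurable_fun setT (\1_A : T -> R) by exact: measurable_indic.
  exact: (proj2 (measurable_EFinP setT (\1_A : T -> R))).
by rewrite integral_indic ?setIT.
Qed.

(* Integrate [1_A (x + y) 1_Q y] against [nu x] and [mu y] in both orders. *)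
Let sfinite_translation_invariant_unique m n
    (mu nu : {sfinite_measure set 'M[R]_(m, n) -> \bar R}) (A Q : set 'M[R]_(m, n)) :
  translation_invariant mu -> translation_invariant nu ->
  measurable A -> measurable Q ->
  nu A * mu Q = nu (-%R @^-1` Q) * mu A.
Proof.
move=> tmu tnu mA mQ.
pose f (p : 'M[R]_(m, n) * 'M[R]_(m, n)) : \bar R := (\1_A (p.1 + p.2)%R * \1_Q p.2)%:E.
pose g (p : 'M[R]_(m, n) * 'M[R]_(m, n)) : \bar R := (\1_A p.2 * \1_Q (p.2 - p.1)%R)%:E.
have mf : measurable_fun setT f.
  apply/measurable_EFinP; apply: measurable_funM.
    exact: (measurable_fun_indic_comp mA (@measurable_addmx m n)).
  exact: (measurable_fun_indic_comp mQ measurable_snd).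
have mg : measurable_fun setT g.
  apply/measurable_EFinP; apply: measurable_funM.
    exact: (measurable_fun_indic_comp mA measurable_snd).
  apply: (measurable_fun_indic_comp mQ).
  rewrite (_ : (fun _ => _) = (fun p : 'M[R]_(m, n) * 'M[R]_(m, n) => p.1 + p.2)%R \o (fun p => (p.2, -%R p.1))) //.
  apply: (measurableT_comp (@measurable_addmx m n)).
  apply/measurable_fun_pairP; split; first exact: measurable_snd.
  exact: (measurableT_comp (@measurable_oppmx m n) measurable_fst).
have f0 p : 0 <= f p by rewrite lee_fin mulr_ge0.
have g0 p : 0 <= g p by rewrite lee_fin mulr_ge0.
transitivity (\int[mu]_y \int[nu]_x f (x, y)).
  rewrite muleC [LHS]muleC -ge0_integralZl_indic//; apply: eq_integral => y _.
  rewrite (ge0_integral_shift (f := fun x => (\1_A x * \1_Q y)%:E)) //; last first.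
    by apply/measurable_EFinP; exact: measurable_funM.
  under eq_integral do rewrite mulrC EFinM.
  by rewrite ge0_integralZl_indic// muleC.
rewrite -(sfinite_Fubini nu mu f f0 mf).
transitivity (\int[nu]_x \int[mu]_y g (x, y)).
  apply: eq_integral => x _; rewrite /f/=.
  rewrite -(ge0_integral_shift (f := fun y => g (x, y)) x) //; last first.
    by apply: measurableT_comp => //; exact: measurable_pair1.
  by apply: eq_integral => y _; rewrite /g/= addrK addrC.
rewrite (sfinite_Fubini nu mu g g0 mg).
have mNQ : measurable (-%R @^-1` Q).
  by apply: measurable_fun_preimage => //; exact: measurable_oppmx.
rewrite -ge0_integralZl_indic//; apply: eq_integral => y _; rewrite /g/=.
rewrite -(ge0_integral_shift (f := fun x => (\1_A y * \1_Q (y - x)%R)%:E) y) //; last first.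
  exact: (measurableT_comp mg (measurable_pair2 y)).
under eq_integral do rewrite opprD addrA addrAC subrr add0r EFinM.
rewrite muleC -(ge0_integralZl_indic nu (A := -%R @^-1` Q))//.
Qed.

(** With [Q] a cube, the identity says that [nu] is proportional to [mu]. Finiteness on cubes
    provides the s-finiteness behind Fubini's theorem. *)
Lemma translation_invariant_unique m n
    (mu nu : {measure set 'M[R]_(m, n) -> \bar R}) (A Q : set 'M[R]_(m, n)) :
  (forall K, mu (mx_cube K) < +oo) -> (forall K, nu (mx_cube K) < +oo) ->
  translation_invariant mu -> translation_invariant nu ->
  measurable A -> measurable Q ->
  nu A * mu Q = nu (-%R @^-1` Q) * mu A.
Proof.
move=> muK nuK.
have sfin (rho : {measure set 'M[R]_(m, n) -> \bar R}) :
    (forall K, rho (mx_cube K) < +oo) -> sfinite_measure rho.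
  by move=> rhoK; exact/sfinite_measure_sigma_finite/sigma_finite_cube.
pose smu : {sfinite_measure set _ -> \bar R} :=
  HB.pack (Measure.sort mu) (isSFinite.Build _ _ _ (Measure.sort mu) (sfin mu muK)).
pose snu : {sfinite_measure set _ -> \bar R} :=
  HB.pack (Measure.sort nu) (isSFinite.Build _ _ _ (Measure.sort nu) (sfin nu nuK)).
exact: (@sfinite_translation_invariant_unique _ _ smu snu).
Qed.

End invariance.

(** * Lebesgue measure on [R^n]: translations, boxes and dilations *)

Section lebesgue_rV.
Local Open Scope ereal_scope.
Context {R : realType}.

Lemma ge0_integral_row_cons n (f : 'rV[R]_n.+1 -> \bar R) :
  measurable_fun setT f -> (forall x, 0 <= f x) ->
  \int[lebesgue_rV n.+1]_x f x =
  \int[lebesgue_measure]_x \int[lebesgue_rV n]_v f (row_cons (x, v)).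
Proof.
move=> mf f0.
have mr := @measurable_row_cons R n.
have := @ge0_integral_pushforward _ _ _ _ R _ mr
  (lebesgue_measure \x lebesgue_rV n) setT f measurableT mf (fun x _ => f0 x).
rewrite preimage_setT => H; transitivity (\int[lebesgue_measure \x lebesgue_rV n]_x (f \o row_cons (n:=n)) x).
  by rewrite -H; exact: eq_measure_integral.
have mfr := measurableT_comp mf mr.
rewrite (fubini_tonelli1 (f \o row_cons (n:=n))) //.
by move=> x /=; exact: f0.
Qed.

Lemma row_consD n (x y : measurableTypeR R) (v w : 'rV[R]_n) :
  (row_cons (x, v) + row_cons (y, w) = row_cons ((x + y)%R : measurableTypeR R, v + w))%R.
Proof.
apply/rowP => i; rewrite !mxE; case: (unlift ord0 i) => //= j.
by rewrite mxE.
Qed.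

Lemma row_cons_eta n (w : 'rV[R]_n.+1) :
  w = row_cons (w ord0 ord0 : measurableTypeR R, \row_j w ord0 (lift ord0 j)).
Proof. by apply/rowP => i; rewrite mxE; case: unliftP => [j ->|->] //=; rewrite mxE. Qed.

Lemma product_measure_invariant d1 d2 (T1 : measurableType d1)
    (T2 : measurableType d2) (m1 : {measure set T1 -> \bar R})
    (m2 : {sigma_finite_measure set T2 -> \bar R}) (s1 : T1 -> T1) (s2 : T2 -> T2) A :
  measurable_fun setT s1 -> (forall B, measurable B -> m1 (s1 @^-1` B) = m1 B) ->
  (forall B, measurable B -> m2 (s2 @^-1` B) = m2 B) ->
  measurable A ->
  (m1 \x m2) ((fun p => (s1 p.1, s2 p.2)) @^-1` A) = (m1 \x m2) A.
Proof.
move=> ms1 m1s m2s mA; rewrite /product_measure1.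
transitivity (\int[m1]_x (m2 \o xsection A) (s1 x)).
  apply: eq_integral => x _ /=.
  rewrite -(m2s (xsection A (s1 x))); last exact: measurable_xsection.
  by congr (m2 _); apply/seteqP; split => y; rewrite /xsection/= !inE.
apply: ge0_integral_invariant => //.
exact: measurable_fun_xsection.
Qed.

Lemma lebesgue_rV_translation n : translation_invariant (lebesgue_rV n : set 'rV[R]_n -> _).
Proof.
elim: n => [|n IH] a A mA.
  by congr (_ _); apply/seteqP; split => x; rewrite /= (_ : (x + a = x)%R)// [LHS]thinmx0 [RHS]thinmx0.
have mp : measurable (@row_cons R n @^-1` A).
  by apply: measurable_fun_preimage => //; exact: measurable_row_cons.
change ((lebesgue_measure \x lebesgue_rV n) (@row_cons R n @^-1` ((fun x => x + a)%R @^-1` A)) =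
  (lebesgue_measure \x lebesgue_rV n) (@row_cons R n @^-1` A)).
rewrite -(@product_measure_invariant _ _ _ _ (@lebesgue_measure R) (lebesgue_rV n)
  (fun x => x + a ord0 ord0)%R (fun v => v + \row_j a ord0 (lift ord0 j))%R (@row_cons R n @^-1` A))//.
- congr (_ _); apply/seteqP; split => -[x v] /=;
  by rewrite -row_consD -(row_cons_eta a).
- exact: measurable_funD.
- exact: lebesgue_measure_shift.
- exact: IH.
Qed.

Lemma lebesgue_rV_box n (B : set R) : measurable B ->
  lebesgue_rV n [set x | forall i j, B (x i j)] = lebesgue_measure B ^+ n.
Proof.
move=> mB; elim: n => [|n IH].
  rewrite expe0 -(diracT R (0 : 'rV[R]_0)%R).
  by congr (_ _); apply/seteqP; split => // x _ i -[].
rewrite expeS -IH.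
have mBox := @measurable_box R 1 n B mB.
rewrite -product_measure1E//.
congr ((_ \x _)%E _); apply/seteqP; split => -[x v] /=.
  move=> h; split => [|i j]; first by have := h ord0 ord0; rewrite mxE unlift_none.
  by have := h ord0 (lift ord0 j); rewrite mxE liftK (ord1 i).
by move=> [h1 h2] i j; rewrite mxE; case: (unliftP ord0 j) => [k|] _ /=.
Qed.

Lemma lebesgue_measure_ball0 (K : R) : (0 <= K)%R ->
  lebesgue_measure [set x : R | (`|x| <= K)%R] = (K *+ 2)%:E.
Proof.
move=> K0; rewrite (_ : mkset _ = `[(- K)%R, K]%classic).
  rewrite lebesgue_measure_itv/= lte_fin -EFinB opprK mulr2n.
  case: ltP => // K0'; have -> : K = 0%R by lra.
  by rewrite addr0.
by apply/seteqP; split => x /=; rewrite in_itv/= ler_norml.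
Qed.

Lemma mx_cubeN m n (x : 'M[R]_(m, n)) K : @mx_cube R m n K (- x)%R = mx_cube K x.
Proof. by apply/propext; split => h i j; have := h i j; rewrite mxE normrN. Qed.

Lemma lebesgue_rV_cube n K :
  lebesgue_rV n (@mx_cube R 1 n K) = ((K%:R *+ 2) ^+ n)%:E.
Proof.
rewrite EFin_expe -lebesgue_measure_ball0// -lebesgue_rV_box//.
rewrite (_ : mkset _ = `[(- K%:R)%R, K%:R]%classic) //.
by apply/seteqP; split => x /=; rewrite in_itv/= ler_norml.
Qed.

Lemma lebesgue_rV_cube_lty n K : lebesgue_rV n (@mx_cube R 1 n K) < +oo.
Proof. by rewrite lebesgue_rV_cube ltry. Qed.

(** The image of Lebesgue measure under a dilation is again translation invariant, so uniqueness
    makes it a multiple of Lebesgue measure; the value on the cube of half-side 1 gives the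
    factor. *)
Lemma lebesgue_rV_scale n (a : R) (A : set 'rV[R]_n) : (a != 0)%R -> measurable A ->
  lebesgue_rV n ( *:%R a @^-1` A) = (`|a|^-1 ^+ n)%:E * lebesgue_rV n A.
Proof.
move=> a0 mA; have na0 : (0 < `|a|)%R by rewrite normr_gt0.
have ms := @measurable_scalemx R 1 n a.
pose nu : {measure set 'rV[R]_n -> \bar R} := measure_function_pushforward__canonical__measure_function_Measure (lebesgue_rV n) ms.
have cubeE K : nu (@mx_cube R 1 n K) = (`|a|^-1 ^+ n)%:E * lebesgue_rV n (@mx_cube R 1 n K).
  rewrite lebesgue_rV_cube -EFinM -exprMn mulrnAr.
  rewrite EFin_expe -lebesgue_measure_ball0; last by rewrite mulr_ge0// invr_ge0.
  rewrite -lebesgue_rV_box//.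
    rewrite /nu /= /pushforward; congr (lebesgue_rV n _).
    apply/seteqP; split => x h i j; have := h i j; rewrite /= mxE normrM.
      by rewrite mulrC -ler_pdivlMr// mulrC.
    by rewrite ler_pdivlMl// mulrC.
  rewrite (_ : mkset _ = `[(- (`|a|^-1 * K%:R))%R, (`|a|^-1 * K%:R)%R]%classic) //.
  by apply/seteqP; split => x /=; rewrite in_itv/= ler_norml.
have := @translation_invariant_unique R 1 n (lebesgue_rV n) nu A (@mx_cube R 1 n 1).
rewrite (_ : -%R @^-1` mx_cube 1 = mx_cube 1); last first.
  by apply/seteqP; split => x /=; rewrite mx_cubeN.
rewrite cubeE muleAC => H.
have c2 : lebesgue_rV n (@mx_cube R 1 n 1) = (2 ^+ n)%:E by rewrite lebesgue_rV_cube.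
have {}H : nu A * (2 ^+ n)%:E = (`|a|^-1 ^+ n)%:E * lebesgue_rV n A * (2 ^+ n)%:E.
  rewrite -c2; apply: H => //.
  - exact: lebesgue_rV_cube_lty.
  - by move=> K; rewrite cubeE lebesgue_rV_cube ltry.
  - exact: lebesgue_rV_translation.
  - move=> b B mB; rewrite /nu /= /pushforward.
    rewrite -(@lebesgue_rV_translation n (a^-1 *: b) (( *:%R a) @^-1` B)).
      by congr (lebesgue_rV n _); apply/seteqP; split => x /=;
      rewrite scalerDr scalerA mulfV// scale1r.
    exact: measurable_fun_preimage.
  - exact: measurable_mx_cube.
have := congr1 (fun z => z * (2 ^- n)%:E) H.
by rewrite -!muleA -!EFinM divff ?mule1// expf_neq0.
Qed.

Lemma ge0_integral_rV_scale n (a : R) (f : 'rV[R]_n -> \bar R) : (a != 0)%R ->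
  measurable_fun setT f -> (forall x, 0 <= f x) ->
  \int[lebesgue_rV n]_x f (a *: x)%R = (`|a|^-1 ^+ n)%:E * \int[lebesgue_rV n]_x f x.
Proof.
move=> a0 mf f0; have ms := @measurable_scalemx R 1 n a.
have c0 : (0 <= `|a|^-1 ^+ n)%R by rewrite exprn_ge0// invr_ge0.
rewrite -(ge0_integral_mscale (lebesgue_rV n) measurableT (NngNum c0))//.
have /= <- := @ge0_integral_pushforward _ _ _ _ R _ ms (lebesgue_rV n) setT f measurableT mf (fun x _ => f0 x).
by apply: eq_measure_integral => A mA _; exact: lebesgue_rV_scale.
Qed.

End lebesgue_rV.

(** * Lebesgue measure on [(R^d)^n] *)

Section lebesgue_mx.
Context {R : realType} (d : nat).

Definition rows_cons n (p : 'rV[R]_d * 'M[R]_(n, d)) : 'M[R]_(n.+1, d) :=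
  \matrix_(i, j) oapp (fun k => p.2 k j) (p.1 ord0 j) (unlift ord0 i).

Lemma measurable_rows_cons n : measurable_fun setT (@rows_cons n).
Proof.
apply: measurable_fun_mx => i j.
rewrite (_ : (fun _ => _) = (fun p : 'rV[R]_d * 'M[R]_(n, d) =>
  oapp (fun k => p.2 k j) (p.1 ord0 j) (unlift ord0 i))); last first.
  by apply/funext => p; rewrite mxE.
case: (unlift ord0 i) => [k|] /=.
  exact: (measurableT_comp (measurable_mx_entry k j) measurable_snd).
exact: (measurableT_comp (measurable_mx_entry ord0 j) measurable_fst).
Qed.

Lemma rows_consD n (x y : 'rV[R]_d) (v w : 'M[R]_(n, d)) :
  rows_cons (x, v) + rows_cons (y, w) = rows_cons (x + y, v + w).
Proof. by apply/matrixP => i j; rewrite !mxE; case: (unlift ord0 i) => [k|] //=; rewrite mxE. Qed.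

Lemma row_rows_cons0 n (p : 'rV[R]_d * 'M[R]_(n, d)) : row ord0 (rows_cons p) = p.1.
Proof. by apply/rowP => j; rewrite !mxE unlift_none. Qed.

Lemma row_rows_cons_lift n (p : 'rV[R]_d * 'M[R]_(n, d)) k :
  row (lift ord0 k) (rows_cons p) = row k p.2.
Proof. by apply/rowP => j; rewrite !mxE liftK. Qed.

Definition rows_uncons n (w : 'M[R]_(n.+1, d)) : 'rV[R]_d * 'M[R]_(n, d) :=
  (row ord0 w, row' ord0 w).

Lemma rows_unconsK n : cancel (@rows_uncons n) (@rows_cons n).
Proof. by move=> w; apply/matrixP => i j; rewrite mxE; case: unliftP => [k ->|->] /=; rewrite mxE. Qed.

Lemma rows_consK n : cancel (@rows_cons n) (@rows_uncons n).
Proof.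
move=> -[x v]; rewrite /rows_uncons row_rows_cons0; congr (_, _).
by apply/matrixP => i j; rewrite !mxE liftK.
Qed.

Section succ.
Context n (mu : {sigma_finite_measure set 'M[R]_(n, d) -> \bar R}).

Definition lebesgue_mx_succ : set 'M[R]_(n.+1, d) -> \bar R :=
  pushforward (lebesgue_rV d \x mu)%E (@rows_cons n).

HB.instance Definition _ := Measure.copy lebesgue_mx_succ
  (measure_function_pushforward__canonical__measure_function_Measure
    (lebesgue_rV d \x mu)%E (@measurable_rows_cons n)).

Let lebesgue_mx_succ_sigma_finite : sigma_finite setT lebesgue_mx_succ.
Proof.
have muncons : measurable_fun setT (@rows_uncons n).
  apply/measurable_fun_pairP; split; apply: measurable_fun_mx => i j /=.
    rewrite (_ : (fun _ => _) = (fun w : 'M[R]_(n.+1, d) => w ord0 j)).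
      exact: measurable_mx_entry.
    by apply/funext => w; rewrite mxE.
  rewrite (_ : (fun _ => _) = (fun w : 'M[R]_(n.+1, d) => w (lift ord0 i) j)).
    exact: measurable_mx_entry.
  by apply/funext => w; rewrite mxE.
have [F FT Foo] := product_sigma_finite (@lebesgue_rV R d) mu.
exists (fun k => @rows_uncons n @^-1` F k).
  by rewrite -preimage_bigcup -FT preimage_setT.
move=> k; have [mF muF] := Foo k; split; first exact: measurable_fun_preimage.
rewrite /lebesgue_mx_succ /pushforward -comp_preimage.
by rewrite (_ : @rows_uncons n \o _ = id) ?preimage_id//; apply/funext/rows_consK.
Qed.

HB.instance Definition _ := @Measure_isSigmaFinite.Build _ _ _ lebesgue_mx_succ
  lebesgue_mx_succ_sigma_finite.

End succ.

(** Built one row at a time, so that Fubini's theorem splits off a whole block; the integrands met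
    later are products or sums over blocks. *)
Fixpoint lebesgue_mx n : {sigma_finite_measure set 'M[R]_(n, d) -> \bar R} :=
  match n with
  | 0%N => @dirac _ 'M[R]_(0, d) 0 R
  | n'.+1 => lebesgue_mx_succ (lebesgue_mx n')
  end.

Local Open Scope ereal_scope.

Lemma ge0_integral_rows_cons n (f : 'M[R]_(n.+1, d) -> \bar R) :
  measurable_fun setT f -> (forall x, 0 <= f x) ->
  \int[lebesgue_mx n.+1]_x f x =
  \int[lebesgue_rV d \x lebesgue_mx n]_p f (rows_cons p).
Proof.
move=> mf f0.
have mr := @measurable_rows_cons n.
have /= <- := @ge0_integral_pushforward _ _ _ _ R _ mr
  (lebesgue_rV d \x lebesgue_mx n) setT f measurableT mf (fun x _ => f0 x).
exact: eq_measure_integral.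
Qed.

Lemma lebesgue_mx_translation n : translation_invariant (lebesgue_mx n : set 'M[R]_(n, d) -> _).
Proof.
elim: n => [|n IH] a A mA.
  by congr (_ _); apply/seteqP; split => x; rewrite /= (_ : (x + a = x)%R)// [LHS]flatmx0 [RHS]flatmx0.
have mp : measurable (@rows_cons n @^-1` A).
  by apply: measurable_fun_preimage => //; exact: measurable_rows_cons.
change ((lebesgue_rV d \x lebesgue_mx n) (@rows_cons n @^-1` ((fun x => x + a)%R @^-1` A)) =
  (lebesgue_rV d \x lebesgue_mx n) (@rows_cons n @^-1` A)).
rewrite -(@product_measure_invariant _ _ _ _ _ (lebesgue_rV d) (lebesgue_mx n)
  (fun x => x + (rows_uncons a).1)%R (fun v => v + (rows_uncons a).2)%R (@rows_cons n @^-1` A))//.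
- congr (_ _); apply/seteqP; split => -[x v] /=;
  by rewrite -rows_consD -[rows_cons (row _ _, _)]/(rows_cons (rows_uncons a)) rows_unconsK.
- exact: measurable_addrmx.
- exact: lebesgue_rV_translation.
- exact: IH.
Qed.

Lemma lebesgue_mx_cube n K :
  lebesgue_mx n (@mx_cube R n d K) = ((K%:R *+ 2) ^+ (n * d))%:E.
Proof.
elim: n => [|n IH].
  rewrite mul0n expr0 -(diracT R (0 : 'M[R]_(0, d))%R).
  by congr (_ _); apply/seteqP; split => // x _ -[].
rewrite mulSn exprD EFinM -IH -lebesgue_rV_cube.
rewrite -product_measure1E; [|exact: measurable_mx_cube..].
congr ((_ \x _)%E _); apply/seteqP; split => -[x v] /=.
  move=> h; split => [i j|i j].
    by have := h ord0 j; rewrite mxE unlift_none (ord1 i).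
  by have := h (lift ord0 i) j; rewrite mxE liftK.
by move=> [h1 h2] i j; rewrite mxE; case: (unliftP ord0 i) => [k|] _ /=.
Qed.

Lemma lebesgue_mx_cube_lty n K : lebesgue_mx n (@mx_cube R n d K) < +oo.
Proof. by rewrite lebesgue_mx_cube ltry. Qed.

(** Uniqueness of Haar measure, normalized on the cube [Q] of half-side 1, whose Lebesgue measure is
    [2 ^ (n d)]. *)
Lemma translation_invariant_lebesgue_mx n (nu : {measure set 'M[R]_(n, d) -> \bar R}) :
  (forall K, nu (mx_cube K) < +oo) -> translation_invariant nu ->
  exists2 c : R, (0 <= c)%R & forall A, measurable A -> nu A = c%:E * lebesgue_mx n A.
Proof.
move=> nuK tnu.
pose Q := @mx_cube R n d 1.
have c2 : lebesgue_mx n Q = (2 ^+ (n * d))%:E by rewrite lebesgue_mx_cube.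
have nQ : nu Q \is a fin_num by rewrite ge0_fin_numE//; exact: nuK.
have H A : measurable A -> nu A * lebesgue_mx n Q = nu Q * lebesgue_mx n A.
  move=> mA; rewrite (@translation_invariant_unique R n d (lebesgue_mx n) nu A Q)//.
  - congr (nu _ * _); apply/seteqP; split => x /=; by rewrite /Q mx_cubeN.
  - exact: lebesgue_mx_cube_lty.
  - exact: lebesgue_mx_translation.
  - exact: measurable_mx_cube.
exists (fine (nu Q) * 2 ^- (n * d))%R.
  by rewrite mulr_ge0// ?fine_ge0// invr_ge0 exprn_ge0.
move=> A mA; have := congr1 (fun z => z * (2 ^- (n * d))%:E) (H A mA).
rewrite c2 -muleA -EFinM divff ?mule1 ?expf_neq0// => ->.
by rewrite EFinM fineK// muleAC.
Qed.

End lebesgue_mx.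
Arguments lebesgue_mx {R d} n.

(** * Hausdorff measure *)

Lemma lee_exp2r {R : realDomainType} (n : nat) (x y : \bar R) :
  (0 <= x -> x <= y -> x ^+ n <= y ^+ n)%E.
Proof.
move=> x0 xy; elim: n => [|n IH]; first by rewrite !expe0.
by rewrite !expeS lee_pmul// expe_ge0.
Qed.

Lemma measurable_sqr_sum {R : realType} m n :
  measurable_fun setT (fun x : 'M[R]_(m, n) => \sum_i \sum_j x i j ^+ 2).
Proof.
apply: measurable_sum => i; apply: measurable_sum => j.
by apply: measurable_funX; exact: measurable_mx_entry.
Qed.

Section hausdorff.
Local Open Scope ereal_scope.
Context {R : realType} (p q m : nat).
Implicit Types (A B F X : set 'M[R]_(p, q)).

Local Notation H := (@hausdorff_outer_measure R p q m).
Local Notation pre := (@hausdorff_premeasure R p q m).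

Lemma le_entry_euclidean_norm (x : 'M[R]_(p, q)) i j :
  (`|x i j| <= euclidean_norm x)%R.
Proof.
rewrite /euclidean_norm -sqrtr_sqr ler_sqrt; last first.
  by apply: sumr_ge0 => k _; apply: sumr_ge0 => l _; exact: sqr_ge0.
rewrite (bigD1 i)//= (bigD1 j)//= -addrA lerDl addr_ge0//.
  by apply: sumr_ge0 => l _; exact: sqr_ge0.
by apply: sumr_ge0 => k _; apply: sumr_ge0 => l _; exact: sqr_ge0.
Qed.

Lemma diam_entry A (delta : R) i j x y : diam A <= delta%:E -> A x -> A y ->
  (`|x i j - y i j| <= delta)%R.
Proof.
move=> dA Ax Ay; rewrite -lee_fin; apply: le_trans dA.
apply: (@le_trans _ _ (euclidean_norm (x - y))%:E).
  by rewrite lee_fin; have := le_entry_euclidean_norm (x - y) i j; rewrite !mxE.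
by apply: ereal_sup_ubound; exists (x, y).
Qed.

Lemma le_hausdorff_premeasure (d1 d2 : R) A : (d1 <= d2)%R -> pre d2 A <= pre d1 A.
Proof.
move=> d12; apply: ereal_inf_le_tmp => _ [F [AF dF] <-]; exists F => //.
by split => // k; apply: le_trans (dF k) _; rewrite lee_fin.
Qed.

(** A covering set of diameter at most [delta < g] cannot meet both [A] and [B], so a cover of the
    union splits into a cover of each. *)
Lemma hausdorff_premeasure_separated (delta : R) A B i j (a g : R) :
  (0 < delta < g)%R ->
  (forall x, A x -> x i j <= a)%R -> (forall x, B x -> a + g <= x i j)%R ->
  pre delta A + pre delta B <= pre delta (A `|` B).
Proof.
move=> /andP[d0 dg] Aa Bg; apply: le_ereal_inf_tmp => _ [F [ABF dF] <-].
pose sub C k : set 'M[R]_(p, q) := if `[< C `&` F k !=set0 >] then F k else set0.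
have dsub C k : diam (sub C k) <= delta%:E.
  rewrite /sub; case: ifP => // _.
  by rewrite /diam set0X image_set0 ereal_sup0 leNye.
have Csub C : C `<=` A `|` B -> C `<=` \bigcup_k sub C k.
  move=> CAB x Cx; have [k _ Fx] := ABF x (CAB x Cx).
  by exists k => //; rewrite /sub; case: asboolP => // -[]; exists x.
have le C : C `<=` A `|` B -> pre delta C <= \sum_(k <oo) hausdorff_gauge m (sub C k).
  move=> CAB; apply: ereal_inf_lbound; exists (sub C) => //; split => //; exact: Csub.
apply: le_trans (leeD (le A _) (le B _)) _; [by left|by right|].
rewrite -nneseriesD; [|by move=> *; exact: hausdorff_gauge_ge0..].
apply: lee_nneseries => k _.
  by move=> _; rewrite adde_ge0// hausdorff_gauge_ge0.
have g0 : hausdorff_gauge m (set0 : set 'M[R]_(p, q)) = 0 by rewrite /hausdorff_gauge eqxx.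
rewrite /sub; case: asboolP => [[x [Ax Fx]]|_]; last first.
  by case: asboolP => _; rewrite ?g0 ?add0e// hausdorff_gauge_ge0.
case: asboolP => [[y [By Fy]]|_]; last by rewrite g0 adde0.
exfalso; have := diam_entry i j (dF k) Fx Fy; have := Aa x Ax; have := Bg y By.
by rewrite ler_norml; lra.
Qed.

Lemma hausdorff_separated A B i j (a g : R) : (0 < g)%R ->
  (forall x, A x -> x i j <= a)%R -> (forall x, B x -> a + g <= x i j)%R ->
  H A + H B <= H (A `|` B).
Proof.
move=> g0 Aa Bg.
have [->|] := eqVneq (H (A `|` B)) +oo; first by rewrite leey.
rewrite -ltey => ABoo.
have fin C : C `<=` A `|` B -> H C \is a fin_num.
  move=> CAB; rewrite ge0_fin_numE ?outer_measure_ge0//.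
  exact: le_lt_trans (le_outer_measure _ _ _ CAB) ABoo.
(* The two suprema defining [H A] and [H B] are taken one after the other, hence two radii. The
   premeasures grow as the radius shrinks, so both can be compared at one [delta] below [d1], [d2]
   and [g]. *)
have key (d1 d2 : R) : (0 < d1)%R -> (0 < d2)%R -> pre d1 A + pre d2 B <= H (A `|` B).
  move=> d10 d20; pose delta := Num.min (Num.min d1 d2) (g / 2)%R.
  have [le1 le2 ltg d0] : [/\ (delta <= d1)%R, (delta <= d2)%R, (delta < g)%R & (0 < delta)%R].
    by rewrite /delta; split; rewrite ?lt_min ?gt_min ?ge_min ?lexx ?orbT//; lra.
  apply: (le_trans (leeD (le_hausdorff_premeasure A le1) (le_hausdorff_premeasure B le2))).
  apply: le_trans (@hausdorff_premeasure_separated delta A B i j a g _ Aa Bg) _.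
    by rewrite d0.
  exact: hausdorff_premeasure_le_outer.
have finpre (d : R) C : (0 < d)%R -> C `<=` A `|` B -> pre d C \is a fin_num.
  move=> d0 CAB; rewrite ge0_fin_numE ?hausdorff_premeasure_ge0//.
  apply: le_lt_trans (hausdorff_premeasure_le_outer m C d0) _.
  by have := fin C CAB; rewrite ge0_fin_numE ?outer_measure_ge0.
have sA : A `<=` A `|` B by left.
have sB : B `<=` A `|` B by right.
rewrite addeC -leeBrDr; last exact: fin.
apply: ge_ereal_sup => _ [d2 d20 <-].
rewrite leeBrDr; last exact: fin.
rewrite addeC -leeBrDr; last exact: finpre.
apply: ge_ereal_sup => _ [d1 d10 <-].
rewrite leeBrDr; last exact: finpre.
exact: key.
Qed.

Let halfspace i j (a : R) : set 'M[R]_(p, q) := [set x | x i j <= a]%R.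

(* The part of [X] above [a] is cut into slabs accumulating at [a]; slabs whose
   indices have the same parity are at positive distance from each other, so
   their measures are summable. *)
Lemma caratheodory_halfspace i j (a : R) : H.-caratheodory (halfspace i j a).
Proof.
apply: le_caratheodory_measurable => X.
have [->|] := eqVneq (H X) +oo; first by rewrite leey.
rewrite -ltey => Xoo.
pose r k : R := (a + k.+1%:R^-1)%R.
have rlt k l : (k < l)%N -> (r l < r k)%R.
  by move=> kl; rewrite ltrD2l ltf_pV2 ?posrE// ltr_nat ltnS.
have rle k l : (k <= l)%N -> (r l <= r k)%R.
  by rewrite leq_eqVlt => /orP[/eqP->//|/rlt/ltW].
pose P k := X `&` [set x | r k.+1 < x i j <= r k]%R.
pose D k := X `&` [set x | r k < x i j]%R.
have parity b N : \sum_(l < N) H (P (l.*2 + b)%N) <= H (\big[setU/set0]_(l < N) P (l.*2 + b)%N).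
  elim: N => [|N IH]; first by rewrite !big_ord0 outer_measure_ge0.
  rewrite !big_ord_recr/= (le_trans (leeD2r _ IH))// addeC setUC.
  case: N {IH} => [|N]; first by rewrite !big_ord0 outer_measure0 adde0 setU0.
  set K := (N.+1.*2 + b)%N.
  apply: (@hausdorff_separated _ _ i j (r K) (r K.-1 - r K)%R).
  - by rewrite subr_gt0; apply: rlt; rewrite /K doubleS.
  - by move=> x [_ /= /andP[]].
  - rewrite -(bigcup_mkord N.+1 (fun l => P (l.*2 + b)%N)) => x [l /= lN [_ /= /andP[rx _]]].
    rewrite addrC subrK (le_trans _ (ltW rx))//; apply: rle.
    by rewrite addSn ltnS leq_add2r leq_double.
have PX b N : \sum_(l < N) H (P (l.*2 + b)%N) <= H X.
  apply: le_trans (parity b N) _; apply: le_outer_measure.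
  by rewrite -(bigcup_mkord N (fun l => P (l.*2 + b)%N)) => x [l _ []].
have sumP : \sum_(l <oo) H (P l) <= H X + H X.
  apply: lime_le; first by apply: is_cvg_nneseries => *; exact: outer_measure_ge0.
  apply: nearW => N; apply: (@le_trans _ _ (\sum_(0 <= l < N.*2) H (P l))).
    rewrite [leRHS](@big_cat_nat _ _ _ N)//=; last by rewrite -addnn leq_addr.
    by rewrite leeDl// sume_ge0// => *; exact: outer_measure_ge0.
  apply: le_trans (leeD (PX 0%N N) (PX 1%N N)).
  rewrite -big_split/=; elim: N => [|N IH]; first by rewrite big_geq// big_ord0.
  by rewrite doubleS !big_nat_recr//= big_ord_recr/= addn0 addn1 -addeA leeD2r.
have tail : \sum_(k <= l <oo) H (P l) @[k --> \oo] --> 0.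
  apply: nneseries_tail_cvg => [|*]; last exact: outer_measure_ge0.
  by apply: le_lt_trans sumP _; rewrite lte_add_pinfty.
(* A point above [a] either exceeds [a] by more than [1 / (k + 1)], and then lies in [D k], which is
   separated from the halfspace, or it lies in a slab of index at least [k]; the total measure of
   these slabs tends to 0. *)
have key k : H (X `&` halfspace i j a) + H (X `&` ~` halfspace i j a) <=
    H X + \sum_(k <= l <oo) H (P l).
  have XE : X `&` ~` halfspace i j a `<=` D k `|` \bigcup_(l in ~` `I_k) P l.
    move=> x [Xx /negP]; rewrite -ltNge => ax.
    have [rx|xr] := ltP (r k) (x i j); [by left|right].
    have ex : exists l, (r l < x i j)%R.
      have [l hl] := ltr_add_invr ax; by exists l.
    case: (ex_minnP ex) => -[|l] rl lmin.
      by have := rle 0%N k (leq0n k); lra.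
    exists l.
      move=> /= lk; suff : (r k < r k)%R by rewrite ltxx.
      by apply: (le_lt_trans _ (lt_le_trans rl xr)); exact: rle.
    split => //=; rewrite rl/= leNgt; apply/negP => /lmin; by rewrite ltnn.
  apply: (@le_trans _ _ (H (X `&` halfspace i j a) + (H (D k) + \sum_(k <= l <oo) H (P l)))).
    rewrite leeD2l// (le_trans (le_outer_measure _ _ _ XE))//.
    rewrite (le_trans (outer_measureU2 _ _ _))// leeD2l//.
    exact: outer_measure_sigma_subadditive_tail.
  rewrite addeA leeD2r//.
  apply: (@le_trans _ _ (H ((X `&` halfspace i j a) `|` D k))).
    apply: (@hausdorff_separated _ _ i j a k.+1%:R^-1); first by rewrite invr_gt0.
      by move=> x [].
    by move=> x [_ /= /ltW].
  by apply: le_outer_measure => x [[]|[]].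
have : H X + \sum_(k <= l <oo) H (P l) @[k --> \oo] --> H X + 0.
  apply: cvgeD => //; last exact: cvg_cst.
  by apply: ge0_adde_def; rewrite inE ?lexx// outer_measure_ge0.
move=> /[dup] cv /cvg_lim; rewrite adde0 => <- //.
apply: lime_ge; first by apply/cvg_ex; eexists; exact: cv.
exact: nearW.
Qed.

(** Halfspaces generate the Borel sets. Stated for the identity map, this lets every Borel function
    be composed into a function measurable for [hausdorff_measure]. *)
Lemma measurable_fun_caratheodory_id :
  measurable_fun setT (id : caratheodory_type H -> 'M[R]_(p, q)).
Proof.
apply: measurable_fun_mx => i j.
apply: (measurability _ (RGenOInfty.measurableE R)) => _ [_ [a ->] <-].
rewrite setTI; suff -> : (fun x : caratheodory_type H => (x : 'M[R]_(p, q)) i j) @^-1` `]a, +oo[ =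
    ~` halfspace i j a.
  by apply: caratheodory_measurable_setC; exact: caratheodory_halfspace.
apply/seteqP; split => x; rewrite /halfspace /= in_itv/= andbT.
  by move=> ax; apply/negP; rewrite -ltNge.
by move/negP; rewrite -ltNge.
Qed.

Lemma measurable_caratheodory A : measurable A -> H.-caratheodory A.
Proof. by move=> mA; exact: (measurable_fun_preimage measurable_fun_caratheodory_id mA). Qed.

(** Apply [f] to each set of a cover: diameters do not grow. *)
Lemma hausdorff_nonexpansive (f : 'M[R]_(p, q) -> 'M[R]_(p, q)) A :
  (forall x y, euclidean_norm (f x - f y) <= euclidean_norm (x - y))%R ->
  H (f @` A) <= H A.
Proof.
move=> fne; apply: ge_ereal_sup => _ [delta d0 <-].
apply: le_trans (hausdorff_premeasure_le_outer m A d0).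
have diamf F : diam (f @` F) <= diam F.
  apply: ge_ereal_sup => _ [[_ _] [[x Fx <-] [y Fy <-]] <-] /=.
  apply: (@le_trans _ _ (euclidean_norm (x - y))%:E); first by rewrite lee_fin.
  by apply: ereal_sup_ubound; exists (x, y).
apply: le_ereal_inf_tmp => _ [F [AF dF] <-].
apply: (@le_trans _ _ (\sum_(k <oo) hausdorff_gauge m (f @` F k))).
  apply: ereal_inf_lbound; exists (fun k => f @` F k) => //; split.
    by move=> _ [x Ax <-]; have [k _ Fx] := AF x Ax; exists k => //; exists x.
  by move=> k; exact: le_trans (diamf _) (dF k).
apply: lee_nneseries => k _; first by move=> _; exact: hausdorff_gauge_ge0.
rewrite /hausdorff_gauge; have [->|/set0P[x Fx]] := eqVneq (F k) set0.
  by rewrite image_set0 eqxx.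
case: ifPn => [_|_].
  rewrite mule_ge0//.
    by rewrite mule_ge0// lee_fin exprn_ge0// invr_ge0.
  rewrite expe_ge0// (@le_trans _ _ (euclidean_norm (x - x))%:E)//.
    by rewrite lee_fin sqrtr_ge0.
  by apply: ereal_sup_ubound; exists (x, x).
apply: lee_wpmul2l; first by rewrite mule_ge0// lee_fin exprn_ge0// invr_ge0.
apply: lee_exp2r => //.
rewrite (@le_trans _ _ (euclidean_norm (f x - f x))%:E)//.
  by rewrite lee_fin sqrtr_ge0.
by apply: ereal_sup_ubound; exists (f x, f x) => //; split; exists x.
Qed.

Lemma hausdorff_isometry (f g : 'M[R]_(p, q) -> 'M[R]_(p, q)) A :
  (forall x y, euclidean_norm (f x - f y) <= euclidean_norm (x - y))%R ->
  (forall x y, euclidean_norm (g x - g y) <= euclidean_norm (x - y))%R ->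
  cancel f g -> H (f @` A) = H A.
Proof.
move=> fne gne fK; apply/eqP; rewrite eq_le hausdorff_nonexpansive//=.
apply: le_trans (hausdorff_nonexpansive (f @` A) gne).
by rewrite image_comp (_ : g \o f = id) ?image_id//; apply/funext.
Qed.

End hausdorff.

Lemma hausdorff_const_lty {R : realType} m : (@hausdorff_const R m < +oo)%E.
Proof.
rewrite /hausdorff_const; set B := [set x : 'rV[R]_m | _].
have Bcube : B `<=` @mx_cube R 1 m 1.
  by move=> x /= x1 i j; apply: le_trans x1; exact: le_entry_euclidean_norm.
have Bfin : lebesgue_rV m B \is a fin_num.
  rewrite ge0_fin_numE//; apply: le_lt_trans (lebesgue_rV_cube_lty m 1).
  apply: le_measure => //; rewrite inE; last exact: measurable_mx_cube.
  rewrite (_ : B = (fun x : 'rV[R]_m => \sum_i \sum_j x i j ^+ 2) @^-1` `]-oo, 1]%classic).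
    by apply: measurable_fun_preimage => //; exact: measurable_sqr_sum.
  apply/seteqP; split => x; rewrite /B /= in_itv/= /euclidean_norm;
  by rewrite -[X in Num.sqrt _ <= X]sqrtr1 ler_sqrt.
by rewrite -(fineK Bfin) -EFinM ltry.
Qed.

(** The interval [[-K, K]] is cut into [N + 1] pieces of half-length [h = K / (N + 1)] with centres
    [- K + (2 l + 1) h]; the least [l] with [t <= - K + 2 (l + 1) h] designates the piece that
    contains [t]. *)
Lemma grid_cell {R : realType} (N K : nat) (t : R) : (`|t| <= K%:R)%R ->
  exists l : 'I_N.+1,
    `|t - (- K%:R + (l%:R *+ 2 + 1) * (K%:R / N.+1%:R))| <= K%:R / N.+1%:R.
Proof.
rewrite ler_norml => /andP[tK1 tK2]; set h := K%:R / N.+1%:R.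
have h0 : 0 <= h by rewrite divr_ge0.
have Nh : N.+1%:R * h = K%:R by rewrite mulrC divfK// pnatr_eq0.
have ex : exists l, t <= - K%:R + (l.+1%:R *+ 2) * h.
  by exists N; rewrite mulrnAl Nh; lra.
case: (ex_minnP ex) => l tl lmin.
have lN : (l < N.+1)%N by rewrite ltnS; apply: lmin; rewrite mulrnAl Nh; lra.
exists (Ordinal lN); rewrite /= ler_norml.
case: l tl lmin lN => [|l] tl lmin lN; first by move: tl; rewrite mulr0n !mulrDl mul0r; lra.
have : - K%:R + (l.+1%:R *+ 2) * h < t.
  by rewrite ltNge; apply/negP => /lmin; rewrite ltnn.
by move: tl; rewrite -[l.+2]addn1 natrD !mulrDl; lra.
Qed.

(** The cube is cut into [(N + 1) ^ m] cells with [m = p q], whose images have diameter at most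
    [a / (N + 1)] with [a = 2 L K]. The [m]-th powers of these diameters add up to at most [a ^ m]
    for every [N], so the bound is uniform in [delta]. *)
Lemma hausdorff_lipschitz_cube {R : realType} (p q p' q' : nat)
    (T : 'M[R]_(p, q) -> 'M[R]_(p', q')) (L : R) (K : nat) : 0 <= L ->
  (forall (e : R) (x y : 'M[R]_(p, q)), 0 <= e -> (forall i j, `|x i j - y i j| <= e) ->
    euclidean_norm (T x - T y) <= L * e) ->
  (hausdorff_outer (p * q) (T @` mx_cube K) < +oo)%E.
Proof.
move=> L0 TL; set m := (p * q)%N.
have cst0 : (0 <= @hausdorff_const R m)%E.
  by rewrite mule_ge0// lee_fin exprn_ge0// invr_ge0.
pose c : R := fine (@hausdorff_const R m).
have c0 : 0 <= c by exact: fine_ge0.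
have cE : hausdorff_const m = c%:E.
  by rewrite fineK// ge0_fin_numE//; exact: hausdorff_const_lty.
pose a : R := L * K%:R *+ 2.
have a0 : 0 <= a by rewrite mulrn_wge0// mulr_ge0.
apply: (@le_lt_trans _ _ (c * a ^+ m)%:E); last by rewrite ltry.
apply: ge_ereal_sup => _ [delta /= d0 <-].
pose N := Num.bound (a / delta).
have aN : a / N.+1%:R <= delta.
  rewrite ler_pdivrMr// mulrC -ler_pdivrMr//.
  have := archi_boundP (divr_ge0 a0 (ltW d0)); rewrite -/N => h.
  by apply: (le_trans (ltW h)); rewrite ler_nat.
pose I := {ffun 'I_p * 'I_q -> 'I_N.+1}.
pose h : R := K%:R / N.+1%:R.
pose cell (f : I) : set 'M[R]_(p, q) :=
  [set x | forall i j, `|x i j - (- K%:R + ((f (i, j))%:R *+ 2 + 1) * h)| <= h].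
pose F j : set 'M[R]_(p', q') :=
  if insub j is Some o then T @` cell (@enum_val I predT o) else set0.
have diam0 : (diam (set0 : set 'M[R]_(p', q')) <= (a / N.+1%:R)%:E)%E.
  by rewrite /diam set0X image_set0 ereal_sup0 leNye.
have diamF j : (diam (F j) <= (a / N.+1%:R)%:E)%E.
  rewrite /F; case: insubP => [l _ _|_]; last exact: diam0.
  apply: ge_ereal_sup => _ [[_ _] [[x Fx <-] [y Fy <-]] <-] /=.
  rewrite lee_fin (_ : a / _ = L * (h *+ 2)); last by rewrite /a /h; ring.
  apply: TL => [|i j']; first by rewrite mulrn_wge0// divr_ge0.
  have := Fx i j'; have := Fy i j'.
  by rewrite !ler_norml => /andP[? ?] /andP[? ?]; apply/andP; split; lra.
apply: (@le_trans _ _ (\sum_(k <oo) hausdorff_gauge m (F k))%E).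
  apply: ereal_inf_lbound; exists F => //; split; last first.
    by move=> k; apply: le_trans (diamF k) _; rewrite lee_fin.
  move=> _ [x xK <-].
  have /choice[f fP] : forall ij : 'I_p * 'I_q, exists l : 'I_N.+1,
      `|x ij.1 ij.2 - (- K%:R + (l%:R *+ 2 + 1) * h)| <= h.
    by move=> [i j]; exact: grid_cell.
  exists (enum_rank (finfun f)) => //; rewrite /F valK; exists x => // i j.
  by rewrite enum_rankK ffunE; exact: (fP (i, j)).
rewrite (nneseries_split 0 #|I|); last by move=> *; exact: hausdorff_gauge_ge0.
rewrite add0n eseries0; last first.
  move=> k Ik _; rewrite /F insubF ?/hausdorff_gauge ?eqxx//.
  by apply/negbTE; rewrite -leqNgt.
rewrite adde0 (@le_trans _ _ (\sum_(0 <= k < #|I|) (c * (a / N.+1%:R) ^+ m)%:E)%E)//.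
  apply: lee_sum => k _; rewrite /hausdorff_gauge; case: ifPn => [_|/set0P[x Fx]].
    by rewrite lee_fin mulr_ge0// exprn_ge0// divr_ge0.
  rewrite cE EFinM lee_wpmul2l// EFin_expe; apply: lee_exp2r => //.
  apply: (@le_trans _ _ (euclidean_norm (x - x))%:E).
    by rewrite lee_fin sqrtr_ge0.
  by apply: ereal_sup_ubound; exists (x, x).
rewrite sumEFin lee_fin sumr_const_nat subn0 card_ffun card_prod !card_ord -/m.
rewrite -[leLHS]mulr_natr natrX exprMn mulrA -[leLHS]mulrA -exprMn mulVf ?pnatr_eq0//.
by rewrite expr1n mulr1.
Qed.

(** * Integration over block hyperplanes *)

Section graph.
Context {R : realType} (n d : nat).
Implicit Types (y : 'rV[R]_n.+1) (k : 'I_n.+1) (z : 'M[R]_(n, d)).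

(** Solves the equation of the block hyperplane for block [k], the other blocks [z] being free; it
    serves as a parametrization when the [k]-th coordinate of [y] is nonzero. *)
Definition hyperplane_graph y k z : 'M[R]_(n.+1, d) :=
  \matrix_(i, j) (if unlift k i is Some l then z l j
    else - \sum_l y ord0 (lift k l) / y ord0 k * z l j).

Lemma row_hyperplane_graph_lift y k z l : row (lift k l) (hyperplane_graph y k z) = row l z.
Proof. by apply/rowP => j; rewrite !mxE liftK. Qed.

Lemma row_hyperplane_graph y k z : row k (hyperplane_graph y k z) =
  - \sum_l (y ord0 (lift k l) / y ord0 k) *: row l z.
Proof.
apply/rowP => j; rewrite !mxE unlift_none summxE; congr (- _).
by apply: eq_bigr => l _; rewrite !mxE.
Qed.

Lemma hyperplane_graphB y k z z' :
  hyperplane_graph y k (z - z') = hyperplane_graph y k z - hyperplane_graph y k z'.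
Proof.
apply/matrixP => i j; rewrite !mxE; case: (unlift k i) => [l|]; first by rewrite !mxE.
rewrite opprK -!sumrN -big_split/=; apply: eq_bigr => l _; rewrite !mxE; ring.
Qed.

Lemma row'_hyperplane_graph y k z : row' k (hyperplane_graph y k z) = z.
Proof. by apply/matrixP => i j; rewrite !mxE liftK. Qed.

Lemma hyperplane_graph_in y k z : y ord0 k != 0 ->
  block_hyperplane y (hyperplane_graph y k z).
Proof.
move=> yk; rewrite /block_hyperplane /= (bigD1_ord k)//= row_hyperplane_graph.
rewrite scalerN scaler_sumr addrC; apply/eqP; rewrite subr_eq0; apply/eqP.
apply: eq_bigr => l _; rewrite row_hyperplane_graph_lift scalerA; congr (_ *: _).
by rewrite mulrCA divff// mulr1.
Qed.

Lemma row'_hyperplaneK y k (x : 'M[R]_(n.+1, d)) : y ord0 k != 0 ->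
  block_hyperplane y x -> hyperplane_graph y k (row' k x) = x.
Proof.
move=> yk; rewrite /block_hyperplane /= (bigD1_ord k)//= => /eqP.
rewrite addr_eq0 => /eqP xk.
have {}xk : row k x = - \sum_l (y ord0 (lift k l) / y ord0 k) *: row l (row' k x).
  apply: (scalerI yk); rewrite xk scalerN; congr (- _).
  rewrite scaler_sumr; apply: eq_bigr => l _; rewrite scalerA mulrCA divff// mulr1.
  by congr (_ *: _); apply/rowP => j; rewrite !mxE.
apply/matrixP => i j; case: (unliftP k i) => [l|] ->.
  by rewrite mxE liftK mxE.
by have /rowP/(_ j) := row_hyperplane_graph y k (row' k x); rewrite -xk !mxE.
Qed.

Lemma measurable_hyperplane_graph y k : measurable_fun setT (hyperplane_graph y k).
Proof.
apply: measurable_fun_mx => i j.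
rewrite (_ : (fun _ => _) = (fun z : 'M[R]_(n, d) => if unlift k i is Some l then z l j
    else - \sum_l y ord0 (lift k l) / y ord0 k * z l j)); last first.
  by apply/funext => z; rewrite mxE.
case: (unlift k i) => [l|]; first exact: measurable_mx_entry.
apply: measurable_funN; apply: measurable_sum => l; apply: measurable_funM => //.
exact: measurable_mx_entry.
Qed.

Lemma measurable_row' k : measurable_fun setT (row' k : 'M[R]_(n.+1, d) -> _).
Proof.
apply: measurable_fun_mx => i j.
rewrite (_ : (fun _ => _) = (fun z : 'M[R]_(n.+1, d) => z (lift k i) j)); last first.
  by apply/funext => z; rewrite mxE.
exact: measurable_mx_entry.
Qed.

Lemma measurable_block_hyperplane y : measurable (block_hyperplane (d := d) y).
Proof.
rewrite (_ : block_hyperplane y = \bigcap_(j : 'I_d)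
    (fun x : 'M[R]_(n.+1, d) => \sum_i y ord0 i * x i j) @^-1` [set 0]).
  apply: fin_bigcap_measurable => [|j _]; first exact: finite_finset.
  apply: measurable_fun_preimage => //; apply: measurable_sum => i.
  by apply: measurable_funM => //; exact: measurable_mx_entry.
have E (x : 'M[R]_(n.+1, d)) j :
    (\sum_i y ord0 i *: row i x) ord0 j = \sum_i y ord0 i * x i j.
  by rewrite summxE; apply: eq_bigr => i _; rewrite !mxE.
apply/seteqP; split => [x /rowP h j _|x h] /=.
  by rewrite -E h mxE.
by apply/rowP => j; rewrite E mxE; exact: h.
Qed.

Lemma euclidean_norm_le p q (x : 'M[R]_(p, q)) c : 0 <= c ->
  (forall i j, `|x i j| <= c) -> euclidean_norm x <= Num.sqrt (p * q)%:R * c.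
Proof.
move=> c0 xc; rewrite -[X in _ * X](ger0_norm c0) -(sqrtr_sqr c) -sqrtrM//.
apply: ler_wsqrtr; apply: (@le_trans _ _ (\sum_(i < p) \sum_(j < q) c ^+ 2)).
  apply: ler_sum => i _; apply: ler_sum => j _.
  by rewrite -real_normK ?num_real// lerXn2r ?nnegrE.
rewrite !sumr_const !card_ord -mulrnA mulr_natl mulnC; exact: lexx.
Qed.

(** [M] bounds the map for the largest absolute entry, and the square root of the number of entries
    passes to the Euclidean norm. *)
Lemma hyperplane_graph_lipschitz y k : exists2 L : R, 0 <= L &
  forall (e : R) (x z : 'M[R]_(n, d)), 0 <= e -> (forall i j, `|x i j - z i j| <= e) ->
    euclidean_norm (hyperplane_graph y k x - hyperplane_graph y k z) <= L * e.
Proof.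
pose M := 1 + \sum_l `|y ord0 (lift k l) / y ord0 k|.
have M1 : 1 <= M by rewrite lerDl sumr_ge0.
exists (Num.sqrt (n.+1 * d)%:R * M).
  by rewrite mulr_ge0// ?sqrtr_ge0// (le_trans _ M1).
move=> e x z e0 xz; rewrite -mulrA; apply: euclidean_norm_le => [|i j].
  by rewrite mulr_ge0// (le_trans _ M1).
rewrite -hyperplane_graphB mxE; case: (unlift k i) => [l|].
  by rewrite !mxE (le_trans (xz l j))// ler_peMl.
rewrite normrN mulrDl mul1r (le_trans (ler_norm_sum _ _ _))//.
apply: (@le_trans _ _ ((\sum_l `|y ord0 (lift k l) / y ord0 k|) * e)); last first.
  by rewrite lerDr.
by rewrite mulr_suml; apply: ler_sum => l _; rewrite normrM !mxE ler_wpM2l.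
Qed.

End graph.

Section section_measure.
Local Open Scope ereal_scope.
Context {R : realType} (n d : nat).

Lemma ge0_integral_mrestr dd (T : measurableType dd) (mu : {measure set T -> \bar R})
    (D : set T) (mD : measurable D) (f : T -> \bar R) :
  measurable_fun setT f -> (forall x, 0 <= f x) ->
  \int[mrestr mu mD]_x f x = \int[mu]_(x in D) f x.
Proof.
move=> mf f0; rewrite -(setUv D) ge0_integral_setU//=; last 3 first.
- exact: measurableC.
- by rewrite setUv.
- by rewrite disj_set2E setICr.
have -> : \int[mrestr mu mD]_(x in ~` D) f x = 0.
  apply: null_set_integral; [exact: measurableC|exact: measurable_funTS|].
  by rewrite /= /mrestr setICl measure0.
rewrite adde0.
by apply: eq_measure_integral => A mA AD; rewrite /= /mrestr setIidl.
Qed.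

(** Pulled back to the free blocks, the Hausdorff measure becomes [nu]. It is finite on cubes
    because the graph map is Lipschitz, and translation invariant because shifting [z] by [a] shifts
    the graph by a fixed vector, which is an isometry. The factor [c] still depends on [y] and [k].
    The dimension is a variable [m] with an equation because the section function writes it as a
    difference. *)
Lemma ge0_integral_block_hyperplane (m : nat) (y : 'rV[R]_n.+1) (k : 'I_n.+1) :
  m = (n * d)%N -> (y ord0 k != 0)%R ->
  exists2 c : R, (0 <= c)%R & forall f : 'M[R]_(n.+1, d) -> \bar R,
    measurable_fun setT f -> (forall x, 0 <= f x) ->
    \int[hausdorff_measure m]_(x in block_hyperplane y) f x =
    c%:E * \int[lebesgue_mx n]_z f (hyperplane_graph y k z).
Proof.
move=> -> yk; set mu := hausdorff_measure (n * d).
pose H := @hausdorff_outer_measure R n.+1 d (n * d).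
have mD : measurable (block_hyperplane y : set (caratheodory_type H)).
  exact: (measurable_caratheodory (n * d) (@measurable_block_hyperplane R n d y)).
have mp : measurable_fun setT (row' k : caratheodory_type H -> 'M[R]_(n, d)).
  exact: (measurableT_comp (@measurable_row' R n d k) (@measurable_fun_caratheodory_id R _ _ _)).
pose nu : {measure set 'M[R]_(n, d) -> \bar R} :=
  measure_function_pushforward__canonical__measure_function_Measure (mrestr mu mD) mp.
have nuE A : nu A = H (hyperplane_graph y k @` A).
  rewrite /nu /= /pushforward /mrestr; congr (H _); apply/seteqP; split => [x [/= Ax Dx]|_ [z Az <-]].
    by exists (row' k x) => //; exact: row'_hyperplaneK.
  by split; rewrite /= ?row'_hyperplane_graph//; exact: hyperplane_graph_in.
have [c c0 cE] : exists2 c : R, (0 <= c)%R & forall A, measurable A -> nu A = c%:E * lebesgue_mx n A.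
  apply: translation_invariant_lebesgue_mx => [K|a A mA].
    rewrite nuE; have [L L0 HL] := @hyperplane_graph_lipschitz R n d y k.
    exact: (hausdorff_lipschitz_cube K L0 HL).
  rewrite !nuE; set b := hyperplane_graph y k a.
  rewrite -[RHS](@hausdorff_isometry _ _ _ _ (fun x => x - b)%R (fun x => x + b)%R); last 3 first.
  - by move=> x z; rewrite opprB addrA subrK.
  - by move=> x z; rewrite opprD addrACA subrr addr0.
  - by move=> x; rewrite subrK.
  congr (H _); apply/seteqP; split => [_ [z Az <-]|_ [_ [z Az <-] <-]].
    by exists (hyperplane_graph y k (z + a)); [exists (z + a)%R|rewrite /b -hyperplane_graphB addrK].
  by exists (z - a)%R; rewrite /= ?subrK// hyperplane_graphB.
exists c => // f mf f0.
have mg := @measurable_hyperplane_graph R n d y k.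
transitivity (\int[mu]_(x in block_hyperplane y) f (hyperplane_graph y k (row' k x))).
  by apply: eq_integral => x /[!inE] Dx; rewrite row'_hyperplaneK.
pose g z := f (hyperplane_graph y k z).
have mfg : measurable_fun setT g by exact: (measurableT_comp mf mg).
have g0 z : 0 <= g z by exact: f0.
transitivity (\int[mrestr mu mD]_x g (row' k x)).
  apply/esym; apply: ge0_integral_mrestr; last by move=> x; exact: g0.
  exact: (measurableT_comp mfg mp).
transitivity (\int[nu]_z g z).
  by rewrite (ge0_integral_pushforward mp (mrestr mu mD) measurableT mfg).
transitivity (\int[mscale (NngNum c0) (lebesgue_mx n)]_z g z); last exact: ge0_integral_mscale.
by apply: eq_measure_integral => A mA _; exact: cE.
Qed.

End section_measure.

(** * Gaussian integrals over block hyperplanes *)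

Section gaussian.
Context {R : realType}.

Definition sqr_sum m n (x : 'M[R]_(m, n)) : R := \sum_i \sum_j x i j ^+ 2.

Lemma sqr_sum_rV n (x : 'rV[R]_n) : sqr_sum x = \sum_j x ord0 j ^+ 2.
Proof. by rewrite /sqr_sum big_ord1. Qed.

Lemma sqr_sum_rows m n (x : 'M[R]_(m, n)) : sqr_sum x = \sum_i sqr_sum (row i x).
Proof.
by apply: eq_bigr => i _; rewrite sqr_sum_rV; apply: eq_bigr => j _; rewrite mxE.
Qed.

Definition gaussian m n (x : 'M[R]_(m, n)) : R := expR (- sqr_sum x).

Lemma measurable_gaussian m n : measurable_fun setT (@gaussian m n).
Proof.
apply: (measurableT_comp (@measurable_expR R)).
by apply: measurable_funN; exact: measurable_sqr_sum.
Qed.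

Lemma measurable_rows_comb n d (a : 'I_n -> R) (b : 'rV[R]_d) :
  measurable_fun setT (fun z : 'M[R]_(n, d) => b + \sum_l a l *: row l z).
Proof.
apply: measurable_fun_mx => i j.
rewrite (_ : (fun _ => _) = (fun z : 'M[R]_(n, d) => b i j + \sum_l a l * z l j)); last first.
  by apply/funext => z; rewrite mxE summxE; congr (_ + _); apply: eq_bigr => l _; rewrite !mxE.
apply: measurable_funD => //; apply: measurable_sum => l.
by apply: measurable_funM => //; exact: measurable_mx_entry.
Qed.

Lemma measurable_expR_sqr_sum p q p' q' (s : R) (g : 'M[R]_(p, q) -> 'M[R]_(p', q')) :
  measurable_fun setT g ->
  measurable_fun setT (fun x => (expR (- (sqr_sum x + s * sqr_sum (g x))))%:E).
Proof.
move=> mg; apply/measurable_EFinP; apply: (measurableT_comp (@measurable_expR R)).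
apply: measurable_funN; apply: measurable_funD; first exact: measurable_sqr_sum.
apply: measurable_funM => //.
exact: (measurableT_comp (@measurable_sqr_sum R p' q') mg).
Qed.

Local Open Scope ereal_scope.

Lemma integral_gaussian_rV n :
  \int[lebesgue_rV n]_x (gaussian x)%:E = ((Num.sqrt pi) ^+ n)%:E.
Proof.
elim: n => [|n IH].
  rewrite integral_dirac//; last by apply/measurable_EFinP; exact: measurable_gaussian.
  rewrite diracT mul1e /gaussian sqr_sum_rV big_ord0.
  by rewrite oppr0 expR0 expr0.
rewrite ge0_integral_row_cons; last 2 first.
- by apply/measurable_EFinP; exact: measurable_gaussian.
- by move=> x; rewrite lee_fin expR_ge0.
transitivity (\int[@lebesgue_measure R]_x ((Num.sqrt pi ^+ n)%:E * (@gauss_fun R x)%:E)).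
  apply: eq_integral => x _; rewrite muleC -IH -ge0_integralZl//; last 3 first.
  - by apply/measurable_EFinP; exact: measurable_gaussian.
  - by move=> v _; rewrite lee_fin expR_ge0.
  - by rewrite lee_fin expR_ge0.
  apply: eq_integral => v _; rewrite -EFinM; congr EFin.
  rewrite /gaussian /gauss_fun -expRD -opprD; congr (expR (- _)%R).
  rewrite !sqr_sum_rV big_ord_recl mxE unlift_none /=; congr (_ + _)%R.
  by apply: eq_bigr => j _; rewrite mxE liftK.
rewrite ge0_integralZl; [|exact: measurableT| | |]; last 3 first.
- by apply/measurable_EFinP; exact: measurable_gauss_fun.
- by move=> x _; rewrite lee_fin gauss_fun_ge0.
- by rewrite lee_fin exprn_ge0// sqrtr_ge0.
by rewrite integralT_gauss -EFinM exprSr.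
Qed.

Let K d : R := (Num.sqrt pi ^+ d)%R.

(** Completing the square: with [u = 1 + s alpha^2], [rho^2 = u], [be = s alpha / rho] and
    [t = s / u = s - be^2], the exponent is minus [|rho x + be b|^2 + t |b|^2]. A dilation and a
    translation then remove [rho] and [be b]. *)
Lemma integral_gaussian_square d (s alpha : R) (b : 'rV[R]_d) : (0 <= s)%R ->
  \int[lebesgue_rV d]_x (expR (- (sqr_sum x + s * sqr_sum (b + alpha *: x))))%:E =
  ((Num.sqrt (1 + s * alpha ^+ 2))^-1 ^+ d * K d *
   expR (- (s / (1 + s * alpha ^+ 2) * sqr_sum b)))%:E.
Proof.
move=> s0; set u := (1 + s * alpha ^+ 2)%R; set rho := Num.sqrt u.
have u0 : (0 < u)%R by rewrite ltr_pwDl// mulr_ge0// sqr_ge0.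
have rho0 : (0 < rho)%R by rewrite sqrtr_gt0.
have rho2 : (rho ^+ 2 = u)%R by rewrite sqr_sqrtr// ltW.
set t := (s / u)%R; pose be := (s * alpha / rho)%R.
have mG := @measurable_gaussian 1 d.
have G0 (x : 'rV[R]_d) : 0 <= (gaussian x)%:E by rewrite lee_fin expR_ge0.
transitivity (\int[lebesgue_rV d]_x ((expR (- (t * sqr_sum b)))%:E *
    (gaussian (rho *: x + be *: b))%:E)).
  apply: eq_integral => x _; rewrite -EFinM -expRD; congr (expR _)%:E.
  rewrite -opprD; congr (- _)%R; rewrite !sqr_sum_rV !mulr_sumr -!big_split/=.
  apply: eq_bigr => j _; rewrite !mxE.
  have -> : t = (s - be ^+ 2)%R.
    rewrite /be expr_div_n rho2 /t; apply: (mulIf (lt0r_neq0 u0)).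
    by rewrite mulrBl !divfK ?lt0r_neq0// /u; ring.
  have -> : ((rho * x ord0 j + be * b ord0 j) ^+ 2 =
      u * x ord0 j ^+ 2 + (s * alpha * x ord0 j * b ord0 j) *+ 2 + be ^+ 2 * b ord0 j ^+ 2)%R.
    rewrite -rho2 (_ : (s * alpha)%R = (rho * be)%R); first by ring.
    by rewrite /be mulrCA divff ?mulr1// lt0r_neq0.
  by rewrite /u; ring.
rewrite ge0_integralZl; [|exact: measurableT| | |]; last 3 first.
- apply/measurable_EFinP; apply: (measurableT_comp mG).
  exact: (measurableT_comp (@measurable_addrmx R 1 d (be *: b)) (@measurable_scalemx R 1 d rho)).
- by move=> x _; exact: G0.
- by rewrite lee_fin expR_ge0.
rewrite (ge0_integral_rV_scale (a := rho) (f := fun x => (gaussian (x + be *: b))%:E)) ?lt0r_neq0//; last first.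
  by apply/measurable_EFinP; apply: (measurableT_comp mG); exact: measurable_addrmx.
rewrite (ge0_integral_shift (mu := lebesgue_rV d) (f := fun x => (gaussian x)%:E)); last 3 first.
- exact: lebesgue_rV_translation.
- by apply/measurable_EFinP; exact: mG.
- exact: G0.
by rewrite integral_gaussian_rV -!EFinM gtr0_norm// mulrC.
Qed.

(** General [s] and [b] make the induction close: integrating out the first block leaves an
    integrand of the same form with [s] replaced by [s / u], where [u = 1 + s a_0^2]. The factors
    recombine because [u (1 + (s / u) S) = 1 + s (a_0^2 + S)], [S] being the sum of the other
    squares. *)
Lemma integral_gaussian_rows n d (s : R) (a : 'I_n -> R) (b : 'rV[R]_d) : (0 <= s)%R ->
  \int[lebesgue_mx n]_z
    (expR (- (sqr_sum z + s * sqr_sum (b + \sum_l a l *: row l z))))%:E =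
  ((Num.sqrt (1 + s * \sum_l a l ^+ 2))^-1 ^+ d * K d ^+ n *
   expR (- (s / (1 + s * \sum_l a l ^+ 2) * sqr_sum b)))%:E.
Proof.
elim: n a b s => [|n IH] a b s s0.
  rewrite integral_dirac//; last first.
    exact: (measurable_expR_sqr_sum s (measurable_rows_comb a b)).
  rewrite diracT mul1e !big_ord0 mulr0 !addr0 sqrtr1 !invr1 expr1n expr0 !mul1r mulr1.
  by congr (expR (- _))%:E; rewrite /sqr_sum big_ord0 add0r.
pose f (z : 'M[R]_(n.+1, d)) : \bar R :=
  (expR (- (sqr_sum z + s * sqr_sum (b + \sum_l a l *: row l z))))%:E.
have mf : measurable_fun setT f.
  exact: (measurable_expR_sqr_sum s (measurable_rows_comb a b)).
have f0 z : 0 <= f z by rewrite lee_fin expR_ge0.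
have mfc := measurableT_comp mf (@measurable_rows_cons R d n).
rewrite (ge0_integral_rows_cons mf f0) (fubini_tonelli2 (f \o @rows_cons R d n))//; last first.
  by move=> x; exact: f0.
rewrite /fubini_G /=.
set al := a ord0; pose a' l := a (lift ord0 l).
pose u := (1 + s * al ^+ 2)%R.
have u0 : (0 < u)%R by rewrite ltr_pwDl// mulr_ge0// sqr_ge0.
transitivity (\int[lebesgue_mx n]_v
   (((Num.sqrt u)^-1 ^+ d * K d)%:E * (expR (- (sqr_sum v + s / u *
      sqr_sum (b + \sum_l a' l *: row l v))))%:E)).
  apply: eq_integral => v _.
  transitivity (\int[lebesgue_rV d]_x ((expR (- sqr_sum v))%:E *
      (expR (- (sqr_sum x + s * sqr_sum ((b + \sum_l a' l *: row l v) + al *: x))))%:E)).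
    apply: eq_integral => x _; rewrite -EFinM -expRD -opprD /f; congr (expR (- _))%:E.
    rewrite (sqr_sum_rows (rows_cons _)) !big_ord_recl !row_rows_cons0 /= -addrA addrCA.
    rewrite (sqr_sum_rows v) -/al.
    congr (_ + (_ + _ * (@sqr_sum 1 d _)))%R.
      by apply: eq_bigr => i _; rewrite row_rows_cons_lift.
    rewrite -addrA [X in (b + X)%R]addrC; congr (_ + (_ + _))%R.
    by apply: eq_bigr => i _; rewrite row_rows_cons_lift.
  rewrite ge0_integralZl; [|exact: measurableT| | |]; last 3 first.
  - apply: measurable_expR_sqr_sum; under eq_fun do rewrite addrC.
    exact: (measurableT_comp (@measurable_addrmx R 1 d _) (@measurable_scalemx R 1 d al)).
  - by move=> x _; rewrite lee_fin expR_ge0.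
  - by rewrite lee_fin expR_ge0.
  rewrite integral_gaussian_square// -!EFinM opprD expRD; congr EFin.
  by rewrite -/u; ring.
have t0 : (0 <= s / u)%R by rewrite divr_ge0// ltW.
rewrite ge0_integralZl; [|exact: measurableT| | |]; last 3 first.
- exact: (measurable_expR_sqr_sum (s / u) (measurable_rows_comb a' b)).
- by move=> x _; rewrite lee_fin expR_ge0.
- by rewrite lee_fin mulr_ge0// exprn_ge0 ?invr_ge0 ?sqrtr_ge0// exprn_ge0// sqrtr_ge0.
rewrite IH// -!EFinM; congr EFin.
set S := (\sum_l a' l ^+ 2)%R.
have S0 : (0 <= S)%R by apply: sumr_ge0 => l _; exact: sqr_ge0.
have uS : (u * (1 + s / u * S) = 1 + s * \sum_l a l ^+ 2)%R.
  by rewrite big_ord_recl -/al -/S mulrDr mulr1 mulrA mulrCA divff ?lt0r_neq0// /u; ring.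
rewrite -uS sqrtrM ?ltW// (exprS (K d)) mulrA; congr (_ * _)%R.
  rewrite invfM exprMn.
  ring.
by rewrite invfM mulrA.
Qed.

Lemma sqr_sum_hyperplane_graph n d (y : 'rV[R]_n.+1) k (z : 'M[R]_(n, d)) :
  sqr_sum (hyperplane_graph y k z) =
  (sqr_sum z + 1 * sqr_sum (0 + \sum_l (y ord0 (lift k l) / y ord0 k) *: row l z))%R.
Proof.
rewrite sqr_sum_rows (bigD1_ord k)//= row_hyperplane_graph mul1r add0r addrC.
congr (_ + _)%R.
  by rewrite sqr_sum_rows; apply: eq_bigr => l _; rewrite row_hyperplane_graph_lift.
by rewrite /sqr_sum; apply: eq_bigr => i _; apply: eq_bigr => j _; rewrite mxE sqrrN.
Qed.

(** For a unit vector, 1 plus the sum of [(y_l / y_k)^2] over [l] different from [k] equals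
    [y_k^-2]; the inverse of its square root is [|y_k|]. *)
Lemma integral_gaussian_hyperplane_graph n d (y : 'rV[R]_n.+1) k :
  (y ord0 k != 0)%R -> (\sum_i y ord0 i ^+ 2 = 1)%R ->
  \int[lebesgue_mx n]_z (gaussian (hyperplane_graph y k z : 'M[R]_(n.+1, d)))%:E =
  (`|y ord0 k| ^+ d * Num.sqrt pi ^+ (n * d))%:E.
Proof.
move=> yk y1; under eq_integral do rewrite /gaussian sqr_sum_hyperplane_graph.
rewrite integral_gaussian_rows// /K /= /sqr_sum [X in expR (- (_ * X))]big1 ?mulr0 ?oppr0 ?expR0 ?mulr1; last first.
  by move=> i _; apply: big1 => j _; rewrite mxE expr0n.
rewrite mulnC exprM; congr ((_ ^+ _) * _)%:E.
rewrite mul1r (_ : (1 + _)%R = ((y ord0 k)^-1) ^+ 2)%R.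
  by rewrite sqrtr_sqr normrV ?unitfE// invrK.
rewrite -[RHS]mul1r -[X in (_ = X * _)%R]y1 (bigD1_ord k)//= mulrDl exprVn divff ?expf_neq0//.
by congr (_ + _)%R; rewrite mulr_suml; apply: eq_bigr => l _; rewrite expr_div_n.
Qed.

End gaussian.

(** * Reflections and the Hausdorff measure of hyperplanes *)

Section rotation.
Local Open Scope ereal_scope.
Context {R : realType} (n d m : nat).

Lemma sqr_sum_trace p q (x : 'M[R]_(p, q)) : sqr_sum x = (\tr (x^T *m x))%R.
Proof.
rewrite /sqr_sum exchange_big /mxtrace; apply: eq_bigr => j _; rewrite !mxE.
by apply: eq_bigr => i _; rewrite mxE expr2.
Qed.

Lemma measurable_mulmx p q r (U : 'M[R]_(p, q)) :
  measurable_fun setT (fun x : 'M[R]_(q, r) => U *m x)%R.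
Proof.
apply: measurable_fun_mx => i j.
rewrite (_ : (fun _ => _) = (fun x : 'M[R]_(q, r) => \sum_l U i l * x l j)%R); last first.
  by apply/funext => x; rewrite mxE.
by apply: measurable_sum => l; apply: measurable_funM => //; exact: measurable_mx_entry.
Qed.

(** [U] is the reflection in the hyperplane orthogonal to [w = y - e]. Since [y] and [e] have the
    same norm, [y w^T] is half of [w w^T], so [y] is moved by exactly [- w]. Being symmetric and
    involutive, [U] is orthogonal and its own inverse. *)
Lemma householder (y e : 'rV[R]_n) : (y *m y^T = e *m e^T)%R ->
  exists U : 'M[R]_n, [/\ U^T = U, (U *m U = 1%:M)%R & (y *m U = e)%R].
Proof.
move=> ye; have [<-|yne] := eqVneq y e.
  by exists 1%:M%R; rewrite trmx1 !mulmx1.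
set w := (y - e)%R; pose s := (w *m w^T)%R ord0 ord0.
have ww : (w *m w^T = s%:M)%R by rewrite [LHS]mx11_scalar.
have s0 : (s != 0)%R.
  rewrite /s mxE; under eq_bigr do rewrite [(w^T)%R _ _]mxE -expr2.
  rewrite psumr_eq0; last by move=> *; exact: sqr_ge0.
  apply: contra yne => /allP h; rewrite -subr_eq0 -/w; apply/eqP/rowP => j.
  have := h j; rewrite mem_index_enum sqrf_eq0 => /(_ isT)/eqP ->.
  by rewrite mxE.
have yw : (y *m w^T = (s / 2)%:M)%R.
  have swap : (e *m y^T = y *m e^T)%R.
    apply/matrixP => i j; rewrite !mxE; apply: eq_bigr => l _.
    by rewrite !mxE !ord1 mulrC.
  have : (y *m w^T + y *m w^T = s%:M)%R.
    rewrite -ww.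
    have -> : (w *m w^T = y *m w^T - e *m w^T)%R by rewrite /w mulmxBl.
    by rewrite /w linearB/= !mulmxBr swap -ye -(opprB (y *m y^T)%R) opprK.
  move=> h; apply: (@scalerI _ _ 2%R); first by rewrite pnatr_eq0.
  by rewrite scaler_nat mulr2n h scale_scalar_mx mulrC divfK.
exists (1%:M - (2 / s) *: (w^T *m w))%R; split.
- by rewrite linearB/= trmx1 linearZ/= trmx_mul trmxK.
- have : ((w^T *m w) *m (w^T *m w) = s *: (w^T *m w))%R.
    by rewrite mulmxA -(mulmxA w^T) ww mul_mx_scalar -scalemxAl.
  move: (w^T *m w)%R => P PP.
  rewrite mulmxBl mul1mx mulmxBr mulmx1 -scalemxAl -scalemxAr PP !scalerA.
  by apply/matrixP => i j; rewrite !mxE; field.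
- rewrite mulmxBr mulmx1 -scalemxAr [X in (_ *: X)%R]mulmxA yw mul_scalar_mx scalerA.
  rewrite (_ : 2 / s * (s / 2) = 1)%R ?scale1r ?subKr//.
  by field; rewrite s0.
Qed.

Local Notation H := (@hausdorff_outer_measure R n d m).

(** [x |-> U x] carries the hyperplane of [y] onto that of [e], since [e U x = y U U x = y x], and
    it is a Euclidean isometry, so it preserves the Hausdorff measure. *)
Lemma ge0_integral_block_hyperplane_rotation (U : 'M[R]_n) (y e : 'rV[R]_n)
    (f : 'M[R]_(n, d) -> \bar R) :
  (U^T = U)%R -> (U *m U = 1%:M)%R -> (y *m U = e)%R ->
  measurable_fun setT f -> (forall x, 0 <= f x) -> (forall x, f (U *m x)%R = f x) ->
  \int[hausdorff_measure m]_(x in block_hyperplane y) f x =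
  \int[hausdorff_measure m]_(x in block_hyperplane e) f x.
Proof.
move=> UT UU yU mf f0 fU.
have mid := @measurable_fun_caratheodory_id R n d m.
(* The restriction of the Hausdorff measure to Borel sets, for which multiplication by [U] is a
   measurable self-map. *)
pose muB : {measure set 'M[R]_(n, d) -> \bar R} :=
  measure_function_pushforward__canonical__measure_function_Measure (hausdorff_measure m) mid.
have mD (z : 'rV[R]_n) : measurable (block_hyperplane (d := d) z).
  rewrite (_ : block_hyperplane z = (fun x : 'M[R]_(n, d) => z *m x)%R @^-1`
      [set x : 'rV[R]_d | forall i j, [set 0%R : R] (x i j)]).
    apply: measurable_fun_preimage; first exact: measurable_mulmx.
    exact: measurable_box.
  rewrite /block_hyperplane; apply/seteqP; split => x /=; rewrite -mulmx_sum_row.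
    by move=> -> i j; rewrite mxE.
  by move=> h; apply/matrixP => i j; rewrite h mxE.
have E (z : 'rV[R]_n) : \int[hausdorff_measure m]_(x in block_hyperplane z) f x =
    \int[muB]_x (f \_ (block_hyperplane z)) x.
  rewrite -integral_mkcond; symmetry.
  apply: (ge0_integral_pushforward mid (hausdorff_measure m) (mD z)) => //.
  exact: measurable_funTS.
pose g (x : 'M[R]_(n, d)) := (U *m x)%R.
have gK : involutive g by move=> x; rewrite /g mulmxA UU mul1mx.
have gne x z : (euclidean_norm (g x - g z) <= euclidean_norm (x - z))%R.
  rewrite /g -mulmxBr /euclidean_norm -!/(sqr_sum _) !sqr_sum_trace trmx_mul UT.
  by rewrite mulmxA -(mulmxA _ U U) UU mulmx1.
rewrite !E.
rewrite -(@ge0_integral_invariant R _ _ muB g (f \_ (block_hyperplane e))).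
- apply: eq_integral => x _; rewrite !patchE /g fU; congr (if _ then _ else _).
  by apply/idP/idP; rewrite !inE /block_hyperplane /= -!mulmx_sum_row mulmxA
    -yU -(mulmxA y U U) UU mulmx1.
- exact: measurable_mulmx.
- move=> A mA; rewrite /muB /= /pushforward -(hausdorff_isometry m A gne gne gK).
  congr (H _); apply/seteqP; split => [x Ax|_ [x Ax <-]].
    by exists (g x); rewrite ?gK.
  by rewrite /= gK.
- by apply/(measurable_restrictT f (mD e)); exact: measurable_funTS.
- by move=> x; rewrite patchE; case: ifP.
Qed.

End rotation.

(** [W] is the factor for the first basis vector [e]. Equating the Gaussian integrals over the
    hyperplanes of [y] and [e] gives [c |y_k|^d pi^(n d / 2) = W pi^(n d / 2)], where [c] is the
    factor for [y] and [k]. *)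
Lemma ge0_integral_block_hyperplane_unit {R : realType} (n d m : nat) : m = (n * d)%N ->
  exists2 W : R, 0 <= W & forall (y : 'rV[R]_n.+1) (k : 'I_n.+1) (f : 'M[R]_(n.+1, d) -> \bar R),
    y ord0 k != 0 -> \sum_i y ord0 i ^+ 2 = 1 ->
    measurable_fun setT f -> (forall x, (0 <= f x)%E) ->
    (\int[hausdorff_measure m]_(x in block_hyperplane y) f x =
    (W * `|y ord0 k|^-1 ^+ d)%:E * \int[lebesgue_mx n]_z f (hyperplane_graph y k z))%E.
Proof.
move=> mE; pose e : 'rV[R]_n.+1 := delta_mx ord0 ord0.
have e0 : e ord0 ord0 = 1 by rewrite mxE.
have e1 : \sum_i e ord0 i ^+ 2 = 1.
  rewrite (bigD1 ord0)//= e0 expr1n big1 ?addr0// => i /negbTE i0.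
  by rewrite mxE i0 andbF expr0n.
have [W W0 HW] := @ge0_integral_block_hyperplane R n d m e ord0 mE ltac:(by rewrite e0 oner_neq0).
exists W => // y k f yk y1 mf f0.
have [c c0 Hc] := ge0_integral_block_hyperplane mE yk.
rewrite Hc//; congr (_%:E * _)%E.
have ye : y *m y^T = e *m e^T.
  apply/matrixP => i j; rewrite !mxE !ord1.
  transitivity (\sum_i y ord0 i ^+ 2); first by apply: eq_bigr => l _; rewrite mxE expr2.
  by rewrite y1 -[LHS]e1; apply: eq_bigr => l _; rewrite [e^T _ _]mxE expr2.
have [U [UT UU yU]] := householder ye.
have mG : measurable_fun setT (fun x : 'M[R]_(n.+1, d) => (gaussian x)%:E).
  by apply/measurable_EFinP; exact: measurable_gaussian.
have G0 (x : 'M[R]_(n.+1, d)) : (0 <= (gaussian x)%:E)%E by rewrite lee_fin expR_ge0.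
have GU (x : 'M[R]_(n.+1, d)) : (gaussian (U *m x))%:E = (gaussian x)%:E.
  by rewrite /gaussian !sqr_sum_trace trmx_mul UT mulmxA -(mulmxA _ U U) UU mulmx1.
have := ge0_integral_block_hyperplane_rotation m UT UU yU mG G0 GU.
rewrite Hc// HW// !integral_gaussian_hyperplane_graph ?e0 ?oner_neq0//.
rewrite normr1 expr1n mul1r -!EFinM => -[]; rewrite mulrA => /mulIf <-.
  by rewrite -mulrA -exprMn divff ?normr_eq0// expr1n mulr1.
by rewrite expf_neq0// lt0r_neq0// sqrtr_gt0 pi_gt0.
Qed.

(** * Fourier inversion *)

Section trig_integral.
Local Open Scope ereal_scope.
Context {R : realType}.

(** The real form of: the integral of [F exp (i th)] equals the real number [c]. Integrability of
    [F] is part of it for the sake of Fubini's theorem, and the vanishing sine integral is what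
    makes values multiply. *)
Definition trig_integral d (T : measurableType d) (m : set T -> \bar R)
    (F th : T -> R) (c : R) : Prop :=
  [/\ m.-integrable setT (EFin \o F), measurable_fun setT th,
      \int[m]_x (F x * cos (th x))%:E = c%:E &
      \int[m]_x (F x * sin (th x))%:E = 0].

Lemma integrable_mul_bounded d (T : measurableType d) (m : {measure set T -> \bar R})
    (F g : T -> R) : m.-integrable setT (EFin \o F) -> measurable_fun setT g ->
  (forall x, `|g x| <= 1)%R -> m.-integrable setT (fun x => (F x * g x)%:E).
Proof.
move=> iF mg g1; have mF : measurable_fun setT F.
  by apply/measurable_EFinP; exact: measurable_int iF.
apply: (le_integrable measurableT _ _ iF).
  by apply/measurable_EFinP; exact: measurable_funM.
by move=> x _ /=; rewrite lee_fin normrM ler_piMr.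
Qed.

Lemma measurable_cos_comp d (T : measurableType d) (th : T -> R) :
  measurable_fun setT th -> measurable_fun setT (fun x => cos (th x)).
Proof.
move=> mth; apply: (measurableT_comp _ mth).
by apply: continuous_measurable_fun; exact: continuous_cos.
Qed.

Lemma measurable_sin_comp d (T : measurableType d) (th : T -> R) :
  measurable_fun setT th -> measurable_fun setT (fun x => sin (th x)).
Proof.
move=> mth; apply: (measurableT_comp _ mth).
by apply: continuous_measurable_fun; exact: continuous_sin.
Qed.

Lemma integral_prod_mul d1 d2 (T1 : measurableType d1) (T2 : measurableType d2)
    (m1 : {sigma_finite_measure set T1 -> \bar R})
    (m2 : {sigma_finite_measure set T2 -> \bar R}) (u : T1 -> R) (v : T2 -> R) :
  m1.-integrable setT (EFin \o u) -> m2.-integrable setT (EFin \o v) ->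
  (m1 \x m2).-integrable setT (fun p => (u p.1 * v p.2)%:E) /\
  \int[m1 \x m2]_p (u p.1 * v p.2)%:E =
    \int[m1]_x (u x)%:E * \int[m2]_y (v y)%:E.
Proof.
move=> iu iv.
have mu : measurable_fun setT u by apply/measurable_EFinP; exact: measurable_int iu.
have mv : measurable_fun setT v by apply/measurable_EFinP; exact: measurable_int iv.
have muv : measurable_fun setT (fun p : T1 * T2 => (u p.1 * v p.2)%:E).
  apply/measurable_EFinP; apply: measurable_funM.
    exact: (measurableT_comp mu measurable_fst).
  exact: (measurableT_comp mv measurable_snd).
have iuv : (m1 \x m2).-integrable setT (fun p => (u p.1 * v p.2)%:E).
  apply: (proj2 (@integrable12ltyP _ _ _ _ _ m1 m2 _ muv)).
  have -> : \int[m1]_x \int[m2]_y `|(u x * v y)%:E| =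
      \int[m1]_x (`|(u x)%:E| * \int[m2]_y `|(v y)%:E|).
    apply: eq_integral => x _; rewrite -ge0_integralZl; [|exact: measurableT| | |] => //.
      by apply: eq_integral => y _; rewrite -abseM -EFinM.
    by apply: measurableT_comp => //; exact/measurable_EFinP.
  have /integrableP[_ iu'] := iu; have /integrableP[_ iv'] := iv.
  under eq_integral do rewrite muleC.
  rewrite ge0_integralZl; [|exact: measurableT| | |] => //.
  - rewrite muleC lte_mul_pinfty ?integral_ge0// ge0_fin_numE ?integral_ge0//.
  - by apply: measurableT_comp => //; exact/measurable_EFinP.
  - exact: integral_ge0.
split => //; rewrite -integral12_prod_meas1//.
have iv_fin : \int[m2]_y (v y)%:E \is a fin_num by exact: integrable_fin_num.
rewrite muleC -(fineK iv_fin) -integralZl//.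
apply: eq_integral => x _; rewrite /fubini_F/=; under eq_integral do rewrite EFinM.
by rewrite integralZl// muleC (fineK iv_fin).
Qed.

(** By the addition formulas for cosine and sine, each term other than the product of the two cosine
    integrals contains a vanishing sine integral. *)
Lemma trig_integral_prod d1 d2 (T1 : measurableType d1) (T2 : measurableType d2)
    (m1 : {sigma_finite_measure set T1 -> \bar R})
    (m2 : {sigma_finite_measure set T2 -> \bar R}) F1 F2 th1 th2 c1 c2 :
  trig_integral m1 F1 th1 c1 -> trig_integral m2 F2 th2 c2 ->
  trig_integral (m1 \x m2) (fun p => F1 p.1 * F2 p.2)%R
    (fun p => th1 p.1 + th2 p.2)%R (c1 * c2).
Proof.
move=> [i1 mt1 cos1 sin1] [i2 mt2 cos2 sin2].
have [ic1 is1] : m1.-integrable setT (fun x => (F1 x * cos (th1 x))%:E) /\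
    m1.-integrable setT (fun x => (F1 x * sin (th1 x))%:E).
  split; apply: integrable_mul_bounded => //.
  - exact: measurable_cos_comp.
  - by move=> x; exact: cos_max.
  - exact: measurable_sin_comp.
  - by move=> x; exact: sin_max.
have [ic2 is2] : m2.-integrable setT (fun x => (F2 x * cos (th2 x))%:E) /\
    m2.-integrable setT (fun x => (F2 x * sin (th2 x))%:E).
  split; apply: integrable_mul_bounded => //.
  - exact: measurable_cos_comp.
  - by move=> x; exact: cos_max.
  - exact: measurable_sin_comp.
  - by move=> x; exact: sin_max.
have [icc Icc] := integral_prod_mul ic1 ic2.
have [iss Iss] := integral_prod_mul is1 is2.
have [ics Ics] := integral_prod_mul ic1 is2.
have [isc Isc] := integral_prod_mul is1 ic2.
have [i12 _] := integral_prod_mul i1 i2.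
split => //.
- by apply: measurable_funD; [exact: (measurableT_comp mt1 measurable_fst)|exact: (measurableT_comp mt2 measurable_snd)].
- transitivity (\int[m1 \x m2]_p ((F1 p.1 * cos (th1 p.1) * (F2 p.2 * cos (th2 p.2)))%:E
      - (F1 p.1 * sin (th1 p.1) * (F2 p.2 * sin (th2 p.2)))%:E)).
    by apply: eq_integral => p _; rewrite -EFinB cosD; congr EFin; ring.
  by rewrite integralB// Icc Iss cos1 cos2 sin1 sin2 mule0 sube0.
- transitivity (\int[m1 \x m2]_p ((F1 p.1 * sin (th1 p.1) * (F2 p.2 * cos (th2 p.2)))%:E
      + (F1 p.1 * cos (th1 p.1) * (F2 p.2 * sin (th2 p.2)))%:E)).
    by apply: eq_integral => p _; rewrite -EFinD sinD; congr EFin; ring.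
  by rewrite integralD// Isc Ics sin1 sin2 mule0 mul0e adde0.
Qed.

Lemma trig_integral_pushforward d1 d2 (T1 : measurableType d1) (T2 : measurableType d2)
    (m : {measure set T1 -> \bar R}) (r : T1 -> T2) F th c :
  measurable_fun setT r -> measurable_fun setT F -> measurable_fun setT th ->
  trig_integral m (F \o r) (th \o r) c -> trig_integral (pushforward m r) F th c.
Proof.
move=> mr mF mth [iF mthr Ic Is].
have key (g : T2 -> R) : measurable_fun setT g ->
    m.-integrable setT (fun x => (g (r x))%:E) ->
    \int[pushforward m r]_y (g y)%:E = \int[m]_x (g (r x))%:E.
  move=> mg ig; have mEg : measurable_fun setT (EFin \o g) by exact/measurable_EFinP.
  exact: (integral_pushforward mr mEg ig measurableT).
split => //.
- have mEF : measurable_fun setT (EFin \o F) by exact/measurable_EFinP.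
  exact: (integrable_pushforward mr mEF iF measurableT).
- rewrite (key (fun y => F y * cos (th y))%R)//.
    by apply: measurable_funM => //; exact: measurable_cos_comp.
  apply: (integrable_mul_bounded (g := fun x => cos (th (r x))) iF).
    exact: measurable_cos_comp.
  by move=> x; exact: cos_max.
- rewrite (key (fun y => F y * sin (th y))%R)//.
    by apply: measurable_funM => //; exact: measurable_sin_comp.
  apply: (integrable_mul_bounded (g := fun x => sin (th (r x))) iF).
    exact: measurable_sin_comp.
  by move=> x; exact: sin_max.
Qed.

Lemma trig_integral_dirac d (T : measurableType d) (a : T) (F th : T -> R) :
  (forall x, F x = 1%R) -> (forall x, th x = 0%R) -> trig_integral (\d_a) F th 1.
Proof.
move=> F1 th0; have -> : F = cst 1%R by apply/funext.
have -> : th = cst 0%R by apply/funext.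
split => //.
- exact: (finite_measure_integrable_cst (\d_a : {finite_measure set T -> \bar R}) 1%R).
- under eq_integral do rewrite /= cos0 mulr1.
  by rewrite integral_dirac// diracT mul1e.
- under eq_integral do rewrite /= sin0 mulr0.
  by rewrite integral0.
Qed.

Lemma trig_integral_rows n d (F : 'rV[R]_d -> R) (th : 'I_n -> 'rV[R]_d -> R) (c : 'I_n -> R) :
  (forall l, trig_integral (lebesgue_rV d) F (th l) (c l)) -> measurable_fun setT F ->
  trig_integral (lebesgue_mx n) (fun z => \prod_l F (row l z))%R
    (fun z => \sum_l th l (row l z))%R (\prod_l c l)%R.
Proof.
have mrow k l : measurable_fun setT (fun z : 'M[R]_(k, d) => row l z).
  apply: measurable_fun_mx => i j; rewrite (_ : (fun _ => _) = (fun z : 'M[R]_(k, d) => z l j)).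
    exact: measurable_mx_entry.
  by apply/funext => z; rewrite mxE.
move=> H mF; elim: n th c H => [|n IH] th c H.
  rewrite big_ord0; apply: trig_integral_dirac => x; exact: big_ord0.
have H0 := H ord0.
have := IH (fun l => th (lift ord0 l)) (fun l => c (lift ord0 l)) (fun l => H (lift ord0 l)).
move=> /(trig_integral_prod H0) HP.
rewrite big_ord_recl.
apply: (@trig_integral_pushforward _ _ _ _ (lebesgue_rV d \x lebesgue_mx n) _ _ _ _ (@measurable_rows_cons R d n)).
- by apply: measurable_prod => l _; exact: (measurableT_comp mF (mrow _ _)).
- apply: measurable_sum => l; have [_ mth _ _] := H l.
  exact: (measurableT_comp mth (mrow _ _)).
- move: HP; congr trig_integral.
    apply/funext => p /=; rewrite big_ord_recl row_rows_cons0; congr (_ * _)%R.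
    by apply: eq_bigr => l _; rewrite row_rows_cons_lift.
  apply/funext => p /=; rewrite big_ord_recl row_rows_cons0; congr (_ + _)%R.
  by apply: eq_bigr => l _; rewrite row_rows_cons_lift.
Qed.

Lemma trig_integral_rV n (F : R -> R) (th : 'I_n -> R -> R) (c : 'I_n -> R) :
  (forall l, trig_integral lebesgue_measure F (th l) (c l)) -> measurable_fun setT F ->
  trig_integral (lebesgue_rV n) (fun x => \prod_l F (x ord0 l))%R
    (fun x => \sum_l th l (x ord0 l))%R (\prod_l c l)%R.
Proof.
move=> H mF; elim: n th c H => [|n IH] th c H.
  rewrite big_ord0; apply: trig_integral_dirac => x; exact: big_ord0.
have H0 := H ord0.
have := IH (fun l => th (lift ord0 l)) (fun l => c (lift ord0 l)) (fun l => H (lift ord0 l)).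
move=> /(trig_integral_prod H0) HP.
rewrite big_ord_recl.
apply: (@trig_integral_pushforward _ _ _ _ (lebesgue_measure \x lebesgue_rV n) _ _ _ _ (@measurable_row_cons R n)).
- by apply: measurable_prod => l _; exact: (measurableT_comp mF (measurable_mx_entry _ _)).
- apply: measurable_sum => l; have [_ mth _ _] := H l.
  exact: (measurableT_comp mth (measurable_mx_entry _ _)).
- move: HP; congr trig_integral.
    apply/funext => p /=; rewrite big_ord_recl mxE unlift_none; congr (_ * _)%R.
    by apply: eq_bigr => l _; rewrite mxE liftK.
  apply/funext => p /=; rewrite big_ord_recl mxE unlift_none; congr (_ + _)%R.
  by apply: eq_bigr => l _; rewrite mxE liftK.
Qed.

End trig_integral.

(** * The Laplace and Cauchy kernels on the line *)

Section kernel.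
Context {R : realType}.

(** Twice the integral over the half-line. [f] may have a corner at 0, as [laplace] does, so the
    antiderivative is taken of a function [g] that agrees with [f] only on the half-line; [F] is
    then differentiable at 0 as well, hence continuous there. *)
Lemma integral_even_antiderivative (f g F : R -> R) (l : R) :
  (forall x, 0 <= f x) -> continuous f -> (forall x, f (- x) = f x) ->
  (forall x, 0 <= x -> f x = g x) ->
  (forall x : R, is_derive x (1 : R) F (g x)) -> F x @[x --> +oo%R] --> l ->
  (\int[lebesgue_measure]_x (f x)%:E = (2 * (l - F 0))%:E)%E.
Proof.
move=> f0 cf fN fg dF Fl.
rewrite ge0_symfun_integralT//; last by move=> x /=; rewrite fN.
rewrite (_ : [set x | _] = `[0, +oo[%classic); last first.
  by apply/seteqP; split => x/=; rewrite in_itv/= andbT.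
rewrite EFinM; congr (_ * _)%E.
rewrite (@ge0_continuous_FTC2y _ f F 0 l)//.
- exact: continuous_subspaceT.
- apply: cvg_at_right_filter.
  have /derivable1_diffP/differentiable_continuous := @ex_derive _ _ _ _ _ _ _ (dF 0).
  exact.
- move=> x; rewrite in_itv/= andbT => x0; rewrite derive1E fg ?ltW//.
  exact: (@derive_val _ _ _ _ _ _ _ (dF x)).
Qed.

Lemma cvg_expRNM (e : R) : 0 < e -> expR (- (e * x)) @[x --> +oo] --> (0 : R).
Proof.
move=> e0; apply: (@cvg_comp _ _ _ (fun x : R => e * x) (fun z => expR (- z)) _ (pinfty_nbhs R)).
  exact: gt0_cvgMry.
exact: cvgr_expR.
Qed.

Definition laplace (e t : R) : R := expR (- (e * `|t|)).

Lemma continuous_laplace e : continuous (laplace e).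
Proof.
move=> t; apply: (@continuous_comp _ _ _ (fun t : R => - (e * `|t|)) expR); last exact: continuous_expR.
apply: cvgN; apply: cvgMl_tmp; exact: norm_continuous.
Qed.

Lemma is_derive_linear (c x : R) : is_derive x (1 : R) (fun t : R => c * t) c.
Proof. by apply: (is_derive_eq (is_deriveZ c (is_derive_id x (1 : R)))); exact: mulr1. Qed.

Lemma is_derive_expRM (c x : R) :
  is_derive x (1 : R) (fun t : R => expR (c * t)) (c * expR (c * x)).
Proof.
apply: (is_derive_eq (is_derive1_comp (is_derive_expR (c * x)) (is_derive_linear c x))).
exact: mulrC.
Qed.

Lemma is_derive_cosM (c x : R) :
  is_derive x (1 : R) (fun t : R => cos (c * t)) (- (c * sin (c * x))).
Proof.
apply: (is_derive_eq (is_derive1_comp (is_derive_cos (c * x)) (is_derive_linear c x))).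
ring.
Qed.

Lemma is_derive_sinM (c x : R) :
  is_derive x (1 : R) (fun t : R => sin (c * t)) (c * cos (c * x)).
Proof.
apply: (is_derive_eq (is_derive1_comp (is_derive_sin (c * x)) (is_derive_linear c x))).
exact: mulrC.
Qed.

Lemma continuous_cosM (c : R) : continuous (fun t : R => cos (c * t)).
Proof.
move=> t; apply: (@continuous_comp _ _ _ (fun t : R => c * t) cos); last exact: continuous_cos.
by apply: cvgMl_tmp; exact: cvg_id.
Qed.

Lemma integral_laplace e : 0 < e ->
  (\int[lebesgue_measure]_t (laplace e t)%:E = (2 / e)%:E)%E.
Proof.
move=> e0; pose F t := - e^-1 * expR (- e * t).
have -> : 2 / e = 2 * (0 - F 0) by rewrite /F mulr0 expR0 mulr1 sub0r opprK.
apply: (@integral_even_antiderivative _ (fun t => expR (- e * t))).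
- by move=> t; exact: expR_ge0.
- exact: continuous_laplace.
- by move=> t; rewrite /laplace normrN.
- by move=> t t0; rewrite /laplace ger0_norm// mulNr.
- move=> t; apply: (is_derive_eq (is_deriveZ (- e^-1) (is_derive_expRM (- e) t))).
  by rewrite /GRing.scale/= mulrA mulrNN mulVf ?mul1r// lt0r_neq0.
- rewrite /F -(mulr0 (- e^-1)); apply: cvgMl_tmp; under eq_fun do rewrite mulNr.
  exact: cvg_expRNM.
Qed.

Lemma integrable_laplace e : 0 < e ->
  lebesgue_measure.-integrable setT (EFin \o laplace e).
Proof.
move=> e0; apply/integrableP; split.
  by apply/measurable_EFinP; apply: continuous_measurable_fun; exact: continuous_laplace.
under eq_integral do rewrite /= ger0_norm ?expR_ge0//.
by rewrite integral_laplace// ltry.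
Qed.

(** [integral_even_antiderivative] asks for a nonnegative integrand, so [cos] is replaced by
    [1 + cos] and the integral of [laplace e] is subtracted afterwards. *)
Lemma integral_laplace_cos e x : 0 < e ->
  (\int[lebesgue_measure]_t (laplace e t * cos (x * t))%:E =
   (2 * e / (e ^+ 2 + x ^+ 2))%:E)%E.
Proof.
move=> e0; set D := e ^+ 2 + x ^+ 2.
have D0 : 0 < D by rewrite ltr_pwDl ?sqr_ge0// exprn_gt0.
have il := integrable_laplace e0.
have ilc : lebesgue_measure.-integrable setT (fun t => (laplace e t * cos (x * t))%:E).
  apply: (@integrable_mul_bounded R _ (measurableTypeR R) (@lebesgue_measure R) _ (fun t => cos (x * t)) il); last by move=> t; exact: cos_max.
  by apply: continuous_measurable_fun; exact: continuous_cosM.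
(* The first term integrates [exp (- e t)]; the second integrates [exp (- e t) cos (x t)] and comes
   from integrating by parts twice. *)
pose F t := - e^-1 * expR (- e * t) +
  D^-1 * (expR (- e * t) * (x * sin (x * t) - e * cos (x * t))).
have : (\int[lebesgue_measure]_t (laplace e t * (1 + cos (x * t)))%:E = (2 * (0 - F 0)%R)%:E)%E.
  apply: (@integral_even_antiderivative _ (fun t => expR (- e * t) * (1 + cos (x * t)))).
  - by move=> t; rewrite mulr_ge0 ?expR_ge0// -lerBlDl sub0r cos_geN1.
  - move=> t; apply: cvgM; first exact: continuous_laplace.
    by apply: cvgD; [exact: cvg_cst|exact: continuous_cosM].
  - by move=> t; rewrite /laplace normrN mulrN cosN.
  - by move=> t t0; rewrite /laplace ger0_norm// mulNr.
  - move=> t.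
    have h1 := is_deriveZ (- e^-1) (is_derive_expRM (- e) t).
    have h2 := is_deriveB (is_deriveZ x (is_derive_sinM x t)) (is_deriveZ e (is_derive_cosM x t)).
    have h3 := is_deriveZ D^-1 (is_deriveM (is_derive_expRM (- e) t) h2).
    apply: (is_derive_eq (is_deriveD h1 h3)); rewrite /GRing.scale/=.
    rewrite (_ : (_ \*: _ - _) t = x * sin (x * t) - e * cos (x * t))//.
    by rewrite /D; field; rewrite !lt0r_neq0.
  - have -> : 0 = - e^-1 * 0 + D^-1 * 0 :> R by rewrite !mulr0 addr0.
    have cE : expR (- e * t) @[t --> +oo] --> (0 : R).
      by under eq_fun do rewrite mulNr; exact: cvg_expRNM.
    apply: cvgD; first exact: cvgMl_tmp.
    apply: cvgMl_tmp; pose C := `|x| + `|e|.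
    apply: (@squeeze_cvgr _ _ _ _ (fun t => - (C * expR (- e * t))) (fun t => C * expR (- e * t))).
    - apply: nearW => t; rewrite -ler_norml normrM (ger0_norm (expR_ge0 _)) [leLHS]mulrC.
      rewrite ler_wpM2r ?expR_ge0//.
      rewrite (le_trans (ler_normB _ _))// lerD// normrM ler_piMr//; [exact: sin_max|exact: cos_max].
    - by rewrite -oppr0 -(mulr0 C); apply: cvgN; apply: cvgMl_tmp.
    - by rewrite -(mulr0 C); apply: cvgMl_tmp.
move=> h.
have : (\int[lebesgue_measure]_t (laplace e t * (1 + cos (x * t)))%:E =
    \int[lebesgue_measure]_t (laplace e t)%:E +
    \int[lebesgue_measure]_t (laplace e t * cos (x * t))%:E)%E.
  rewrite -integralD//; apply: eq_integral => t _.
  by rewrite mulrDr mulr1 EFinD.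
have Ifin := integrable_fin_num measurableT ilc.
rewrite h integral_laplace// -(fineK Ifin) -EFinD => -[hF].
congr EFin; rewrite -[LHS](addKr (2 / e)) -hF /F !mulr0 expR0 cos0 sin0 /D.
by field; rewrite !lt0r_neq0.
Qed.

Lemma integral_odd (f : R -> R) : lebesgue_measure.-integrable setT (EFin \o f) ->
  (forall x, f (- x) = - f x) -> (\int[lebesgue_measure]_x (f x)%:E = 0)%E.
Proof.
move=> intf fN.
have mN : measurable_fun setT (-%R : measurableTypeR R -> measurableTypeR R).
  exact: oppr_measurable.
have mf : measurable_fun setT (EFin \o f) := measurable_int _ intf.
have intfN : lebesgue_measure.-integrable setT ((EFin \o f) \o (-%R : measurableTypeR R -> measurableTypeR R)).
  rewrite (_ : _ \o _ = (fun x => - (f x)%:E)%E); first exact: integrableN.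
  by apply/funext => x /=; rewrite fN EFinN.
have E : (\int[lebesgue_measure]_x (f x)%:E = \int[lebesgue_measure]_x (f (- x))%:E)%E.
  have := integral_pushforward mN mf intfN measurableT.
  rewrite preimage_setT => <-; apply: eq_measure_integral => A mA _.
  by apply/esym; exact: lebesgue_measureN.
have Ifin := integrable_fin_num measurableT intf.
have := integralZl measurableT intf (-1)%R.
rewrite (_ : (\int[_]_(x in _) _ = \int[lebesgue_measure]_x (f (- x))%:E)%E); last first.
  by apply: eq_integral => x _; rewrite /= fN -EFinM mulN1r.
rewrite -E; have -> : (\int[lebesgue_measure]_x (EFin \o f) x = \int[lebesgue_measure]_x (f x)%:E)%E by [].
by rewrite -(fineK Ifin) -EFinM => -[h]; congr EFin; lra.
Qed.

Lemma trig_integral_laplace e x : 0 < e ->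
  trig_integral lebesgue_measure (laplace e) (fun t => x * t) (2 * e / (e ^+ 2 + x ^+ 2)).
Proof.
move=> e0; split.
- exact: integrable_laplace.
- exact: measurable_funM.
- exact: integral_laplace_cos.
- apply: integral_odd.
    apply: (@integrable_mul_bounded R _ (measurableTypeR R) (@lebesgue_measure R) _ (fun t => sin (x * t)) (integrable_laplace e0)).
      by apply: measurable_sin_comp; exact: measurable_funM.
    by move=> t; exact: sin_max.
  by move=> t; rewrite /laplace normrN mulrN sinN mulrN.
Qed.

(** The Fourier transform of [t |-> exp (- |t|)] in the convention with [2 pi], that is, the density
    of the Cauchy law of scale [1 / (2 pi)]. *)
Definition cauchy_density (x : R) : R := 2 / (1 + (2 * pi * x) ^+ 2).

Let den0 (x : R) : 0 < 1 + (2 * pi * x) ^+ 2.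
Proof. by rewrite ltr_pwDl// sqr_ge0. Qed.

Lemma continuous_cauchy_density : continuous cauchy_density.
Proof.
move=> x; apply: cvgM; first exact: cvg_cst.
apply: cvgV; first by rewrite gt_eqF.
apply: cvgD; first exact: cvg_cst.
under eq_fun do rewrite expr2; rewrite expr2.
by apply: cvgM; apply: cvgMl_tmp; exact: cvg_id.
Qed.

Lemma integral_cauchy_density :
  (\int[lebesgue_measure]_x (cauchy_density x)%:E = 1)%E.
Proof.
pose F (t : R) : R := pi^-1 * atan (2 * pi * t).
have -> : 1%E = (2 * (pi^-1 * (pi / 2) - F 0))%:E :> \bar R.
  by rewrite /F mulr0 atan0 mulr0 subr0 mulKf ?gt_eqF ?pi_gt0// divff.
apply: (@integral_even_antiderivative _ cauchy_density).
- by move=> x; rewrite divr_ge0// ltW.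
- exact: continuous_cauchy_density.
- by move=> x; rewrite /cauchy_density mulrN sqrrN.
- by [].
- move=> x; apply: (is_derive_eq (is_deriveZ pi^-1 (is_derive1_comp (is_derive1_atan (2 * pi * x)) (is_derive_linear (2 * pi) x)))).
  rewrite /GRing.scale/= /cauchy_density mulrCA mulrC; congr (_ / _).
  by rewrite mulrCA mulVf ?mulr1// gt_eqF ?pi_gt0.
- apply: cvgMl_tmp; apply: (@cvg_comp _ _ _ (fun x : R => 2 * pi * x) atan _ (pinfty_nbhs R)).
    by apply: gt0_cvgMry => //; rewrite mulr_gt0// pi_gt0.
  exact: cvgy_atan.
Qed.

End kernel.

(** * The inversion formula by Laplace damping *)

Section inversion.
Local Open Scope ereal_scope.
Context {R : realType} (d : nat).
Implicit Types (t u v w y : 'rV[R]_d).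

Definition phase t y : R := (2 * pi * inner_prod t y)%R.

Lemma phaseE t y : phase t y = (\sum_j (2 * pi * y ord0 j) * t ord0 j)%R.
Proof. by rewrite /phase mulr_sumr; apply: eq_bigr => j _; ring. Qed.

Lemma phaseBr t y w : phase t (y - w)%R = (phase t y - phase t w)%R.
Proof.
rewrite /phase -mulrBr -sumrB; congr (_ * _)%R; apply: eq_bigr => j _.
by rewrite !mxE; ring.
Qed.

Lemma measurable_phase dT (S : measurableType dT) (f g : S -> 'rV[R]_d) :
  measurable_fun setT f -> measurable_fun setT g ->
  measurable_fun setT (fun x => phase (f x) (g x)).
Proof.
move=> mf mg; apply: measurable_funM => //; apply: measurable_sum => j.
by apply: measurable_funM; [exact: (measurableT_comp (measurable_mx_entry ord0 j) mf)|
  exact: (measurableT_comp (measurable_mx_entry ord0 j) mg)].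
Qed.

Definition laplace_rV (e : R) t : R := (\prod_j laplace e (t ord0 j))%R.
Definition cauchy_rV v : R := (\prod_j cauchy_density (v ord0 j))%R.
(** The Fourier transform of [laplace_rV e]: a product of Cauchy kernels that concentrates at 0 as
    [e] decreases to 0. *)
Definition laplace_fourier (e : R) u : R :=
  (\prod_j (2 * e / (e ^+ 2 + (2 * pi * u ord0 j) ^+ 2)))%R.

Lemma measurable_laplace_rV e : measurable_fun setT (laplace_rV e).
Proof.
apply: measurable_prod => j _.
apply: (measurableT_comp _ (measurable_mx_entry ord0 j)).
by apply: continuous_measurable_fun; exact: continuous_laplace.
Qed.

Lemma measurable_cauchy_density : measurable_fun setT (@cauchy_density R).
Proof. by apply: continuous_measurable_fun; exact: continuous_cauchy_density. Qed.

Lemma measurable_cauchy_rV : measurable_fun setT cauchy_rV.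
Proof.
apply: measurable_prod => j _.
exact: (measurableT_comp measurable_cauchy_density (measurable_mx_entry ord0 j)).
Qed.

Lemma cauchy_density_ge0 (x : R) : (0 <= cauchy_density x)%R.
Proof. by rewrite divr_ge0// addr_ge0// sqr_ge0. Qed.

Lemma cauchy_rV_ge0 v : (0 <= cauchy_rV v)%R.
Proof. by apply: prodr_ge0 => j _; exact: cauchy_density_ge0. Qed.

Lemma laplace_rV_ge0 e t : (0 <= laplace_rV e t)%R.
Proof. by apply: prodr_ge0 => j _; exact: expR_ge0. Qed.

Lemma laplace_rVE e t : laplace_rV e t = expR (- (e * \sum_j `|t ord0 j|)).
Proof. by rewrite mulr_sumr -sumrN expR_sum. Qed.

Lemma laplace_rV_le1 e t : (0 <= e -> laplace_rV e t <= 1)%R.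
Proof.
move=> e0; rewrite laplace_rVE -expR0 ler_expR lerNl oppr0 mulr_ge0// sumr_ge0//.
Qed.

Lemma laplace_fourier_ge0 e u : (0 <= e -> 0 <= laplace_fourier e u)%R.
Proof.
move=> e0; apply: prodr_ge0 => j _; apply: divr_ge0; first exact: mulr_ge0.
by rewrite addr_ge0 ?sqr_ge0.
Qed.

Lemma laplace_fourier_scale e v : (0 < e)%R ->
  laplace_fourier e (e *: v) = (e^-1 ^+ d * cauchy_rV v)%R.
Proof.
move=> e0; have -> : (e^-1 ^+ d = \prod_(j < d) e^-1)%R by rewrite prodr_const card_ord.
rewrite -big_split/=; apply: eq_bigr => j _.
rewrite mxE /cauchy_density.
rewrite (_ : (e ^+ 2 + _ = e ^+ 2 * (1 + (2 * pi * v ord0 j) ^+ 2))%R); last by ring.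
rewrite invfM !mulrA; congr (_ / _)%R.
by rewrite expr2 invfM; field; rewrite gt_eqF.
Qed.

Lemma measurable_laplace_fourier e : (0 < e)%R -> measurable_fun setT (laplace_fourier e).
Proof.
move=> e0; rewrite (_ : laplace_fourier e = fun u => e^-1 ^+ d * cauchy_rV (e^-1 *: u))%R.
  apply: measurable_funM => //.
  exact: (measurableT_comp measurable_cauchy_rV (@measurable_scalemx R 1 d e^-1)).
apply/funext => u; rewrite -laplace_fourier_scale// scalerA divff ?scale1r//.
by rewrite gt_eqF.
Qed.

Lemma trig_integral_laplace_rV e u : (0 < e)%R ->
  trig_integral (lebesgue_rV d) (laplace_rV e) (fun t => phase t u) (laplace_fourier e u).
Proof.
move=> e0.
have := @trig_integral_rV R d (laplace e) (fun j (s : R) => 2 * pi * u ord0 j * s)%R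
  (fun j => 2 * e / (e ^+ 2 + (2 * pi * u ord0 j) ^+ 2))%R (fun j => trig_integral_laplace _ e0).
move=> /(_ (continuous_measurable_fun (@continuous_laplace R e))).
by congr trig_integral; apply/funext => t; rewrite phaseE.
Qed.

Lemma trig_integral_cauchy_rV :
  trig_integral (lebesgue_rV d) cauchy_rV (fun=> 0%R) 1.
Proof.
have := @trig_integral_rV R d (@cauchy_density R) (fun _ _ => 0%R) (fun=> 1%R).
rewrite (_ : (fun x : 'rV[R]_d => \sum_(l < d) 0)%R = fun=> 0%R); last first.
  by apply/funext => x; rewrite big1.
rewrite (_ : (\prod_(l < d) 1 = 1)%R); last by rewrite big1.
apply; last exact: measurable_cauchy_density.
move=> _; split => //.
- apply/integrableP; split; first by apply/measurable_EFinP; exact: measurable_cauchy_density.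
  under eq_integral do rewrite /= ger0_norm ?cauchy_density_ge0//.
  by rewrite integral_cauchy_density ltry.
- by under eq_integral do rewrite cos0 mulr1; exact: integral_cauchy_density.
- by under eq_integral do rewrite sin0 mulr0; exact: integral0.
Qed.

Lemma integral_cauchy_rV : \int[lebesgue_rV d]_v (cauchy_rV v)%:E = 1.
Proof.
have [_ _ <- _] := trig_integral_cauchy_rV.
by apply: eq_integral => v _; rewrite cos0 mulr1.
Qed.

Lemma trig_integral_shift dT (S : measurableType dT) (m : {measure set S -> \bar R})
    (F th : S -> R) (c a : R) : trig_integral m F th c ->
  \int[m]_x (F x * cos (th x - a))%:E = (c * cos a)%:E.
Proof.
move=> [iF mth Ic Is].
have ic : m.-integrable setT (fun x => (F x * cos (th x))%:E).
  apply: integrable_mul_bounded => //; first exact: measurable_cos_comp.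
  by move=> x; exact: cos_max.
have is_ : m.-integrable setT (fun x => (F x * sin (th x))%:E).
  apply: integrable_mul_bounded => //; first exact: measurable_sin_comp.
  by move=> x; exact: sin_max.
transitivity (\int[m]_x ((cos a)%:E * (F x * cos (th x))%:E + (sin a)%:E * (F x * sin (th x))%:E)).
  by apply: eq_integral => x _; rewrite -!EFinM -EFinD cosB; congr EFin; ring.
rewrite integralD//; [|exact: integrableZl..].
by rewrite !integralZl// Ic Is mule0 adde0 -EFinM mulrC.
Qed.

Variables (phi hat : 'rV[R]_d -> R).
Hypotheses (phi_ge0 : forall y, (0 <= phi y)%R) (phi_cont : continuous phi)
  (hatE : forall t, trig_integral (lebesgue_rV d) phi (phase t) (hat t))
  (hat_ge0 : forall t, (0 <= hat t)%R)
  (hat_int : (lebesgue_rV d).-integrable setT (EFin \o hat)).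

Let phi_meas : measurable_fun setT phi.
Proof. exact: continuous_measurable_mx. Qed.

Let phi_int : (lebesgue_rV d).-integrable setT (EFin \o phi).
Proof. by have [] := hatE 0%R. Qed.

(** Insert the integral defining [hat] and exchange the integrals; the damping factor makes the
    double integral absolutely convergent. Integrating in [t] leaves the kernel
    [laplace_fourier e (y - w)], and the substitution [y = e v + w] turns it into [cauchy_rV v], the
    Jacobian being absorbed. *)
Lemma mollified_inversion e w : (0 < e)%R ->
  \int[lebesgue_rV d]_t (hat t * laplace_rV e t * cos (phase t w))%:E =
  \int[lebesgue_rV d]_v (phi (e *: v + w) * cauchy_rV v)%:E.
Proof.
move=> e0.
have [lap_int _ _ _] := @trig_integral_laplace_rV e 0%R e0.
have [prod_int _] := integral_prod_mul lap_int phi_int.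
pose F (p : 'rV[R]_d * 'rV[R]_d) : \bar R :=
  (laplace_rV e p.1 * phi p.2 * cos (phase p.1 (p.2 - w)%R))%:E.
have intF : (lebesgue_rV d \x lebesgue_rV d).-integrable setT F.
  apply: (integrable_mul_bounded prod_int); last by move=> p; exact: cos_max.
  apply: measurable_cos_comp; apply: measurable_phase => //.
  exact: (measurableT_comp (@measurable_addrmx R 1 d (- w)%R) measurable_snd).
have lapc_int y : (lebesgue_rV d).-integrable setT (fun t => (laplace_rV e t * cos (phase t y))%:E).
  apply: (integrable_mul_bounded lap_int); last by move=> p; exact: cos_max.
  by apply: measurable_cos_comp; exact: measurable_phase.
transitivity (\int[lebesgue_rV d]_t \int[lebesgue_rV d]_y F (t, y)).
  apply: eq_integral => t _; rewrite /F /=.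
  transitivity ((laplace_rV e t)%:E * \int[lebesgue_rV d]_y (phi y * cos (phase t y - phase t w))%:E).
    by rewrite (trig_integral_shift _ (hatE t)) -EFinM; congr EFin; ring.
  rewrite -integralZl//.
    by apply: eq_integral => y _; rewrite -EFinM mulrA phaseBr.
  apply: (integrable_mul_bounded phi_int); last by move=> p; exact: cos_max.
  by apply: measurable_cos_comp; apply: measurable_funB => //; exact: measurable_phase.
rewrite (Fubini intF).
transitivity (\int[lebesgue_rV d]_y (phi y * laplace_fourier e (y - w)%R)%:E).
  apply: eq_integral => y _; rewrite /F /=.
  have [_ _ Ic _] := @trig_integral_laplace_rV e (y - w)%R e0.
  rewrite EFinM -Ic -integralZl//.
  by apply: eq_integral => t _; rewrite -EFinM; congr EFin; ring.
pose g y := (phi (y + w) * laplace_fourier e y)%:E.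
have g0 y : 0 <= g y by rewrite lee_fin mulr_ge0// laplace_fourier_ge0// ltW.
have mlf := measurable_laplace_fourier e0.
have mg : measurable_fun setT g.
  apply/measurable_EFinP; apply: measurable_funM => //.
  exact: (measurableT_comp phi_meas (@measurable_addrmx R 1 d w)).
rewrite -(ge0_integral_shift (mu := lebesgue_rV d) (f := fun y => (phi y * laplace_fourier e (y - w)%R)%:E) w); last 3 first.
- exact: lebesgue_rV_translation.
- apply/measurable_EFinP; apply: measurable_funM => //.
  exact: (measurableT_comp mlf (@measurable_addrmx R 1 d (- w)%R)).
- by move=> y; rewrite lee_fin mulr_ge0// laplace_fourier_ge0// ltW.
under eq_integral do rewrite addrK -/(g _).
have ne0 : (e != 0)%R by rewrite gt_eqF.
have := ge0_integral_rV_scale ne0 mg g0.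
rewrite gtr0_norm// => H.
have c0 : (0 <= e^-1 ^+ d)%R by rewrite exprn_ge0// invr_ge0 ltW.
have : (e^-1 ^+ d)%:E * \int[lebesgue_rV d]_y g y =
    (e^-1 ^+ d)%:E * \int[lebesgue_rV d]_v (phi (e *: v + w) * cauchy_rV v)%:E.
  rewrite -H -ge0_integralZl; [|exact: measurableT| | |] => //.
  - apply: eq_integral => v _; rewrite /g laplace_fourier_scale// -EFinM.
    by congr EFin; ring.
  - apply/measurable_EFinP; apply: measurable_funM; last exact: measurable_cauchy_rV.
    apply: (measurableT_comp phi_meas).
    exact: (measurableT_comp (@measurable_addrmx R 1 d w) (@measurable_scalemx R 1 d e)).
  - by move=> v _; rewrite lee_fin mulr_ge0// cauchy_rV_ge0.
move=> /(congr1 (fun z => (e ^+ d)%:E * z)); rewrite !muleA -!EFinM -!exprMn.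
by rewrite divff// expr1n !mul1e.
Qed.

Let eps (k : nat) : R := k.+1%:R^-1.

Let eps_gt0 k : (0 < eps k)%R. Proof. by rewrite invr_gt0. Qed.

Let cvg_eps : eps k @[k --> \oo] --> (0 : R)%R.
Proof. exact: cvg_harmonic. Qed.

Lemma cvg_phi_eps v w : (phi (eps k *: v + w)%R)%:E @[k --> \oo] --> (phi w)%:E.
Proof.
apply: cvg_EFin; first exact: nearW.
have : (eps k *: v + w)%R @[k --> \oo] --> w.
  rewrite -[X in _ --> X]add0r -(scale0r v); apply: cvgD; last exact: cvg_cst.
  exact: cvgZr_tmp.
by move=> h; apply: (@cvg_comp _ _ _ (fun k => eps k *: v + w)%R phi _ (nbhs w)) => //; exact: phi_cont.
Qed.

Let mphi_eps k w : measurable_fun setT (fun v => (phi (eps k *: v + w) * cauchy_rV v)%:E).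
Proof.
apply/measurable_EFinP; apply: measurable_funM; last exact: measurable_cauchy_rV.
apply: (measurableT_comp phi_meas).
exact: (measurableT_comp (@measurable_addrmx R 1 d w) (@measurable_scalemx R 1 d (eps k))).
Qed.

Let cvg_phi_cauchy v w : (phi (eps k *: v + w)%R * cauchy_rV v)%:E @[k --> \oo] --> (phi w * cauchy_rV v)%:E.
Proof.
under eq_fun do rewrite EFinM; rewrite EFinM.
by apply: cvgeZr => //; exact: cvg_phi_eps.
Qed.

Let integrable_hat_laplace k w :
  (lebesgue_rV d).-integrable setT (fun t => (hat t * laplace_rV (eps k) t * cos (phase t w))%:E).
Proof.
under eq_fun do rewrite -mulrA; apply: (integrable_mul_bounded hat_int).
  apply: measurable_funM; first exact: measurable_laplace_rV.
  by apply: measurable_cos_comp; exact: measurable_phase.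
move=> t; rewrite normrM (ger0_norm (laplace_rV_ge0 _ _)).
by rewrite mulr_ile1// ?laplace_rV_ge0 ?laplace_rV_le1 ?cos_max// ltW.
Qed.

Lemma integral_mollified_le k w :
  \int[lebesgue_rV d]_v (phi (eps k *: v + w) * cauchy_rV v)%:E <= \int[lebesgue_rV d]_t (hat t)%:E.
Proof.
rewrite -mollified_inversion//; apply: le_integral => //.
- move=> t _; rewrite lee_fin -mulrA ler_piMr//.
  rewrite (le_trans (ler_norm _))// normrM (ger0_norm (laplace_rV_ge0 _ _)).
  by rewrite mulr_ile1// ?laplace_rV_ge0 ?laplace_rV_le1 ?cos_max// ltW.
Qed.

(** Fatou's lemma for [mollified_inversion] as the damping vanishes: by continuity the integrands
    tend to [phi w * cauchy_rV v], of total mass [phi w], while their integrals never exceed that of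
    [hat]. *)
Lemma phi_bounded w : (phi w <= fine (\int[lebesgue_rV d]_t (hat t)%:E))%R.
Proof.
have Mfin := integrable_fin_num measurableT hat_int.
rewrite -lee_fin fineK//.
have -> : (phi w)%:E = \int[lebesgue_rV d]_v (phi w * cauchy_rV v)%:E.
  under eq_integral do rewrite EFinM.
  rewrite ge0_integralZl; [|exact: measurableT| | |] => //.
  - by rewrite integral_cauchy_rV mule1.
  - by apply/measurable_EFinP; exact: measurable_cauchy_rV.
  - by move=> v _; rewrite lee_fin cauchy_rV_ge0.
  - by rewrite lee_fin.
have := @fatou _ _ _ (lebesgue_rV d) setT measurableT _ (fun k => mphi_eps k w).
have pos k v : setT v -> 0 <= (phi (eps k *: v + w) * cauchy_rV v)%:E.
  by move=> _; rewrite lee_fin mulr_ge0// cauchy_rV_ge0.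
move=> /(_ pos); under eq_integral => v _ do rewrite (cvg_limn_einf_sup (@cvg_phi_cauchy v w)).1.
move=> H; apply: (le_trans H); rewrite limn_einf_lim.
apply: lime_le; first exact: is_cvg_einfs.
apply: nearW => k; apply: le_trans (integral_mollified_le k w).
by apply: ereal_inf_lbound; exists k => /=.
Qed.

(** Let the damping vanish on both sides of [mollified_inversion]. The left side is dominated by
    [hat], the right side by [M * cauchy_rV] thanks to [phi_bounded], and [cauchy_rV] has mass 1. *)
Lemma fourier_inversion w : \int[lebesgue_rV d]_t (hat t * cos (phase t w))%:E = (phi w)%:E.
Proof.
pose f k t := (hat t * laplace_rV (eps k) t * cos (phase t w))%:E.
pose M := fine (\int[lebesgue_rV d]_t (hat t)%:E).
have c1 : \int[lebesgue_rV d]_t f k t @[k --> \oo] --> \int[lebesgue_rV d]_t (hat t * cos (phase t w))%:E.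
  have [] // := @dominated_convergence _ _ _ (lebesgue_rV d) setT measurableT f
    (fun t => (hat t * cos (phase t w))%:E) (EFin \o hat).
  - by move=> k; exact: measurable_int (integrable_hat_laplace k w).
  - apply/measurable_EFinP; apply: measurable_funM.
      by apply/measurable_EFinP; exact: measurable_int hat_int.
    by apply: measurable_cos_comp; exact: measurable_phase.
  - apply: aeW => t _; apply: cvg_EFin; first exact: nearW.
    apply: cvgMr_tmp; rewrite -[X in _ --> X]mulr1; apply: cvgMl_tmp.
    under eq_fun do rewrite laplace_rVE; rewrite -expR0.
    apply: (@cvg_comp _ _ _ (fun k => - (eps k * \sum_j `|t ord0 j|))%R expR _ (nbhs (0 : R)%R)); last exact: continuous_expR.
    have h : (eps k * \sum_j `|t ord0 j|)%R @[k --> \oo] --> (0 * \sum_j `|t ord0 j|)%R.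
      by apply: cvgMr_tmp; exact: cvg_eps.
    rewrite mul0r in h; have h2 := cvgN h; rewrite oppr0 in h2; exact: h2.
  - apply: aeW => t k _; rewrite /f /= lee_fin -mulrA normrM (ger0_norm (hat_ge0 t)) ler_piMr//.
    rewrite normrM (ger0_norm (laplace_rV_ge0 _ _)).
    by rewrite mulr_ile1// ?laplace_rV_ge0 ?laplace_rV_le1 ?cos_max// ltW.
have cauchy_int : (lebesgue_rV d).-integrable setT (EFin \o cauchy_rV).
  by have [] := trig_integral_cauchy_rV.
have c2 : \int[lebesgue_rV d]_v (phi (eps k *: v + w) * cauchy_rV v)%:E @[k --> \oo] -->
    \int[lebesgue_rV d]_v (phi w * cauchy_rV v)%:E.
  have [] // := @dominated_convergence _ _ _ (lebesgue_rV d) setT measurableT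
    (fun k v => (phi (eps k *: v + w) * cauchy_rV v)%:E)
    (fun v => (phi w * cauchy_rV v)%:E) (fun v => M%:E * (cauchy_rV v)%:E).
  - apply/measurable_EFinP; apply: measurable_funM => //; exact: measurable_cauchy_rV.
  - by apply: aeW => v _; exact: cvg_phi_cauchy.
  - exact: integrableZl.
  - apply: aeW => v k _; rewrite /= -EFinM lee_fin normrM !ger0_norm// ?cauchy_rV_ge0//.
    by rewrite ler_wpM2r ?cauchy_rV_ge0//; exact: phi_bounded.
have c1' : \int[lebesgue_rV d]_t f k t @[k --> \oo] --> \int[lebesgue_rV d]_v (phi w * cauchy_rV v)%:E.
  rewrite (_ : (fun k => _) = (fun k => \int[lebesgue_rV d]_v (phi (eps k *: v + w) * cauchy_rV v)%:E))//.
  by apply/funext => k; exact: mollified_inversion.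
rewrite (cvg_unique _ c1 c1')//.
under eq_integral do rewrite EFinM.
rewrite integralZl//.
by rewrite [X in _ * X]integral_cauchy_rV mule1.
Qed.

End inversion.

(** * The section function *)

Section section_formula.
Local Open Scope ereal_scope.
Context {R : realType} (d : nat) (phi hat : 'rV[R]_d -> R).
Hypotheses (phi_ge0 : forall y, (0 <= phi y)%R) (phi_cont : continuous phi)
  (hatE : forall t, trig_integral (lebesgue_rV d) phi (phase t) (hat t))
  (hat_ge0 : forall t, (0 <= hat t)%R)
  (hat_int : (lebesgue_rV d).-integrable setT (EFin \o hat)).

Let phi_meas : measurable_fun setT phi.
Proof. exact: continuous_measurable_mx. Qed.

Let hat_meas : measurable_fun setT hat.
Proof. by apply/measurable_EFinP; exact: measurable_int hat_int. Qed.

Lemma measurable_row m n (i : 'I_m) : measurable_fun setT (row i : 'M[R]_(m, n) -> 'rV[R]_n).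
Proof.
apply: measurable_fun_mx => k j.
rewrite (_ : (fun _ => _) = (fun x : 'M[R]_(m, n) => x i j)); first exact: measurable_mx_entry.
by apply/funext => x; rewrite mxE.
Qed.

Lemma measurable_prod_rows n : measurable_fun setT
  (fun x : 'M[R]_(n, d) => \prod_i phi (row i x))%R.
Proof.
by apply: measurable_prod => i _; exact: (measurableT_comp phi_meas (@measurable_row _ _ i)).
Qed.

Lemma phase_hyperplane n (y : 'rV[R]_n.+1) k (s : 'rV[R]_d) (z : 'M[R]_(n, d)) :
  (phase s (row k (hyperplane_graph y k z)) =
   - \sum_l phase (y ord0 (lift k l) / y ord0 k *: s) (row l z))%R.
Proof.
rewrite row_hyperplane_graph /phase -mulr_sumr -mulrN; congr (_ * _)%R.
rewrite /inner_prod exchange_big/= -[RHS]sumrN; apply: eq_bigr => j _.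
rewrite mxE summxE mulrN; congr (- _)%R; rewrite mulr_sumr; apply: eq_bigr => l _.
by rewrite !mxE; ring.
Qed.

(** Inversion turns the factor at block [k] into an integral over [s] whose phase splits over the
    free blocks, so the integral in [z] factors. The result singles out [k]; substituting
    [s = y_k t] gives [a_l s = y_l t], which is symmetric in all blocks, at the price of
    [|y_k|^d]. *)
Lemma integral_hyperplane_graph n (y : 'rV[R]_n.+1) k : (y ord0 k != 0)%R ->
  \int[lebesgue_mx n]_z (\prod_i phi (row i (hyperplane_graph y k z)))%:E =
  (`|y ord0 k| ^+ d)%:E * \int[lebesgue_rV d]_t (\prod_i hat (y ord0 i *: t))%:E.
Proof.
move=> yk; pose a l := (y ord0 (lift k l) / y ord0 k)%R.
pose th (s : 'rV[R]_d) (z : 'M[R]_(n, d)) : R := (\sum_l phase (a l *: s) (row l z))%R.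
have rowsE s : trig_integral (lebesgue_mx n) (fun z => \prod_l phi (row l z))%R (th s)
    (\prod_l hat (a l *: s))%R.
  exact: (@trig_integral_rows R n d phi (fun l => phase (a l *: s)) (fun l => hat (a l *: s))
    (fun l => hatE _) phi_meas).
have [phi_int _ _ _] := rowsE 0%R.
have [prod_int _] := integral_prod_mul phi_int hat_int.
pose F (p : 'M[R]_(n, d) * 'rV[R]_d) : \bar R :=
  (\prod_l phi (row l p.1) * hat p.2 * cos (th p.2 p.1))%:E.
have intF : (lebesgue_mx n \x lebesgue_rV d).-integrable setT F.
  apply: (integrable_mul_bounded prod_int); last by move=> p; exact: cos_max.
  apply: measurable_cos_comp; apply: measurable_sum => l; apply: measurable_phase.
    exact: (measurableT_comp (@measurable_scalemx R 1 d (a l)) measurable_snd).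
  exact: (measurableT_comp (@measurable_row _ _ l) measurable_fst).
have mth s : measurable_fun setT (th s) by have [] := rowsE s.
transitivity (\int[lebesgue_mx n]_z \int[lebesgue_rV d]_s F (z, s)).
  apply: eq_integral => z _; rewrite (bigD1_ord k)//= EFinM muleC.
  rewrite -(fourier_inversion phi_ge0 phi_cont hatE hat_ge0 hat_int) -integralZl//.
    apply: eq_integral => s _; rewrite -EFinM /F/=; congr EFin.
    rewrite phase_hyperplane cosN mulrA; congr (_ * _ * _)%R.
    by apply: eq_bigr => l _; rewrite row_hyperplane_graph_lift.
  apply: (integrable_mul_bounded hat_int); last by move=> p; exact: cos_max.
  by apply: measurable_cos_comp; exact: measurable_phase.
rewrite (Fubini intF).
pose g (s : 'rV[R]_d) : \bar R := (hat s * \prod_l hat (a l *: s))%:E.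
have g0 s : 0 <= g s by rewrite lee_fin mulr_ge0// prodr_ge0.
have mg : measurable_fun setT g.
  apply/measurable_EFinP; apply: measurable_funM => //; apply: measurable_prod => l _.
  exact: (measurableT_comp hat_meas (@measurable_scalemx R 1 d (a l))).
transitivity (\int[lebesgue_rV d]_s g s).
  apply: eq_integral => s _; rewrite /F/= /g EFinM.
  have [_ _ <- _] := rowsE s; rewrite -integralZl//.
    by apply: eq_integral => z _; rewrite -EFinM; congr EFin; ring.
  by apply: (integrable_mul_bounded phi_int); [exact: measurable_cos_comp|move=> p; exact: cos_max].
have := ge0_integral_rV_scale yk mg g0.
rewrite (_ : \int[lebesgue_rV d]_x g (y ord0 k *: x)%R =
    \int[lebesgue_rV d]_t (\prod_i hat (y ord0 i *: t))%:E) => [->|].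
  by rewrite muleA -EFinM -exprMn divff ?normr_eq0// expr1n mul1e.
apply: eq_integral => t _; rewrite /g (bigD1_ord k)//=; congr (_ * _)%:E.
by apply: eq_bigr => l _; rewrite scalerA divfK.
Qed.

Lemma unit_coord_neq0 n (y : 'rV[R]_n) : (\sum_i y ord0 i ^+ 2 = 1)%R ->
  exists k, (y ord0 k != 0)%R.
Proof.
move=> y1; apply/existsP; apply: contraT; rewrite negb_exists => /forallP y0.
have : (1 : R)%R != 0%R by exact: oner_neq0.
rewrite -y1 big1 ?eqxx// => i _; have := y0 i; rewrite negbK => /eqP ->.
by rewrite expr0n.
Qed.

Lemma block_section_formula n : exists2 W : R, (0 <= W)%R &
  forall y : 'rV[R]_n.+1, (\sum_i y ord0 i ^+ 2 = 1)%R ->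
    block_section phi y = W%:E * \int[lebesgue_rV d]_t (\prod_i hat (y ord0 i *: t))%:E.
Proof.
(* [n.+1 * d] computes to [d + n * d], so subtracting [d] leaves [n * d]. *)
have [W W0 HW] := @ge0_integral_block_hyperplane_unit R n d (n.+1 * d - d)%N (addKn _ _).
exists W => // y y1.
have [k yk] := unit_coord_neq0 y1.
rewrite /block_section (HW y k)//; last 2 first.
- by apply/measurable_EFinP; exact: measurable_prod_rows.
- by move=> x; rewrite lee_fin prodr_ge0.
rewrite integral_hyperplane_graph// muleA -EFinM -mulrA -exprMn mulVf ?normr_eq0//.
by rewrite expr1n mulr1.
Qed.

Hypothesis phi1 : \int[lebesgue_rV d]_y (phi y)%:E = 1.

Lemma hat_le1 t : (hat t <= 1)%R.
Proof.
have [iphi mth Ic _] := hatE t; rewrite -lee_fin -Ic -phi1; apply: le_integral => //.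
  by apply: (integrable_mul_bounded iphi); [exact: measurable_cos_comp|move=> y; exact: cos_max].
by move=> y _; rewrite lee_fin ler_piMr// cos_le1.
Qed.

(** Some coordinate of a unit vector is nonzero; its factor is a dilate of [hat], hence integrable,
    and the other factors lie between 0 and 1. *)
Lemma integrable_prod_hat n (y : 'rV[R]_n.+1) : (\sum_i y ord0 i ^+ 2 = 1)%R ->
  (lebesgue_rV d).-integrable setT (fun t : 'rV[R]_d => (\prod_i hat (y ord0 i *: t))%:E).
Proof.
move=> y1; have [k yk] := unit_coord_neq0 y1.
have mhat (c : R) : measurable_fun setT (fun t : 'rV[R]_d => hat (c *: t)%R).
  exact: (measurableT_comp hat_meas (@measurable_scalemx R 1 d c)).
have ik : (lebesgue_rV d).-integrable setT (EFin \o (fun t : 'rV[R]_d => hat (y ord0 k *: t)%R)).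
  apply/integrableP; split; first exact/measurable_EFinP.
  under eq_integral do rewrite /= ger0_norm//.
  rewrite (ge0_integral_rV_scale (f := fun t => (hat t)%:E))//; last exact/measurable_EFinP.
  have /fineK <- : \int[lebesgue_rV d]_x (hat x)%:E \is a fin_num.
    exact: integrable_fin_num.
  by rewrite -EFinM ltry.
under eq_fun do rewrite (bigD1_ord k)//=.
apply: (integrable_mul_bounded ik); first by apply: measurable_prod => l _; exact: mhat.
move=> t; rewrite ger0_norm ?prodr_ge0//; apply: prodr_ile1 => l _.
by rewrite hat_ge0 hat_le1.
Qed.

End section_formula.

(** * Hoelder and Karamata inequalities *)

Lemma powR_prod {R : realType} (I : Type) (s : seq I) (F : I -> R) (l : R) :
  (forall i, 0 <= F i) -> (\prod_(i <- s) F i) `^ l = \prod_(i <- s) F i `^ l.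
Proof.
move=> F0; elim: s => [|i s IH]; first by rewrite !big_nil powR1.
by rewrite !big_cons powRM ?IH// prodr_ge0.
Qed.

(** Hoelder's inequality for the conjugate exponents [1 / l] and [1 / (1 - l)]. *)
Lemma ge0_hoelder_powR {R : realType} d (T : measurableType d)
    (mu : {measure set T -> \bar R}) (f g : T -> R) (l : R) :
  0 < l < 1 -> (forall x, 0 <= f x) -> (forall x, 0 <= g x) ->
  mu.-integrable setT (EFin \o f) -> mu.-integrable setT (EFin \o g) ->
  (\int[mu]_x (f x `^ l * g x `^ (1 - l))%:E <=
   (fine (\int[mu]_x (f x)%:E) `^ l * fine (\int[mu]_x (g x)%:E) `^ (1 - l))%:E)%E.
Proof.
move=> /andP[l0 l1] f0 g0 intf intg.
have mf : measurable_fun setT f by apply/measurable_EFinP; exact: measurable_int intf.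
have mg : measurable_fun setT g by apply/measurable_EFinP; exact: measurable_int intg.
have l1' : 0 < 1 - l by lra.
have mpow (h : T -> R) (r : R) : measurable_fun setT h -> measurable_fun setT (fun x => h x `^ r).
  by move=> mh; exact: (measurableT_comp (measurable_powR r) mh).
have Lpow (h : T -> R) (r : R) : 0 < r -> (forall x, 0 <= h x) ->
    mu.-integrable setT (EFin \o h) ->
    ('N[mu]_(r^-1)%:E[EFin \o (fun x => h x `^ r)%R] = (fine (\int[mu]_x (h x)%:E) `^ r)%:E)%E.
  move=> r0 h0 inth; rewrite unlock invrK.
  have Ifin := integrable_fin_num measurableT inth.
  rewrite -poweR_EFin fineK//; congr (poweR _ _); apply: eq_integral => x _.
  by rewrite /= ger0_norm ?powR_ge0// -powRrM divff ?gt_eqF// powRr1.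
have := @hoelder _ _ _ mu (fun x => f x `^ l) (fun x => g x `^ (1 - l)) l^-1 (1 - l)^-1
  (mpow _ _ mf) (mpow _ _ mg).
rewrite !invrK !invr_gt0 subrKC => /(_ l0 l1' erefl).
rewrite !Lpow// -EFinM Lnorm1; apply: le_trans.
rewrite le_eqVlt; apply/orP; left; apply/eqP; apply: eq_integral => x _ /=.
by rewrite ger0_norm// mulr_ge0// powR_ge0.
Qed.

Section karamata.
Context {R : realType} (P : set R) (g : R -> R).
Hypothesis P_itv : forall a b c, P a -> P b -> a <= c <= b -> P c.
Hypothesis g_concave : forall a b l, P a -> P b -> 0 < l < 1 ->
  l * g a + (1 - l) * g b <= g (l * a + (1 - l) * b).

Let slope u v : R := (g u - g v) / (u - v).

Let slopeC u v : slope u v = slope v u.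
Proof. by rewrite /slope -(opprB v u) -(opprB (g v)) invrN mulrNN. Qed.

Let chord a b c : P a -> P c -> a < b < c ->
  (c - b) * g a + (b - a) * g c <= (c - a) * g b.
Proof.
move=> Pa Pc /andP[ab bc]; have ca : 0 < c - a by lra.
have hl : 0 < (c - b) / (c - a) < 1.
  apply/andP; split; first by apply: divr_gt0; lra.
  by rewrite ltr_pdivrMr// mul1r; lra.
have := @g_concave a c ((c - b) / (c - a)) Pa Pc hl.
have -> : 1 - (c - b) / (c - a) = (b - a) / (c - a) by field; rewrite gt_eqF.
have -> : (c - b) / (c - a) * a + (b - a) / (c - a) * c = b by field; rewrite gt_eqF.
by rewrite mulrAC [X in _ + X]mulrAC -mulrDl ler_pdivrMr// [g b * _]mulrC.
Qed.

Let slope_left a b d : P a -> P d -> a < b -> b <= d -> slope a d <= slope a b.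
Proof.
move=> Pa Pd ab; rewrite le_eqVlt => /predU1P[->//|bd].
rewrite slopeC (slopeC a b) /slope ler_pdivlMr ?subr_gt0// mulrAC ler_pdivrMr; last by lra.
by have := chord Pa Pd (introT andP (conj ab bd)); nra.
Qed.

Let slope_right a c d : P a -> P d -> a <= c -> c < d -> slope c d <= slope a d.
Proof.
move=> Pa Pd + cd; rewrite le_eqVlt => /predU1P[->//|ac].
rewrite slopeC (slopeC a d) /slope ler_pdivlMr; last by lra.
rewrite mulrAC ler_pdivrMr; last by lra.
by have := chord Pa Pd (introT andP (conj ac cd)); nra.
Qed.

Let slope_anti_lt a b c d : P a -> P d -> a < b -> c < d -> a <= c -> b <= d ->
  slope c d <= slope a b.
Proof.
move=> Pa Pd ab cd ac bd; exact: le_trans (slope_right Pa Pd ac cd) (slope_left Pa Pd ab bd).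
Qed.

(** By symmetry of [slope] both pairs may be taken increasing; the chord then slides to the right
    one endpoint at a time. *)
Let slope_anti u v u' v' : P u -> P v -> P u' -> P v' -> u != v -> u' != v' ->
  u' <= u -> v' <= v -> slope u v <= slope u' v'.
Proof.
move=> Pu Pv Pu' Pv' + + uu vv.
rewrite !neq_lt => /orP[uv|uv] /orP[uv'|uv'].
- exact: slope_anti_lt.
- by rewrite (slopeC u'); apply: slope_anti_lt => //; lra.
- by rewrite (slopeC u); apply: slope_anti_lt => //; lra.
- by rewrite (slopeC u) (slopeC u'); apply: slope_anti_lt.
Qed.

(* Abel summation as an induction: [delta] is the deficit accumulated by the
   prefix sums so far and [sigma] the slope of the last chord met. *)
Let karamata_aux (xs ys : seq R) (delta sigma : R) :
  size xs = size ys -> (forall x, x \in xs -> P x) -> (forall y, y \in ys -> P y) ->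
  sorted >=%R xs -> sorted >=%R ys -> 0 <= delta ->
  \sum_(x <- xs) x = \sum_(y <- ys) y + delta ->
  (forall k, \sum_(x <- take k xs) x <= \sum_(y <- take k ys) y + delta) ->
  (forall u v, u \in xs -> v \in ys -> (u, v) \in zip xs ys -> u != v ->
    sigma * delta <= slope u v * delta) ->
  sigma * delta <= \sum_(x <- xs) g x - \sum_(y <- ys) g y.
Proof.
elim: xs ys delta sigma => [|x xs IH] [|y ys] delta sigma //=.
  move=> _ _ _ _ _ _; rewrite !big_nil add0r => <- _ _.
  by rewrite mulr0 subr0.
move=> [sz] Px Py sx sy d0 tot pre slo; rewrite !big_cons.
have xy : x <= y + delta.
  by have := pre 1%N; rewrite /= !take0 !big_cons !big_nil !addr0.
pose delta' := delta + y - x.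
have d'0 : 0 <= delta' by rewrite /delta'; lra.
have tot' : \sum_(x <- xs) x = \sum_(y <- ys) y + delta'.
  by move: tot; rewrite !big_cons /delta'; lra.
have pre' k : \sum_(x <- take k xs) x <= \sum_(y <- take k ys) y + delta'.
  by have := pre k.+1; rewrite /= !big_cons /delta'; lra.
have sub := fun s => IH ys delta' s sz (fun u hu => Px u (mem_behead (s := x :: xs) hu))
  (fun u hu => Py u (mem_behead (s := y :: ys) hu)) (path_sorted sx) (path_sorted sy) d'0 tot' pre'.
have [exy|nxy] := eqVneq x y.
  have dd : delta' = delta by rewrite /delta' exy addrK.
  have := sub sigma; rewrite dd exy opprD addrACA subrr add0r; apply => u v hu hv huv uv.
  by apply: slo => //; rewrite in_cons ?hu ?hv ?huv orbT.
have gxy : g x - g y = slope x y * (x - y) by rewrite divfK// subr_eq0.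
have := sub (slope x y); rewrite opprD addrACA gxy => H.
have {}H : slope x y * delta' <= \sum_(j <- xs) g j - \sum_(j <- ys) g j.
  apply: H => u v hu hv _ uv; apply: ler_wpM2r => //.
  have ux : u <= x.
    have := order_path_min (rev_trans le_trans) sx => /allP/(_ _ hu); exact.
  have vy : v <= y.
    have := order_path_min (rev_trans le_trans) sy => /allP/(_ _ hv); exact.
  apply: slope_anti => //; try by [apply: Px; rewrite mem_head|apply: Py; rewrite mem_head].
    by apply: Px; rewrite in_cons hu orbT.
  by apply: Py; rewrite in_cons hv orbT.
(* The head contributes [slope x y * (x - y)] and the tail at least [slope x y * delta']; together
   they make [slope x y * delta], which [slo] compares with [sigma * delta]. *)
have := slo x y (mem_head _ _) (mem_head _ _) (mem_head _ _) nxy.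
by move: H; rewrite /delta'; nra.
Qed.

(** Only the [ys] are assumed to lie in [P]: majorization keeps the [xs] between the extreme [ys],
    and [P] is an interval. The inequality is then [karamata_aux] with initial deficit 0. The set
    [P] is there because the function to which this applies, the logarithm of a log-concave
    function, is concave only where that function is positive. *)
Lemma karamata (xs ys : seq R) : size xs = size ys ->
  (forall y, y \in ys -> P y) -> sorted >=%R xs -> sorted >=%R ys ->
  \sum_(x <- xs) x = \sum_(y <- ys) y ->
  (forall k, \sum_(x <- take k xs) x <= \sum_(y <- take k ys) y) ->
  (forall x, x \in xs -> P x) /\ \sum_(y <- ys) g y <= \sum_(x <- xs) g x.
Proof.
move=> sz Py sx sy tot pre.
have up x : x \in xs -> exists2 y, y \in ys & x <= y.
  move: xs ys sz {Py} sx sy tot pre => [|x0 xs] [|y0 ys] //= _ sx sy _ pre.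
  have x0y0 : x0 <= y0 by have := pre 1%N; rewrite /= !take0 !big_cons !big_nil !addr0.
  rewrite in_cons => /predU1P[->|xx]; exists y0; rewrite ?mem_head//.
  apply: le_trans x0y0.
  by have := order_path_min (rev_trans le_trans) sx => /allP/(_ _ xx).
have low x : x \in xs -> exists2 y, y \in ys & y <= x.
  move: xs ys sz {Py up} sx sy tot pre.
  case/lastP => [|xs xl]; first by [].
  case/lastP => [|ys yl]; first by rewrite size_rcons.
  rewrite !size_rcons => -[sz] sx sy; rewrite !big_rcons/= => tot pre.
  (* The prefix sums without the last entry, subtracted from the equal totals, compare the last and
     smallest entries in the reverse direction. *)
  have {}pre : \sum_(r <- xs) r <= \sum_(r <- ys) r.
    by have := pre (size xs); rewrite -!cats1 !take_size_cat.
  have yx : yl <= xl by lra.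
  have yly : yl \in rcons ys yl by rewrite mem_rcons mem_head.
  rewrite mem_rcons in_cons => /predU1P[->|xx]; exists yl => //.
    apply: (le_trans yx); move: sx; rewrite (sorted_pairwise (rev_trans le_trans)) pairwise_rcons.
  by move=> /andP[/allP/(_ _ xx)].
have Px x : x \in xs -> P x.
  move=> xx; have [y1 y1s xy1] := up x xx; have [y2 y2s y2x] := low x xx.
  by apply: (P_itv (Py _ y2s) (Py _ y1s)); rewrite y2x.
split => //; rewrite -subr_ge0 -[leLHS](mulr0 0); apply: karamata_aux => //.
- by rewrite addr0.
- by move=> k; rewrite addr0.
- by move=> *; rewrite !mulr0.
Qed.

End karamata.

(** If the product at [y] is not positive, the other one is at least as large, being nonnegative.
    Otherwise every [f (y_i)] is positive, and Karamata's inequality applies to [ln f] on [P];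
    log-concavity makes [P] an interval and shows that [f] is positive at the coordinates of [x]
    too. *)
Lemma log_concave_prod_majorized {R : realType} n (f : R -> R) (x y : 'rV[R]_n) :
  log_concave_on [set r : R^o | 0 <= r] f ->
  (forall i, 0 <= x ord0 i) -> (forall i, 0 <= y ord0 i) -> majorized x y ->
  \prod_i f (y ord0 i) <= \prod_i f (x ord0 i).
Proof.
move=> [f0 flc] x0 y0 [pre tot].
pose P r := 0 <= r /\ 0 < f r.
have [py|] := ltP 0 (\prod_i f (y ord0 i)); last first.
  move=> py; apply: (le_trans py); apply: prodr_ge0 => i _; exact: (f0 _ (x0 i)).
pose xs := decreasing_rearrangement x; pose ys := decreasing_rearrangement y.
have psort (z : 'rV[R]_n) : perm_eq (decreasing_rearrangement z) [seq z ord0 i | i <- enum 'I_n].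
  by rewrite perm_sort.
have szr (z : 'rV[R]_n) : size (decreasing_rearrangement z) = n.
  by rewrite (perm_size (psort z)) size_map size_enum_ord.
have sumr (z : 'rV[R]_n) (F : R -> R) :
    \sum_(r <- decreasing_rearrangement z) F r = \sum_i F (z ord0 i).
  by rewrite (perm_big _ (psort z)) big_image.
have memr (z : 'rV[R]_n) i : z ord0 i \in decreasing_rearrangement z.
  by rewrite (perm_mem (psort z)) map_f// mem_enum.
have srt (z : 'rV[R]_n) : sorted >=%R (decreasing_rearrangement z).
  by apply: sort_sorted; exact: ge_total.
have fconv a b l : P a -> P b -> 0 < l < 1 -> 0 < f a `^ l * f b `^ (1 - l) <= f (l * a + (1 - l) * b).
  by move=> [a0 fa] [b0 fb] l01; apply/andP; split; [by rewrite mulr_gt0 ?powR_gt0|exact: (flc a b l a0 b0 l01)].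
have Pitv a b c : P a -> P b -> a <= c <= b -> P c.
  move=> Pa Pb /andP[ac cb]; split; first by have [a0 _] := Pa; lra.
  have [<-|nac] := eqVneq a c; first by have [] := Pa.
  have [->|ncb] := eqVneq c b; first by have [] := Pb.
  have ac' : a < c by rewrite lt_neqAle nac.
  have cb' : c < b by rewrite lt_neqAle ncb.
  have l01 : 0 < (b - c) / (b - a) < 1.
    apply/andP; split; first by apply: divr_gt0; lra.
    by rewrite ltr_pdivrMr ?mul1r; lra.
  have /andP[p1 p2] := fconv _ _ _ Pa Pb l01.
  have -> : c = (b - c) / (b - a) * a + (1 - (b - c) / (b - a)) * b.
    by field; rewrite subr_eq0 gt_eqF// (lt_trans ac').
  exact: lt_le_trans p1 p2.
have gc a b l : P a -> P b -> 0 < l < 1 ->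
    l * ln (f a) + (1 - l) * ln (f b) <= ln (f (l * a + (1 - l) * b)).
  move=> Pa Pb l01; have /andP[p1 p2] := fconv _ _ _ Pa Pb l01.
  have [_ fa] := Pa; have [_ fb] := Pb.
  rewrite -!ln_powR -lnM ?posrE ?powR_gt0// ler_ln ?posrE//.
  exact: lt_le_trans p1 p2.
have Py r : r \in ys -> P r.
  rewrite (perm_mem (psort y)) => /mapP[i _ ->]; split => //.
  have fy : 0 <= f (y ord0 i) by exact: (f0 _ (y0 i)).
  rewrite lt_neqAle fy andbT eq_sym.
  by apply: contraTneq py => fi; rewrite (bigD1 i)//= fi mul0r ltxx.
(* [majorized] speaks of [0 < k < n] only; for [k = 0] both sums are empty, and for [k >= n] they
   are the equal totals. *)
have pre' k : \sum_(r <- take k xs) r <= \sum_(r <- take k ys) r.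
  case: k => [|k]; first by rewrite !take0 !big_nil.
  have [kn|nk] := ltnP k.+1 n; first exact: pre.
  by rewrite !take_oversize ?szr// /xs /ys (sumr x id) (sumr y id) tot.
have [Px le_sum] := karamata Pitv gc (etrans (szr x) (esym (szr y))) Py (srt x) (srt y)
  (etrans (sumr x id) (etrans tot (esym (sumr y id)))) pre'.
rewrite !sumr in le_sum.
have expprod (z : 'rV[R]_n) : (forall i, 0 < f (z ord0 i)) ->
    \prod_i f (z ord0 i) = expR (\sum_i ln (f (z ord0 i))).
  by move=> fz; rewrite expR_sum; apply: eq_bigr => i _; rewrite lnK ?posrE.
rewrite !expprod ?ler_expR// => i.
  by have [] := Px _ (memr x i).
by have [] := Py _ (memr y i).
Qed.

(** * Log-convexity and Schur concavity of sections *)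

Section fourier_transform.
Context {R : realType} (d : nat) (phi : 'rV[R]_d -> R).
Hypotheses (phi_int : (lebesgue_rV d).-integrable setT (EFin \o phi))
  (fourier_ge0 : forall x, 0 <= fourier phi x).

(** Nonnegativity in the order of the complex numbers includes a zero imaginary part, which is minus
    the sine integral because of the sign in the exponent. *)
Lemma trig_integral_fourier t :
  trig_integral (lebesgue_rV d) phi (phase t) (complex.Re (fourier phi t)).
Proof.
have mph : measurable_fun setT (phase t) by exact: measurable_phase.
have ic : (lebesgue_rV d).-integrable setT (fun y => (phi y * cos (phase t y))%:E).
  by apply: (integrable_mul_bounded phi_int); [exact: measurable_cos_comp|move=> y; exact: cos_max].
have is_ : (lebesgue_rV d).-integrable setT (fun y => (phi y * sin (phase t y))%:E).
  by apply: (integrable_mul_bounded phi_int); [exact: measurable_sin_comp|move=> y; exact: sin_max].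
split => //.
- rewrite /fourier /Cintegral /=.
  rewrite -[LHS]fineK; last exact: integrable_fin_num.
  congr EFin; congr fine; apply: eq_integral => y _.
  by rewrite /= mul0r subr0 cosN.
- have : complex.Im (fourier phi t) = 0.
    by have := fourier_ge0 t; rewrite lecE => /andP[/eqP -> _].
  rewrite /fourier /Cintegral /= => Im0.
  rewrite -[LHS]fineK; last exact: integrable_fin_num.
  congr EFin; apply/eqP; rewrite -oppr_eq0 -fineN; apply/eqP.
  rewrite -[RHS]Im0 /Rintegral; congr fine.
  rewrite -integralN; last exact: integrable_add_def.
  by apply: eq_integral => y _; rewrite /= mul0r addr0 sinN mulrN EFinN.
Qed.

End fourier_transform.

Lemma std_simplex_conv {R : realType} n (x y : 'rV[R]_n) (l : R) :
  std_simplex x -> std_simplex y -> 0 < l < 1 -> std_simplex (l *: x + (1 - l) *: y).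
Proof.
move=> [x01 x1] [y01 y1] /andP[l0 l1]; split=> [i|].
  by rewrite !mxE; have /andP[? ?] := x01 i; have /andP[? ?] := y01 i; apply/andP; split; nra.
under eq_bigr do rewrite !mxE.
by rewrite big_split/= -!mulr_sumr x1 y1; ring.
Qed.

Section sqrt_simplex_section.
Context {R : realType} (d n : nat) (phi hat : 'rV[R]_d -> R).
Hypotheses (phi_ge0 : forall y, 0 <= phi y) (phi_cont : continuous phi)
  (hatE : forall t, trig_integral (lebesgue_rV d) phi (phase t) (hat t))
  (hat_ge0 : forall t, 0 <= hat t)
  (hat_int : (lebesgue_rV d).-integrable setT (EFin \o hat))
  (phi1 : (\int[lebesgue_rV d]_y (phi y)%:E = 1)%E).

Let P (q : 'rV[R]_n.+1) (t : 'rV[R]_d) := \prod_i hat (Num.sqrt (q ord0 i) *: t).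

Let P_ge0 q t : 0 <= P q t. Proof. exact: prodr_ge0. Qed.

Let prod_sqrtE q t : \prod_i hat ((sqrt_rV q) ord0 i *: t) = P q t.
Proof. by apply: eq_bigr => i _; rewrite mxE. Qed.

Lemma sum_sqr_sqrt_rV (q : 'rV[R]_n.+1) :
  std_simplex q -> \sum_i (sqrt_rV q) ord0 i ^+ 2 = 1.
Proof.
move=> [q01 q1]; rewrite -q1; apply: eq_bigr => i _.
by rewrite mxE sqr_sqrtr//; have /andP[] := q01 i.
Qed.

Let P_int q : std_simplex q -> (lebesgue_rV d).-integrable setT (EFin \o P q).
Proof.
move=> /sum_sqr_sqrt_rV q1.
have := integrable_prod_hat phi_ge0 hatE hat_ge0 hat_int phi1 q1.
by under eq_fun do rewrite prod_sqrtE.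
Qed.

Let P_fin q : std_simplex q -> (\int[lebesgue_rV d]_t (P q t)%:E)%E \is a fin_num.
Proof. by move=> /P_int Pi; exact: integrable_fin_num. Qed.

Let I q : R := fine (\int[lebesgue_rV d]_t (P q t)%:E).

Let I_ge0 q : 0 <= I q.
Proof. by rewrite fine_ge0// integral_ge0// => t _; rewrite lee_fin. Qed.

Lemma block_section_sqrt_rV : exists2 W : R, 0 <= W &
  forall q : 'rV[R]_n.+1, std_simplex q -> block_section phi (sqrt_rV q) =
    (W * fine (\int[lebesgue_rV d]_t (\prod_i hat (Num.sqrt (q ord0 i) *: t))%:E))%:E.
Proof.
have [W W0 SE] := block_section_formula phi_ge0 phi_cont hatE hat_ge0 hat_int n.
exists W => // q sq; rewrite SE ?sum_sqr_sqrt_rV// EFinM fineK; last exact: P_fin.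
by congr (_ * _)%E; apply: eq_integral => t _; rewrite prod_sqrtE.
Qed.

(** For fixed [t] each factor of the product is log-convex in one coordinate of [q], so the product
    is log-convex in [q]; Hoelder's inequality carries this over to the integral. *)
Lemma block_section_log_convex :
  (forall t : 'rV[R]_d, log_convex_on [set r : R^o | 0 <= r]
     (fun r : R^o => hat (Num.sqrt r *: t))) ->
  log_convex_on (@std_simplex R n.+1) (fun q => fine (block_section phi (sqrt_rV q))).
Proof.
have [W W0 SE] := block_section_sqrt_rV.
move=> hlc; split=> [q sq|x y l sx sy l01]; first by rewrite SE//= mulr_ge0// I_ge0.
have sxy := std_simplex_conv sx sy l01.
have /andP[l0 l1] := l01.
(* The constant is split as [W = W^l W^(1 - l)]; this includes [W = 0], since the exponents add up
   to 1 and not to 0. *)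
rewrite !SE//= !powRM ?I_ge0// mulrACA -powRD; last by apply/implyP; rewrite subrKC oner_eq0.
rewrite subrKC powRr1//; apply: ler_wpM2l => //.
rewrite -lee_fin fineK; last exact: P_fin.
apply: le_trans (ge0_hoelder_powR l01 (P_ge0 x) (P_ge0 y) (P_int sx) (P_int sy)).
have mP q a : std_simplex q -> measurable_fun setT (fun t => P q t `^ a).
  move=> sq; apply: (measurableT_comp (measurable_powR a)).
  by apply/measurable_EFinP; exact: measurable_int (P_int sq).
apply: ge0_le_integral => //.
- by move=> t _; rewrite lee_fin P_ge0.
- exact: measurable_int (P_int sxy).
- by apply/measurable_EFinP; apply: measurable_funM; exact: mP.
- move=> t _; rewrite lee_fin /P !powR_prod//; rewrite -big_split/=.
  apply: ler_prod => i _; rewrite hat_ge0/= !mxE.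
  have [_ lc] := hlc t; apply: lc => //=.
    by have [/(_ i)/andP[]] := sx.
  by have [/(_ i)/andP[]] := sy.
Qed.

Lemma block_section_schur_concave :
  (forall t : 'rV[R]_d, log_concave_on [set r : R^o | 0 <= r]
     (fun r : R^o => hat (Num.sqrt r *: t))) ->
  schur_concave_on (@std_simplex R n.+1) (fun q => fine (block_section phi (sqrt_rV q))).
Proof.
have [W W0 SE] := block_section_sqrt_rV.
move=> hlc x y sx sy xy; rewrite !SE//= ler_wpM2l//.
rewrite fine_le ?P_fin//; [exact: P_fin..|]; apply: le_integral => //; [exact: P_int..|].
move=> t _; rewrite lee_fin.
apply: (log_concave_prod_majorized (f := fun r => hat (Num.sqrt r *: t))) => //.
  by move=> i; have [/(_ i)/andP[]] := sx.
by move=> i; have [/(_ i)/andP[]] := sy.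
Qed.

End sqrt_simplex_section.

(** [G] is real-valued through [fine], which would turn an infinite section into 0; the first
    conjunct excludes this. Taking [complex.Re] loses nothing, as [fourier_ge0] makes the transform
    real. [phi_cont] selects the continuous representative of the density. *)
Theorem proposition3p1 (R : realType) (d n : nat) (hd : (0 < d)%N)
    (hn : (0 < n)%N) (mu : probability 'rV[R]_d R) (phi : 'rV[R]_d -> R)
    (phi_ge0 : forall x, 0 <= phi x)
    (phi_cont : continuous phi)
    (phi_density : forall A : set 'rV[R]_d, measurable A ->
       mu A = (\int[lebesgue_rV d]_(x in A) (phi x)%:E)%E)
    (phi_even : forall x, phi (- x) = phi x)
    (fourier_ge0 : forall x, 0 <= fourier phi x)
    (fourier_int : Cintegrable (fourier phi)) :
  let S : 'rV[R]_n -> \bar R := block_section phi in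
  let G : 'rV[R]_n -> R := fun q => fine (S (sqrt_rV q)) in
  [/\ (forall q, @std_simplex R n q -> S (sqrt_rV q) \is a fin_num),
      (forall t : 'rV[R]_d,
         log_convex_on [set r : R^o | 0 <= r]
           (fun r : R^o => complex.Re (fourier phi (Num.sqrt r *: t)))) ->
      log_convex_on (@std_simplex R n) G
    & (forall t : 'rV[R]_d,
         log_concave_on [set r : R^o | 0 <= r]
           (fun r : R^o => complex.Re (fourier phi (Num.sqrt r *: t)))) ->
      schur_concave_on (@std_simplex R n) G].
Proof.
case: n hn => // n _ S G.
have phi1 : (\int[lebesgue_rV d]_y (phi y)%:E = 1)%E.
  by rewrite -phi_density// probability_setT.
have phi_int : (lebesgue_rV d).-integrable setT (EFin \o phi).
  apply/integrableP; split; first by apply/measurable_EFinP; exact: continuous_measurable_mx.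
  by under eq_integral do rewrite /= ger0_norm//; rewrite phi1 ltry.
have hatE := trig_integral_fourier phi_int fourier_ge0.
have hat_ge0 t : 0 <= complex.Re (fourier phi t).
  by have := fourier_ge0 t; rewrite lecE => /andP[].
have [hat_int _] := fourier_int.
split.
- by have [W _ SE] := block_section_sqrt_rV n phi_ge0 phi_cont hatE hat_ge0 hat_int phi1;
    move=> q /SE; rewrite /S => ->.
- exact: (@block_section_log_convex R d n phi _ phi_ge0 phi_cont hatE hat_ge0 hat_int phi1).
- exact: (@block_section_schur_concave R d n phi _ phi_ge0 phi_cont hatE hat_ge0 hat_int phi1).
Qed.
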